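(* Let $T>0$, let $\Omega$ be a bounded domain of $\mathbb R^N$ ($N\geqslant1$) of class $\mathcal C^2$, and let $\omega$ be a nonempty open subset of $\Omega$ with $\omega\subset\subset\Omega$. Let $\omega_1$ be a nonempty regular open set satisfying $\omega\subset\subset\omega_1\subset\subset\Omega$, and consider a function $\theta\in\mathcal C^\infty(\overline\Omega)$ satisfying $$\theta=1\ \text{in }\omega,\qquad \operatorname{Supp}(\theta)\subset\overline{\omega_1},\qquad \theta>0\ \text{in }\omega_1.$$ Then there exists $a\in\mathcal C^\infty(\overline\Omega)$ such that the system $$ \left\{\begin{array}{ll} \partial_ty_1=\Delta y_1+\mathbf 1_\omega u&\text{in }Q_T,\\ \partial_ty_2=\Delta y_2+ay_2+\partial_{x_1}(\theta y_1)&\text{in }Q_T,\\ y=0&\text{on }\Sigma_T,\\ y(0,\cdot)=y^0&\text{in }\Omega \end{array}\right. $$ is not approximately controllable (hence not null controllable) on the time interval $(0,T)$.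
   Context: $Q_T:=(0,T)\times\Omega$, $\Sigma_T:=(0,T)\times\partial\Omega$, $y=(y_1,y_2)$, $y^0\in L^2(\Omega)^2$ is the initial condition, $u\in L^2(Q_T)$ is the control, and $x_1$ is the first space coordinate. $A\subset\subset B$ means that $\overline A$ is a compact subset of the open set $B$. Solutions are understood in $W(0,T)^2$ with $W(0,T):=L^2(0,T;H^1_0(\Omega))\cap H^1(0,T;H^{-1}(\Omega))\hookrightarrow\mathcal C^0([0,T];L^2(\Omega))$; they exist and are unique. The system is approximately controllable on $(0,T)$ if for every $y^0\in L^2(\Omega)^2$, every $y^T\in L^2(\Omega)^2$ and every $\varepsilon>0$ there exists $u\in L^2(Q_T)$ such that the corresponding solution satisfies $\|y(T,\cdot)-y^T\|_{L^2(\Omega)^2}\leqslant\varepsilon$. It is null controllable on $(0,T)$ if for every $y^0\in L^2(\Omega)^2$ there exists $u\in L^2(Q_T)$ such that $y(T,\cdot)=0$ in $\Omega$. *)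

(* Defs.v *)
From HB Require Import structures.
From mathcomp Require Import all_boot all_order all_algebra.
From mathcomp Require Import all_classical all_reals all_analysis.
Set Implicit Arguments.
Unset Strict Implicit.
Unset Printing Implicit Defensive.
Import Order.TTheory GRing.Theory Num.Theory.
Import numFieldNormedType.Exports.
Local Open Scope classical_set_scope.
Local Open Scope ring_scope.

Section BorelRow.
Context {R : realType} (n : nat).

Definition row_coord (i : 'I_n) (x : 'rV[R]_n) : R := x ord0 i.

Let row_set0 : g_sigma_preimage row_coord set0.
Proof. exact: sigma_algebra0. Qed.

Let row_setC A : g_sigma_preimage row_coord A ->
  g_sigma_preimage row_coord (~` A).
Proof. exact: sigma_algebraC. Qed.

Let row_bigcup (F : (set 'rV[R]_n)^nat) :
  (forall i, g_sigma_preimage row_coord (F i)) ->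
  g_sigma_preimage row_coord (\bigcup_i (F i)).
Proof. exact: sigma_algebra_bigcup. Qed.

(* The sigma-algebra generated by the coordinates is the Borel one. *)
HB.instance Definition _ := @isMeasurable.Build default_measure_display
  'rV[R]_n (g_sigma_preimage row_coord) row_set0 row_setC row_bigcup.

End BorelRow.

Definition cons_row {R : realType} {n : nat} (p : R * 'rV[R]_n) : 'rV[R]_n.+1 :=
  row_mx (const_mx p.1 : 'rV_1) p.2.

Lemma measurable_row_coord {R : realType} {n : nat} (i : 'I_n) :
  measurable_fun [set: 'rV[R]_n] (row_coord i).
Proof.
move=> _ Y mY; rewrite setTI; apply: sub_sigma_algebra => /=.
rewrite -bigcup_seq/=; exists i => /=; first by rewrite mem_index_enum.
by exists Y => //; rewrite setTI.
Qed.

Lemma measurable_fun_row {R : realType} {n : nat} {d : measure_display}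
    {T : measurableType d} (f : T -> 'rV[R]_n) :
  (forall i, measurable_fun [set: T] (row_coord i \o f)) ->
  measurable_fun [set: T] f.
Proof.
move=> mf; suff : g_sigma_preimage (fun i => row_coord i \o f) `<=` measurable.
  by rewrite g_sigma_preimage_comp => h _ A mA; apply: h; exists A.
apply: smallest_sub; first exact: sigma_algebra_measurable.
case: n => [|n] in f mf *; first by rewrite big_ord0.
rewrite -bigcup_mkord_ord => A [i /= Hi] [B mB <-]; exact: mf.
Qed.

Lemma measurable_cons_row {R : realType} {n : nat} :
  measurable_fun [set: R * 'rV[R]_n] (@cons_row R n).
Proof.
apply: measurable_fun_row => i; case: (@split_ordP 1 n i) => j ->.
  rewrite (_ : _ \o _ = fst)//; apply/funext => p.
  by rewrite [LHS](@row_mxEl _ 1 1 n) mxE.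
rewrite (_ : _ \o _ = row_coord j \o snd); last first.
  by apply/funext => p; exact: (@row_mxEr _ 1 1 n).
by apply: measurableT_comp => //; exact: measurable_row_coord.
Qed.

Definition uncons_row {R : realType} {n : nat} (x : 'rV[R]_n.+1) :
    R * 'rV[R]_n :=
  (x ord0 ord0, \row_j x ord0 (lift ord0 j)).

Lemma cons_rowK {R : realType} {n : nat} :
  cancel (@cons_row R n) (@uncons_row R n).
Proof.
move=> [a v]; rewrite /uncons_row /cons_row; congr pair.
  rewrite (_ : ord0 = lshift n (ord0 : 'I_1)); last exact/val_inj.
  by rewrite [LHS](@row_mxEl _ 1 1 n) mxE.
apply/rowP => j; rewrite mxE.
rewrite (_ : lift ord0 j = rshift 1 j); last exact/val_inj.
exact: (@row_mxEr _ 1 1 n).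
Qed.

Lemma measurable_uncons_row {R : realType} {n : nat} :
  measurable_fun [set: 'rV[R]_n.+1] (@uncons_row R n).
Proof.
apply: measurable_fun_pair; first exact: (measurable_row_coord ord0).
apply: measurable_fun_row => i.
rewrite (_ : _ \o _ = row_coord (lift ord0 i)).
  exact: measurable_row_coord.
by apply/funext => x; rewrite /= /row_coord mxE.
Qed.

Section LebesgueStep.
Context {R : realType} {n : nat}.
Variable m : {sigma_finite_measure set 'rV[R]_n -> \bar R}.
Local Open Scope ereal_scope.

Notation mu1 := (@lebesgue_measure R).

(* Product of the Lebesgue measure on R with a measure on R^n, carried by R^n.+1. *)
Definition lebesgue_step : set 'rV[R]_n.+1 -> \bar R :=
  pushforward (mu1 \x m) (@cons_row R n).

Let step0 : lebesgue_step set0 = 0.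
Proof. by rewrite /lebesgue_step /pushforward preimage_set0 measure0. Qed.

Let step_ge0 A : 0 <= lebesgue_step A.
Proof. exact: (measure_ge0 (mu1 \x m)). Qed.

Let step_sigma_additive : semi_sigma_additive lebesgue_step.
Proof.
move=> F mF tF mUF; rewrite /lebesgue_step /pushforward preimage_bigcup.
apply: measure_semi_sigma_additive.
- by move=> k; rewrite -[X in measurable X]setTI; exact: measurable_cons_row.
- apply/trivIsetP => /= i j _ _ ij; rewrite -preimage_setI.
  by move/trivIsetP : tF => /(_ _ _ _ _ ij) ->//; rewrite preimage_set0.
- rewrite -preimage_bigcup -[X in measurable X]setTI.
  exact: measurable_cons_row.
Qed.

HB.instance Definition _ := isMeasure.Build _ _ _
  lebesgue_step step0 step_ge0 step_sigma_additive.

Let step_sigma_finite : sigma_finite setT lebesgue_step.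
Proof.
have /sigma_finiteP[F [TF ndF mF]] := sigma_finiteT mu1.
have /sigma_finiteP[G [TG ndG mG]] := sigma_finiteT m.
exists (fun k => @uncons_row R n @^-1` (F k `*` G k)).
  rewrite -preimage_bigcup (_ : \bigcup_i _ = setT) ?preimage_setT//.
  rewrite -subTset => -[x y] _.
  have [i _ Fx] : (\bigcup_i F i) x by rewrite -TF.
  have [j _ Gy] : (\bigcup_i G i) y by rewrite -TG.
  exists (maxn i j) => //; split.
  - by move: x Fx; exact/subsetPset/ndF/leq_maxl.
  - by move: y Gy; exact/subsetPset/ndG/leq_maxr.
move=> k; have [mFk Fkoo] := mF k; have [mGk Gkoo] := mG k; split.
  rewrite -[X in measurable X]setTI; apply: measurable_uncons_row => //.
  exact: measurableX.
rewrite /lebesgue_step /pushforward (_ : _ @^-1` _ = F k `*` G k).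
  by rewrite product_measure1E// lte_mul_pinfty// ge0_fin_numE.
by apply/funext => p; rewrite /preimage /mkset cons_rowK.
Qed.

HB.instance Definition _ := Measure_isSigmaFinite.Build _ _ _
  lebesgue_step step_sigma_finite.

End LebesgueStep.

Fixpoint lebesgue {R : realType} (n : nat) :
    {sigma_finite_measure set 'rV[R]_n -> \bar R} :=
  match n with
  | 0 => dirac (0 : 'rV[R]_0)
  | k.+1 => lebesgue_step (lebesgue k)
  end.

Lemma lebesgue_box {R : realType} (n : nat) (A : 'I_n -> set R) :
  (forall i, measurable (A i)) ->
  lebesgue n [set x : 'rV[R]_n | forall i, A i (x ord0 i)] =
  (\prod_(i < n) lebesgue_measure (A i))%E.
Proof.
elim: n A => [|n IHn] A mA.
  rewrite big_ord0 /= /dirac indicE mem_set//; by case.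
rewrite big_ord_recl -IHn; last by move=> i; exact: mA.
rewrite -product_measure1E; first last.
- rewrite (_ : [set x | _] =
      \bigcap_(i in [set: 'I_n]) (row_coord i @^-1` A (lift ord0 i))).
    apply: fin_bigcap_measurable => [|i _]; first exact: finite_finset.
    rewrite -[X in measurable X]setTI.
    exact: measurable_row_coord.
  apply/seteqP; split => x /= xA i; last exact: xA.
  by move=> _; exact: xA.
- exact: mA.
apply: (congr1 (product_measure1 (@lebesgue_measure R) (lebesgue n))).
apply/funext => -[a v]; apply/propext; rewrite /preimage /mkset /=.
have va0 : cons_row (a, v) ord0 ord0 = a.
  by have /(congr1 fst) := cons_rowK (a, v).
have vaS i : cons_row (a, v) ord0 (lift ord0 i) = v ord0 i.
  have /(congr1 snd)/rowP/(_ i) := cons_rowK (a, v).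
  by rewrite mxE.
split=> [cA|[Aa vA] i].
  by split=> [|i]; [rewrite -[a]va0; exact: cA|rewrite -vaS; exact: cA].
by case: (unliftP ord0 i) => [j|] ->; rewrite ?vaS ?va0.
Qed.


Section Smoothness.
Context {R : realType} {n : nat}.
Implicit Types (f : 'rV[R]_n -> R) (A D : set 'rV[R]_n).

Definition partial (i : 'I_n) f : 'rV[R]_n -> R :=
  fun x => 'D_(delta_mx ord0 i) f x.

Fixpoint Ck (k : nat) f : Prop :=
  continuous f /\
  if k is j.+1 then forall i, (forall x, derivable f x (delta_mx ord0 i)) /\
                              Ck j (partial i f)
  else True.

Definition Cinfty f : Prop := forall k, Ck k f.

(* Smooth functions on closure D are the restrictions of smooth functions on
   the whole space; values outside closure D are irrelevant. *)
Definition Cinfty_closure D f : Prop :=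
  exists2 F, Cinfty F & {in closure D, f =1 F}.

(* Support of a function living on closure D only. *)
Definition supp_in D f : set 'rV[R]_n :=
  closure [set x | closure D x /\ f x != 0].

Definition test_function D f : Prop :=
  [/\ Cinfty f, compact (closure [set x | f x != 0]) &
      closure [set x | f x != 0] `<=` D].

Definition compactly_included A D : Prop :=
  compact (closure A) /\ closure A `<=` D.

Definition bounded_domain D : Prop :=
  [/\ open D, connected D, D !=set0 & bounded_set D].

End Smoothness.

(* Near each boundary point, D is the strict epigraph or hypograph, in the
   direction of some coordinate axis i, of a C^2 function of the remaining
   coordinates. *)
Definition class_C2 {R : realType} {N : nat} (D : set 'rV[R]_N.+1) : Prop :=
  forall x0, (closure D `\` D°) x0 ->
  exists (i : 'I_N.+1) (b : bool) (gamma : 'rV[R]_N -> R), Ck 2 gamma /\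
  \forall x \near x0,
    D x <-> 0 < (-1) ^+ b * (x ord0 i - gamma (col' i x)).

Definition time_test_function {R : realType} (T : R) (phi : R -> R) : Prop :=
  [/\ forall k x, derivable (derive1n k phi) x 1,
      compact (closure [set t | phi t != 0]) &
      closure [set t | phi t != 0] `<=` `]0, T[].

Section L2.
Context {d : measure_display} {X : measurableType d} {R : realType}.
Variable mu : {measure set X -> \bar R}.
Implicit Types (D : set X) (f g : X -> R).

Definition L2 D f : Prop := f \_ D \in Lfun mu 2%:E.

Definition L2norm D f : R := fine ('N[mu]_2%:E [EFin \o (f \_ D)])%E.

Definition L2prod D f g : R := (\int[mu]_(x in D) (f x * g x))%R.

End L2.

Section Sobolev.
Context {R : realType} {N : nat}.
Variable Omega : set 'rV[R]_N.+1.
Notation V := 'rV[R]_N.+1.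
Notation leb := (@lebesgue R N.+1).
Implicit Types (f g v : V -> R) (F : (V -> R) -> R).

Definition is_weak_partial (i : 'I_N.+1) f g : Prop :=
  L2 leb Omega g /\
  forall phi, test_function Omega phi ->
    L2prod leb Omega f (partial i phi) = - L2prod leb Omega g phi.

(* Unique up to a null set when it exists. *)
Definition weak_partial (i : 'I_N.+1) f : V -> R :=
  xget (cst 0) (is_weak_partial i f).

Definition H1 f : Prop :=
  L2 leb Omega f /\ forall i, exists g, is_weak_partial i f g.

Definition H1norm f : R :=
  Num.sqrt (L2norm leb Omega f ^+ 2 +
            \sum_i L2norm leb Omega (weak_partial i f) ^+ 2).

Definition H10 : set (V -> R) := [set f | H1 f /\
  exists2 phi : nat -> V -> R, (forall k, test_function Omega (phi k)) &
    H1norm (fun x => phi k x - f x) @[k --> \oo] --> 0].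

(* H^{-1}: the dual of H^1_0, as functionals on representatives; boundedness
   forces them to respect almost everywhere equality. *)
Definition Hm1 : set ((V -> R) -> R) := [set F |
  (forall (c : R) f g, H10 f -> H10 g ->
    F (fun x => c * f x + g x) = c * F f + F g) /\
  exists C : R, forall f, H10 f -> `|F f| <= C * H1norm f].

Definition Hm1norm F : R :=
  sup [set `|F f| | f in [set f | H10 f /\ H1norm f <= 1]].

(* The elements v, Laplacian of v and i-th partial derivative of v of H^{-1}. *)
Definition dual_of_L2 v : (V -> R) -> R := fun h => L2prod leb Omega v h.

Definition dual_laplacian v : (V -> R) -> R := fun h =>
  - \sum_i L2prod leb Omega (weak_partial i v) (weak_partial i h).

Definition dual_partial (i : 'I_N.+1) v : (V -> R) -> R := fun h =>
  - L2prod leb Omega v (weak_partial i h).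

End Sobolev.

(* Both H^1_0 and H^{-1} consist of real functions on some type S; E is the
   space and nrm its seminorm on representatives. *)
Section Bochner.
Context {R : realType} {S : Type}.
Variables (T : R) (E : set (S -> R)) (nrm : (S -> R) -> R).
Implicit Types f s : R -> S -> R.

Definition simple_in s : Prop :=
  exists (m : nat) (A : 'I_m -> set R) (e : 'I_m -> S -> R),
    [/\ forall i, measurable (A i), forall i, E (e i) &
        forall t x, s t x = \sum_(i < m) \1_(A i) t * e i x].

Definition strongly_measurable f : Prop :=
  exists2 s : nat -> R -> S -> R, (forall k, simple_in (s k)) &
    {ae @lebesgue_measure R, forall t, t \in `]0, T[ ->
      nrm (fun x => s k t x - f t x) @[k --> \oo] --> 0}.

(* Strong measurability only makes t |-> nrm (f t) Borel up to a null set; the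
   integral of a nonnegative function is defined without measurability and does
   not see such null sets. *)
Definition bochner_L2 f : Prop :=
  [/\ {ae @lebesgue_measure R, forall t, t \in `]0, T[ -> E (f t)},
      strongly_measurable f &
      (\int[@lebesgue_measure R]_(t in `]0%R, T[) (nrm (f t) ^+ 2)%:E < +oo)%E].

End Bochner.

Section Parabolic.
Context {R : realType} {N : nat}.
Variables (T : R) (Omega : set 'rV[R]_N.+1).
Notation V := 'rV[R]_N.+1.
Notation leb := (@lebesgue R N.+1).
Notation leb1 := (@lebesgue_measure R).

(* g is the distributional derivative of y in time, as an H^{-1}-valued
   distribution on (0,T). *)
Definition is_time_derivative (y : R -> V -> R) (g : R -> (V -> R) -> R) : Prop :=
  forall phi, time_test_function T phi -> forall h, H10 Omega h ->
    \int[leb1]_(t in `]0, T[) (dual_of_L2 Omega (y t) h * derive1 phi t) =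
    - \int[leb1]_(t in `]0, T[) (g t h * phi t).

Definition in_W (y : R -> V -> R) (g : R -> (V -> R) -> R) : Prop :=
  [/\ bochner_L2 T (H10 Omega) (H1norm Omega) y,
      bochner_L2 T (Hm1 Omega) (Hm1norm Omega) g &
      is_time_derivative y g].

Definition continuous_L2 (y : R -> V -> R) : Prop :=
  forall t, t \in `[0, T] -> L2 leb Omega (y t) /\
    L2norm leb Omega (fun x => y s x - y t x)
      @[s --> within `[0, T] (nbhs t)] --> 0.

Definition QT : set (R * V) := `]0, T[ `*` Omega.

(* Controls are Borel representatives of classes in L^2(Q_T). *)
Definition control (u : R * V -> R) : Prop := L2 (leb1 \x leb)%E QT u.

(* Each component is the continuous representative of an element of W(0,T);
   the boundary condition is carried by H^1_0, and the two equations hold in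
   L^2(0,T; H^{-1}). *)
Definition solution (omega : set V) (theta a : V -> R)
    (y01 y02 : V -> R) (u : R * V -> R) (y1 y2 : R -> V -> R) : Prop :=
  exists g1 g2 : R -> (V -> R) -> R,
  [/\ in_W y1 g1 /\ in_W y2 g2,
      continuous_L2 y1 /\ continuous_L2 y2,
      {ae leb1, forall t, t \in `]0, T[ -> forall h, H10 Omega h ->
        g1 t h = dual_laplacian Omega (y1 t) h +
                 dual_of_L2 Omega (fun x => \1_omega x * u (t, x)) h},
      {ae leb1, forall t, t \in `]0, T[ -> forall h, H10 Omega h ->
        g2 t h = dual_laplacian Omega (y2 t) h +
                 dual_of_L2 Omega (fun x => a x * y2 t x) h +
                 dual_partial Omega ord0 (fun x => theta x * y1 t x) h} &
      {ae leb, forall x, Omega x -> y1 0 x = y01 x /\ y2 0 x = y02 x}].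

Definition approximately_controllable (omega : set V) (theta a : V -> R) : Prop :=
  forall y01 y02 yT1 yT2 : V -> R,
    L2 leb Omega y01 -> L2 leb Omega y02 ->
    L2 leb Omega yT1 -> L2 leb Omega yT2 ->
  forall eps : R, 0 < eps ->
  exists u y1 y2, [/\ control u, solution omega theta a y01 y02 u y1 y2 &
    Num.sqrt (L2norm leb Omega (fun x => y1 T x - yT1 x) ^+ 2 +
              L2norm leb Omega (fun x => y2 T x - yT2 x) ^+ 2) <= eps].

Definition null_controllable (omega : set V) (theta a : V -> R) : Prop :=
  forall y01 y02 : V -> R, L2 leb Omega y01 -> L2 leb Omega y02 ->
  exists u y1 y2, [/\ control u, solution omega theta a y01 y02 u y1 y2 &
    {ae leb, forall x, Omega x -> y1 T x = 0 /\ y2 T x = 0}].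

End Parabolic.

(* Main.v *)
Require Import Defs.
From HB Require Import structures.
From mathcomp Require Import all_boot all_order all_algebra.
From mathcomp Require Import all_classical all_reals all_analysis.
From mathcomp Require Import measurable_realfun ring lra.
Import Order.TTheory GRing.Theory Num.Theory.
Import numFieldNormedType.Exports.
Local Open Scope classical_set_scope.
Local Open Scope ring_scope.
Set Implicit Arguments.
Unset Strict Implicit.
Unset Printing Implicit Defensive.

(** Why the system is not controllable. The control acts on the second component
only through d_1 (theta y_1), and theta vanishes outside the closure of
omega_1. Let phi be an element of H^1_0(Omega) which is constant on the closure
of omega_1 and satisfies Delta phi + a phi = 0 in Omega. Then, whatever the
control,

  d/dt (y_2, phi) = (y_2, Delta phi + a phi) - (theta y_1, d_1 phi) = 0,

so that (y_2(T), phi) = (y_2(0), phi): this is [weight_conserved]. From zero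
initial data the target (0, phi) cannot be approached, and the initial data
(0, phi) cannot be steered to zero. As a can be chosen freely, it suffices to find
a function phi, equal to 1 near the closure of omega_1, for which
a = - Delta phi / phi is smooth: this is [harmonic_weight].

The function phi. Let f be a nonnegative bump supported in omega_1, let psi in
H^1_0(Omega) solve - Delta psi = f ([dirichlet_solution], by minimization of
the Dirichlet energy), let chi be a cut-off function equal to 1 near the closure
of omega_1, and put phi = chi + (1 - chi) psi. The function phi is 1 where
chi = 1 and harmonic where chi = 0, so Delta phi lives in the transition region
of chi, a compact subset of Omega away from the support of f. In particular a
vanishes near the boundary, where little is known about psi. In the transition
region psi has to be smooth and positive. Both facts come from the averages of
psi against a radial mollifier of scale s whose derivative in s is the
Laplacian of a nonnegative compactly supported function:
- where f = 0 the averages do not depend on s ([average_const]), whence psi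
  coincides almost everywhere with a multiple of its averages, which are smooth
  ([average_ae], Weyl's lemma);
- in general the averages decrease with s, whence the averages of psi are
  positive in the connected set Omega ([average_gt0], the strong maximum
  principle).

Passing from the weak formulation to the conservation law requires that weak
derivatives be unique almost everywhere ([fundamental_lemma]), that the
equation of phi may be tested with elements of H^1_0 ([weak_equation_H10]), and
that a continuous function of time with zero weak derivative be constant
([weakly_constant]). *)

(** * Smoothness along a set of directions *)

Section SmoothAlong.
Context {R : realType} {V : normedModType R} (D : set V).
Implicit Types (f g : V -> R) (k : nat).

(** One notion serves both for functions on R^n differentiated along the
coordinate axes and for functions of time differentiated along 1. *)
Fixpoint Ck_along k f : Prop :=
  continuous f /\
  if k is j.+1 then
    forall v, D v -> (forall x, derivable f x v) /\ Ck_along j ('D_v f)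
  else True.

Lemma Ck_along_continuous k f : Ck_along k f -> continuous f.
Proof. by case: k => [|k] []. Qed.

Lemma Ck_alongW k f : Ck_along k.+1 f -> Ck_along k f.
Proof.
elim: k f => [|k IHk] f; first by case.
move=> [cf df]; split=> // v Dv; have [dv Cv] := df v Dv.
by split=> //; exact: IHk.
Qed.

Lemma Ck_along_cst k (c : R) : Ck_along k (cst c).
Proof.
elim: k c => [|k IHk] c /=; split=> //; try exact: cst_continuous.
move=> v _; split => [x|]; first exact: derivable_cst.
rewrite (_ : 'D_v _ = cst 0) //.
by apply/funext => x; rewrite derive_cst.
Qed.

Lemma Ck_alongD k f g :
  Ck_along k f -> Ck_along k g -> Ck_along k (fun x => f x + g x).
Proof.
elim: k f g => [|k IHk] f g /= [cf df] [cg dg].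
  by split=> // x; apply: cvgD; [exact: cf|exact: cg].
split; first by move=> x; apply: cvgD; [exact: cf|exact: cg].
move=> v Dv; have [dfv Cf] := df v Dv; have [dgv Cg] := dg v Dv.
split=> [x|]; first exact: derivableD.
rewrite (_ : 'D_v _ = fun x => 'D_v f x + 'D_v g x); first exact: IHk.
by apply/funext => x; rewrite [LHS]deriveD.
Qed.

Lemma Ck_alongM k f g :
  Ck_along k f -> Ck_along k g -> Ck_along k (fun x => f x * g x).
Proof.
elim: k f g => [|k IHk] f g.
  move=> /= [cf _] [cg _].
  by split=> // x; apply: cvgM; [exact: cf|exact: cg].
move=> Cf Cg; have [cf df] := Cf; have [cg dg] := Cg.
split; first by move=> x; apply: cvgM; [exact: cf|exact: cg].
move=> v Dv; have [dfv Cfv] := df v Dv; have [dgv Cgv] := dg v Dv.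
split=> [x|]; first exact: derivableM.
rewrite (_ : 'D_v _ = fun x => f x * 'D_v g x + g x * 'D_v f x).
  by apply: Ck_alongD; apply: IHk => //; exact: Ck_alongW.
by apply/funext => x; rewrite [LHS]deriveM.
Qed.

Lemma Ck_alongZ k (c : R) f : Ck_along k f -> Ck_along k (fun x => c * f x).
Proof. by apply: Ck_alongM; exact: Ck_along_cst. Qed.

Lemma Ck_alongN k f : Ck_along k f -> Ck_along k (fun x => - f x).
Proof.
by move=> /(@Ck_alongZ _ (-1)); under eq_fun do rewrite mulN1r.
Qed.

Lemma Ck_alongB k f g :
  Ck_along k f -> Ck_along k g -> Ck_along k (fun x => f x - g x).
Proof. by move=> Cf Cg; apply: Ck_alongD => //; exact: Ck_alongN. Qed.

Lemma eq_Ck_along k f g : f =1 g -> Ck_along k g -> Ck_along k f.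
Proof. by move=> /funext ->. Qed.

Lemma Ck_along_sum k (I : Type) (r : seq I) (P : pred I) (F : I -> V -> R) :
  (forall i, P i -> Ck_along k (F i)) ->
  Ck_along k (fun x => \sum_(i <- r | P i) F i x).
Proof.
move=> CF; elim: r => [|i r IHr].
  by apply: (eq_Ck_along _ (Ck_along_cst k 0)) => x; rewrite big_nil.
case Pi : (P i); last first.
  by apply: (eq_Ck_along _ IHr) => x; rewrite big_cons Pi.
apply: (eq_Ck_along _ (Ck_alongD (CF i Pi) IHr)) => x.
by rewrite big_cons Pi.
Qed.

Lemma Ck_along_prod k (I : Type) (r : seq I) (P : pred I) (F : I -> V -> R) :
  (forall i, P i -> Ck_along k (F i)) ->
  Ck_along k (fun x => \prod_(i <- r | P i) F i x).
Proof.
move=> CF; elim: r => [|i r IHr].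
  by apply: (eq_Ck_along _ (Ck_along_cst k 1)) => x; rewrite big_nil.
case Pi : (P i); last first.
  by apply: (eq_Ck_along _ IHr) => x; rewrite big_cons Pi.
apply: (eq_Ck_along _ (Ck_alongM (CF i Pi) IHr)) => x.
by rewrite big_cons Pi.
Qed.

Lemma Ck_alongV k f :
  (forall x, f x != 0) -> Ck_along k f -> Ck_along k (fun x => (f x)^-1).
Proof.
move=> f0; elim: k => [|k IHk].
  by move=> /= [cf _]; split=> // x; apply: cvgV => //; exact: cf.
move=> Cf; have CV := IHk (Ck_alongW Cf); have [cf df] := Cf.
split; first by move=> x; apply: cvgV => //; exact: cf.
move=> v Dv; have [dfv Cfv] := df v Dv.
split=> [x|]; first exact: derivableV.
rewrite (_ : 'D_v _ = fun x => (- (f x)^-1 * (f x)^-1) * 'D_v f x).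
  by apply: Ck_alongM => //; apply: Ck_alongM => //; exact: Ck_alongN.
apply/funext => x; rewrite [LHS]deriveV// /GRing.scale/= expr2 invfM.
by rewrite -mulNr.
Qed.

(** Affine functions: their derivative along v does not depend on the point. *)
Lemma Ck_along_affine k f (c : V -> R) : continuous f ->
  (forall x v, D v -> is_derive x v f (c v)) -> Ck_along k f.
Proof.
move=> cf df; case: k => [|k] //=; split=> // v Dv; split=> [x|].
  by have [] := df x v Dv.
rewrite (_ : 'D_v f = cst (c v)); first exact: Ck_along_cst.
by apply/funext => x; have [_ ->] := df x v Dv.
Qed.

End SmoothAlong.

Section ChainRule.
Context {R : realType} {V : normedModType R}.

Lemma derive_line (f : V -> R) (x v : V) :
  'D_v f x = 'D_1 (fun h : R => f (h *: v + x)) 0.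
Proof.
rewrite /derive; set g1 := fun h => h^-1 *: _; set g2 := fun h => h^-1 *: _.
suff -> : g1 = g2 by [].
by rewrite funeqE /g1 /g2 => h /=; rewrite addr0 scale0r add0r [_%:A]mulr1.
Qed.

Lemma is_derive_comp (h : R -> R) (f : V -> R) (x v : V) (a b : R) :
  is_derive (f x) 1 h a -> is_derive x v f b ->
  is_derive x v (fun y => h (f y)) (a * b).
Proof.
move=> dh [dfv fE].
pose g t := f (t *: v + x).
have g0 : g 0 = f x by rewrite /g scale0r add0r.
have dg : is_derive (0 : R) 1 g b.
  by split; [exact: (derivable1P _ _ _).1|rewrite -derive_line].
rewrite -g0 in dh.
have [d1 d2] := is_derive1_comp dh dg.
by split; [exact/derivable1P|rewrite derive_line].
Qed.

End ChainRule.

(** * Flat functions *)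

Section Flat.
Context {R : realType}.
Implicit Types (m : nat) (x : R).

(** The powers of 1/x make the family stable under differentiation:
(flat m)' = flat (m + 2) - m flat (m + 1). *)
Definition flat m x : R := if 0 < x then x^-1 ^+ m * expR (- x^-1) else 0.

Lemma flat_ge0 m x : 0 <= flat m x.
Proof.
rewrite /flat; case: ifPn => // x0.
by rewrite mulr_ge0 ?expR_ge0// exprn_ge0// invr_ge0 ltW.
Qed.

Lemma flat_gt0 m x : 0 < x -> 0 < flat m x.
Proof.
by move=> x0; rewrite /flat x0 mulr_gt0 ?expR_gt0// exprn_gt0// invr_gt0.
Qed.

Lemma flat_eq0 m x : x <= 0 -> flat m x = 0.
Proof. by rewrite /flat leNgt => /negbTE ->. Qed.

(** Comparison of exp (1/x) with one term of its power series; the bound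
x ^ 2 gives the vanishing derivative at 0, and below 1 a bound depending only
on m. *)
Lemma flat_le m x : flat m x <= (m.+2)`!%:R * x ^+ 2.
Proof.
have [x0|x0] := ltP 0 x; last by rewrite flat_eq0// mulr_ge0// sqr_ge0.
rewrite /flat x0 expRN ler_pdivrMr ?expR_gt0//.
have := @expR_ge1Dxn R x^-1 m.+1; rewrite invr_ge0 ltW// => /(_ isT).
move=> le1; have le2 : x^-1 ^+ m.+2 / m.+2`!%:R <= expR x^-1.
  by apply: le_trans le1; rewrite lerDr.
have f0 : 0 < (m.+2`!%:R : R) by rewrite ltr0n fact_gt0.
rewrite ler_pdivrMr// in le2.
rewrite -mulrA mulrCA -ler_pdivrMl ?exprn_gt0//.
by rewrite mulrC -exprVn -exprD addn2 (le_trans le2)// mulrC.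
Qed.

Lemma is_derive_inv x : x != 0 -> is_derive x 1 (fun y : R => y^-1) (- x ^- 2).
Proof.
by move=> x0; split; [exact: derivableV|rewrite deriveV// derive_id [LHS]mulr1].
Qed.

Lemma is_derive_expV m x : x != 0 ->
  is_derive x 1 (fun y : R => y^-1 ^+ m) (- m%:R * x^-1 ^+ m.+1).
Proof.
move=> x0; have dV := is_derive_inv x0.
case: m => [|m].
  by rewrite oppr0 mul0r; under eq_fun do rewrite expr0; exact: is_derive_cst.
rewrite (_ : (fun y => _) = (fun y : R => y^-1) ^+ m.+1); last first.
  by apply/funext => y; rewrite fctE.
apply: is_derive_eq; rewrite /GRing.scale/= -exprVn !exprS.
by rewrite -mulr_natl; ring.
Qed.

Lemma is_derive_flat m x :
  is_derive x 1 (flat m) (flat m.+2 x - m%:R * flat m.+1 x).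
Proof.
have [x0|x0|x0] := ltgtP 0 x.
- apply: (@near_eq_is_derive R R R (fun y => y^-1 ^+ m * expR (- y^-1))).
    near=> y; rewrite /flat ifT//.
    near: y; exact: lt_nbhsr.
  rewrite /flat x0.
  have dV := is_derive_inv (lt0r_neq0 x0).
  have dE : is_derive x 1 (fun y : R => expR (- y^-1)) (expR (- x^-1) * x ^- 2).
    apply: (is_derive_comp (h := expR) (f := fun y : R => - y^-1)).
    by rewrite -[X in is_derive _ _ _ X]opprK; exact: is_deriveN.
  have dX := is_derive_expV m (lt0r_neq0 x0).
  apply: is_derive_eq; rewrite /GRing.scale/= -exprVn !exprS; ring.
- apply: (@near_eq_is_derive R R R (cst 0)).
    near=> y; rewrite /flat ifF//; apply/negbTE; rewrite -leNgt ltW//.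
    near: y; exact: lt_nbhsl.
  rewrite !(flat_eq0 _ (ltW x0)) mulr0 subrr; exact: is_derive_cst.
- rewrite -x0 !(flat_eq0 _ (lexx 0)) mulr0 subrr.
  have cv : h^-1 *: ((flat m \o shift (0 : R)) h%:A - flat m 0) @[h --> 0^'] --> (0 : R).
    apply/cvgr0Pnorm_le => e e0.
    have K0 : 0 < (m.+2`!%:R : R) by rewrite ltr0n fact_gt0.
    near=> h.
    have h0 : h != 0 by near: h; exact: nbhs_dnbhs_neq.
    rewrite /= addr0 [_%:A]mulr1 (flat_eq0 _ (lexx 0)) subr0 /GRing.scale/=.
    rewrite normrM normfV ler_pdivrMl ?normr_gt0//.
    rewrite ger0_norm ?flat_ge0// (le_trans (flat_le _ _))//.
    rewrite -[h ^+ 2]real_normK ?num_real// expr2 mulrCA ler_wpM2l//.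
    rewrite -ler_pdivlMl//; near: h; apply: dnbhs0_le.
    by rewrite mulr_gt0 ?invr_gt0.
  split; first by apply/cvg_ex; exists 0.
  exact/cvg_lim.
Unshelve. all: by end_near. Qed.

Lemma continuous_flat m : continuous (flat m).
Proof.
move=> x; have [d _] := is_derive_flat m x.
exact/differentiable_continuous/derivable1_diffP.
Qed.

Lemma Ck_along_flat (V : normedModType R) (D : set V) m k (f : V -> R) :
  Ck_along D k f -> Ck_along D k (fun y => flat m (f y)).
Proof.
elim: k m f => [|k IHk] m f.
  move=> /= [cf _]; split=> // x.
  by apply: continuous_comp; [exact: cf|exact: continuous_flat].
move=> Cf; have [cf df] := Cf; split.
  by move=> x; apply: continuous_comp; [exact: cf|exact: continuous_flat].
move=> v Dv; have [dfv Cfv] := df v Dv.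
have dfl (x : V) := is_derive_comp (is_derive_flat m (f x)) (derivableP (dfv x)).
split=> [x|]; first by have [] := dfl x.
apply: (@eq_Ck_along _ _ _ _ _
  (fun y => (flat m.+2 (f y) - m%:R * flat m.+1 (f y)) * 'D_v f y)).
  by move=> x; have [_] := dfl x.
apply: Ck_alongM => //; apply: Ck_alongB; first exact/IHk/Ck_alongW.
exact/Ck_alongZ/IHk/Ck_alongW.
Qed.

Lemma Ck_along_sqrt (V : normedModType R) (D : set V) k (f : V -> R) :
  (forall y, 0 < f y) ->
  Ck_along D k f -> Ck_along D k (fun y => Num.sqrt (f y)).
Proof.
move=> f0; elim: k => [|k IHk].
  move=> /= [cf _]; split=> // x.
  by apply: continuous_comp; [exact: cf|exact: sqrt_continuous].
move=> Cf; have [cf df] := Cf; split.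
  by move=> x; apply: continuous_comp; [exact: cf|exact: sqrt_continuous].
move=> v Dv; have [dfv Cfv] := df v Dv.
have ds (x : V) := is_derive_comp (is_derive1_sqrt (f0 x)) (derivableP (dfv x)).
split=> [x|]; first by have [] := ds x.
apply: (@eq_Ck_along _ _ _ _ _ (fun y => (2 * Num.sqrt (f y))^-1 * 'D_v f y)).
  by move=> x; have [_] := ds x.
apply: Ck_alongM => //; apply: Ck_alongV.
  by move=> x; rewrite mulf_neq0// gt_eqF// sqrtr_gt0.
exact/Ck_alongZ/IHk/Ck_alongW.
Qed.

End Flat.

(** * Smooth functions on R^n *)

Section SmoothRow.
Context {R : realType} {n : nat}.
Notation V := 'rV[R]_n.
Implicit Types (f g : V -> R) (A D K : set V).

Definition axes : set V := range (fun i : 'I_n => delta_mx ord0 i : V).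

Lemma CkP k f : Ck k f <-> Ck_along axes k f.
Proof.
elim: k f => [//|k IHk] f; split=> -[cf df]; split=> //.
  by move=> _ [i _ <-]; have [? ?] := df i; split=> //; exact/IHk.
move=> i; have [|? ?] := df (delta_mx ord0 i); first by exists i.
by split=> //; exact/IHk.
Qed.

Lemma CinftyP f : Cinfty f <-> forall k, Ck_along axes k f.
Proof. by split=> Cf k; exact/CkP. Qed.

Lemma Cinfty_continuous f : Cinfty f -> continuous f.
Proof. by move=> /(_ 0%N)[]. Qed.

Lemma Cinfty_derivable f i x : Cinfty f -> derivable f x (delta_mx ord0 i).
Proof. by move=> /(_ 1%N)[_ /(_ i)[]]. Qed.

Lemma Cinfty_partial f i : Cinfty f -> Cinfty (partial i f).
Proof. by move=> Cf k; have [_ /(_ i)[]] := Cf k.+1. Qed.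

Lemma Cinfty_cst (c : R) : Cinfty (fun _ : V => c).
Proof. by apply/CinftyP => k; exact: Ck_along_cst. Qed.

Lemma CinftyD f g : Cinfty f -> Cinfty g -> Cinfty (fun x => f x + g x).
Proof. by move=> /CinftyP Cf /CinftyP Cg; apply/CinftyP => k; exact: Ck_alongD. Qed.

Lemma CinftyM f g : Cinfty f -> Cinfty g -> Cinfty (fun x => f x * g x).
Proof. by move=> /CinftyP Cf /CinftyP Cg; apply/CinftyP => k; exact: Ck_alongM. Qed.

Lemma CinftyZ c f : Cinfty f -> Cinfty (fun x => c * f x).
Proof. by move=> /CinftyP Cf; apply/CinftyP => k; exact: Ck_alongZ. Qed.

Lemma CinftyN f : Cinfty f -> Cinfty (fun x => - f x).
Proof. by move=> /CinftyP Cf; apply/CinftyP => k; exact: Ck_alongN. Qed.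

Lemma CinftyB f g : Cinfty f -> Cinfty g -> Cinfty (fun x => f x - g x).
Proof. by move=> /CinftyP Cf /CinftyP Cg; apply/CinftyP => k; exact: Ck_alongB. Qed.

Lemma Cinfty_sum (I : Type) (r : seq I) (P : pred I) (F : I -> V -> R) :
  (forall i, P i -> Cinfty (F i)) -> Cinfty (fun x => \sum_(i <- r | P i) F i x).
Proof.
move=> CF; apply/CinftyP => k.
by apply: Ck_along_sum => i Pi; exact: (CinftyP _).1 (CF i Pi) k.
Qed.

Lemma Cinfty_prod (I : Type) (r : seq I) (P : pred I) (F : I -> V -> R) :
  (forall i, P i -> Cinfty (F i)) -> Cinfty (fun x => \prod_(i <- r | P i) F i x).
Proof.
move=> CF; apply/CinftyP => k.
by apply: Ck_along_prod => i Pi; exact: (CinftyP _).1 (CF i Pi) k.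
Qed.

Lemma CinftyV f : (forall x, f x != 0) -> Cinfty f -> Cinfty (fun x => (f x)^-1).
Proof. by move=> f0 /CinftyP Cf; apply/CinftyP => k; exact: Ck_alongV. Qed.

Lemma Cinfty_sqrt f : (forall x, 0 < f x) -> Cinfty f ->
  Cinfty (fun x => Num.sqrt (f x)).
Proof. by move=> f0 /CinftyP Cf; apply/CinftyP => k; exact: Ck_along_sqrt. Qed.

Lemma Cinfty_flat m f : Cinfty f -> Cinfty (fun x => flat m (f x)).
Proof. by move=> /CinftyP Cf; apply/CinftyP => k; exact: Ck_along_flat. Qed.

Lemma is_derive_coord (i j : 'I_n) (x : V) :
  is_derive x (delta_mx ord0 j) (fun y : V => y ord0 i) (i == j)%:R.
Proof.
have E (h : R) : h != 0 ->
    h^-1 *: ((h *: (delta_mx ord0 j : V) + x) ord0 i - x ord0 i) = (i == j)%:R :> R.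
  by move=> h0; rewrite !mxE addrK /= /GRing.scale/= mulrA mulVf// mul1r.
have cv : h^-1 *: (((fun y : V => y ord0 i) \o shift x) (h *: delta_mx ord0 j) - x ord0 i)
    @[h --> (0 : R)^'] --> ((i == j)%:R : R).
  apply: cvg_near_cst; near=> h; apply: E.
  by near: h; exact: nbhs_dnbhs_neq.
by split; [apply/cvg_ex; eexists; exact: cv|exact/cvg_lim].
Unshelve. all: by end_near. Qed.

Lemma Cinfty_coord i : Cinfty (fun x : V => x ord0 i).
Proof.
apply/CinftyP => k.
apply: (@Ck_along_affine _ _ _ _ _ (fun v : V => v ord0 i)).
  exact: coord_continuous.
move=> x _ [j _ <-]; apply: is_derive_eq; first exact: is_derive_coord.
by rewrite mxE.
Qed.

Lemma partial_coord i j : partial j (fun x : V => x ord0 i) = cst (i == j)%:R.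
Proof. by apply/funext => x; have [_] := is_derive_coord i j x. Qed.

Lemma partial_cst (c : R) i : partial i (fun _ : V => c) = cst 0.
Proof. by apply/funext => x; exact: derive_cst. Qed.

Lemma partialD f g i x : Cinfty f -> Cinfty g ->
  partial i (fun y => f y + g y) x = partial i f x + partial i g x.
Proof. by move=> Cf Cg; rewrite [LHS]deriveD//; exact: Cinfty_derivable. Qed.

Lemma partialB f g i x : Cinfty f -> Cinfty g ->
  partial i (fun y => f y - g y) x = partial i f x - partial i g x.
Proof. by move=> Cf Cg; rewrite [LHS]deriveB//; exact: Cinfty_derivable. Qed.

Lemma partialM f g i x : Cinfty f -> Cinfty g ->
  partial i (fun y => f y * g y) x = f x * partial i g x + g x * partial i f x.
Proof. by move=> Cf Cg; rewrite [LHS]deriveM//; exact: Cinfty_derivable. Qed.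

Lemma partialZ c f i x : Cinfty f ->
  partial i (fun y => c * f y) x = c * partial i f x.
Proof. by move=> Cf; rewrite [LHS]deriveZ//; exact: Cinfty_derivable. Qed.

Lemma partialN f i x : Cinfty f -> partial i (fun y => - f y) x = - partial i f x.
Proof. by move=> Cf; rewrite [LHS]deriveN//; exact: Cinfty_derivable. Qed.

Lemma partial_sum (I : Type) (r : seq I) (F : I -> V -> R) i x :
  (forall j, Cinfty (F j)) ->
  partial i (fun y => \sum_(j <- r) F j y) x = \sum_(j <- r) partial i (F j) x.
Proof.
move=> CF; elim: r => [|j r IHr].
  rewrite big_nil -[RHS](derive_cst (0 : R) x (delta_mx ord0 i)).
  by congr ('D_ _ _ x); apply/funext => y; rewrite big_nil.
rewrite big_cons -IHr -partialD//; last exact: Cinfty_sum.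
by congr (partial i _ x); apply/funext => y; rewrite big_cons.
Qed.

Lemma partial_flat m f i x : Cinfty f ->
  partial i (fun y => flat m (f y)) x =
  (flat m.+2 (f x) - m%:R * flat m.+1 (f x)) * partial i f x.
Proof.
move=> Cf; have df := derivableP (@Cinfty_derivable _ i x Cf).
by have [_] := is_derive_comp (is_derive_flat m (f x)) df.
Qed.

Lemma partial_sqrt f i x : (forall y, 0 < f y) -> Cinfty f ->
  partial i (fun y => Num.sqrt (f y)) x = (2 * Num.sqrt (f x))^-1 * partial i f x.
Proof.
move=> f0 Cf; have df := derivableP (@Cinfty_derivable _ i x Cf).
by have [_] := is_derive_comp (is_derive1_sqrt (f0 x)) df.
Qed.

Lemma is_derive_reflect f (c v x : V) : derivable f (c - x) v ->
  is_derive x v (fun y => f (c - y)) (- 'D_v f (c - x)).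
Proof.
move=> df; pose g t := f (t *: v + (c - x)).
have dg : is_derive (- (0 : R)) 1 g ('D_v f (c - x)).
  by rewrite oppr0; split; [exact: (derivable1P _ _ _).1|rewrite -derive_line].
have [d1 d2] := is_derive1_comp dg (is_deriveNid (0 : R) 1).
have E : (fun h : R => f (c - (h *: v + x))) = g \o -%R.
  apply/funext => h; rewrite /g/=; congr f.
  by rewrite scaleNr opprD addrCA.
split; first by apply/derivable1P; rewrite E.
by rewrite derive_line E d2 mulrN1.
Qed.

Lemma partial_reflect f c i x : Cinfty f ->
  partial i (fun y => f (c - y)) x = - partial i f (c - x).
Proof.
by move=> Cf; have [_] := is_derive_reflect (@Cinfty_derivable _ i (c - x) Cf).
Qed.

Lemma continuous_reflect (c : V) : continuous (fun y : V => c - y).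
Proof.
by move=> x; apply: (@cvgB _ V _ (nbhs x) _ (fun=> c) id); [exact: cvg_cst|exact: cvg_id].
Qed.

Lemma Cinfty_reflect f (c : V) : Cinfty f -> Cinfty (fun y => f (c - y)).
Proof.
move=> Cf k.
have cfc g : Cinfty g -> continuous (fun y : V => g (c - y)).
  move=> Cg x; apply: (@continuous_comp _ _ _ (fun y : V => c - y) g).
    exact: continuous_reflect.
  exact: Cinfty_continuous.
elim: k f Cf => [|k IHk] f Cf; first by split=> //; exact: cfc.
split; first exact: cfc.
move=> i; split=> [x|].
  by have [] := is_derive_reflect (@Cinfty_derivable _ i (c - x) Cf).
rewrite (_ : partial i _ = fun y => (fun z => - partial i f z) (c - y)).
  by apply: (IHk (fun z => - partial i f z)); exact/CinftyN/Cinfty_partial.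
by apply/funext => x; rewrite partial_reflect.
Qed.

End SmoothRow.

(** * Compactness and test functions *)

Section RowNorm.
Context {R : realType} {n : nat}.
Notation V := 'rV[R]_n.

Lemma le_coord_norm (x : V) i : `|x ord0 i| <= `|x|.
Proof.
have /mapP[j Hj ->] : `|x ord0 i| \in [seq `|x y.1 y.2| | y : 'I_1 * 'I_n].
  by apply/mapP; exists (ord0, i) => //=; rewrite mem_enum.
by rewrite [leRHS]/Num.norm /= mx_normrE; apply/bigmax_geP; right => /=; exists j.
Qed.

Lemma row_norm_le (x : V) e : 0 <= e -> (forall i, `|x ord0 i| <= e) -> `|x| <= e.
Proof.
move=> e0 xe; rewrite [leLHS]/Num.norm /= mx_normrE.
by apply/bigmax_leP; split=> // -[i j] _ /=; rewrite ord1; exact: xe.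
Qed.

Lemma row_norm_lt (x : V) e : 0 < e -> (forall i, `|x ord0 i| < e) -> `|x| < e.
Proof.
move=> e0 xe; rewrite [ltLHS]/Num.norm /= mx_normrE.
by apply/bigmax_ltP; split=> // -[i j] _ /=; rewrite ord1; exact: xe.
Qed.

End RowNorm.

Section CompactRow.
Context {R : realType} {V : normedModType R}.
Implicit Types (f : V -> R) (K U : set V).

Lemma open_contains_ball U x : open U -> U x -> exists2 r : R, 0 < r & ball x r `<=` U.
Proof. by move=> oU Ux; apply/nbhs_ballP; exact: open_nbhs_nbhs. Qed.

Lemma compact_thickening K U : compact K -> open U -> K `<=` U ->
  exists2 d : R, 0 < d & forall x y, K x -> `|x - y| < d -> U y.
Proof.
move=> cK oU KU.
have : \forall d \near (0 : R)^'+, K `<=` [set x | forall y, `|x - y| < d -> U y].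
  apply: (compact_near_coveringP K).1 => // x Kx.
  have [r r0 xrU] := open_contains_ball oU (KU x Kx).
  exists (ball x (r / 2), [set d | d <= r / 2]) => /=.
    by split; [apply: nbhsx_ballx; rewrite divr_gt0|apply: nbhs_right_le; rewrite divr_gt0].
  move=> [x' d] [/= xx' dr] y xy; apply: xrU.
  rewrite -ball_normE/= in xx' *.
  rewrite -(subrK x' x) -addrA (le_lt_trans (ler_normD _ _))//.
  by rewrite (splitr r) ltrD// (lt_le_trans xy).
move=> nd; have /filter_ex[d [d0 dP]] : \forall d \near (0 : R)^'+,
    0 < d /\ K `<=` [set x | forall y, `|x - y| < d -> U y].
  by apply: filterI => //; exact: nbhs_right_gt.
by exists d => // x y Kx; exact: dP.
Qed.

Lemma compact_continuous_bounded f K : compact K -> continuous f ->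
  exists2 M : R, 0 < M & forall x, K x -> `|f x| <= M.
Proof.
move=> cK cf.
have /ex_strict_bound_gt0[M M0 fM] : bounded_set (f @` K).
  apply/compact_bounded/continuous_compact => //.
  exact: continuous_subspaceT.
by exists M => // x Kx; apply/ltW/fM; exists x.
Qed.

Lemma compact_continuous_min f K : compact K -> continuous f ->
  (forall x, K x -> 0 < f x) ->
  exists2 c : R, 0 < c & forall x, K x -> c <= f x.
Proof.
move=> cK cf f0; have [->|K0] := eqVneq K set0; first by exists 1.
have [||| x /set_mem Kx xmin] := @compact_EVT_min _ _ f K.
- exact/set0P.
- by [].
- exact: continuous_subspaceT.
by exists (f x) => [|y Ky]; [exact: f0|apply: xmin; exact/mem_set].
Qed.

Lemma uniform_continuity f K : compact K -> continuous f ->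
  (forall x, ~ K x -> f x = 0) ->
  forall e : R, 0 < e ->
  exists2 d : R, 0 < d & forall x y, `|x - y| < d -> `|f x - f y| < e.
Proof.
move=> cK cf f0 e e0.
have : \forall d \near (0 : R)^'+,
    K `<=` [set x | forall y, `|x - y| < d -> `|f x - f y| < e].
  apply: (compact_near_coveringP K).1 => // x Kx.
  have [r r0 xrU] : exists2 r : R, 0 < r &
      ball x r `<=` [set y | `|f x - f y| < e / 2].
    apply/nbhs_ballP; have /cvgrPdist_lt := cf x; apply.
    by rewrite divr_gt0.
  exists (ball x (r / 2), [set d | d <= r / 2]) => /=.
    by split; [apply: nbhsx_ballx; rewrite divr_gt0|apply: nbhs_right_le; rewrite divr_gt0].
  move=> [x' d] [/= xx' dr] y xy.
  have fx' : `|f x - f x'| < e / 2.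
    apply: xrU; rewrite -ball_normE/= in xx' *.
    by rewrite (lt_trans xx')// ltr_pdivrMr// ltr_pMr// ltr1n.
  have fy : `|f x - f y| < e / 2.
    apply: xrU; rewrite -ball_normE/= in xx' *.
    rewrite -(subrK x' x) -addrA (le_lt_trans (ler_normD _ _))//.
    by rewrite (splitr r) ltrD// (lt_le_trans xy).
  rewrite -(subrK (f x) (f x')) -addrA (le_lt_trans (ler_normD _ _))//.
  by rewrite (splitr e) ltrD// distrC.
move=> nd; have /filter_ex[d [d0 dP]] : \forall d \near (0 : R)^'+,
    0 < d /\ K `<=` [set x | forall y, `|x - y| < d -> `|f x - f y| < e].
  by apply: filterI => //; exact: nbhs_right_gt.
exists d => // x y xy.
have [Kx|nKx] := pselect (K x); first exact: dP.
have [Ky|nKy] := pselect (K y); last by rewrite !f0// subrr normr0.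
by rewrite distrC; apply: dP => //; rewrite distrC.
Qed.

End CompactRow.

Section TestFunctions.
Context {R : realType} {n : nat}.
Notation V := 'rV[R]_n.
Implicit Types (f g : V -> R) (D K : set V).

Definition supp f : set V := closure [set x | f x != 0].

Lemma supp0 f x : ~ supp f x -> f x = 0.
Proof.
by move=> nfx; apply/eqP; apply/negP => fx; apply: nfx; apply: subset_closure; exact/negP.
Qed.

Lemma partial_locally_cst (W : set V) (g : V -> R) (c : R) i x : open W -> W x ->
  (forall y, W y -> g y = c) -> partial i g x = 0.
Proof.
move=> oW Wx gc; rewrite -(derive_cst c x (delta_mx ord0 i)).
apply: near_eq_derive.
by have : nbhs x W by [exact: open_nbhs_nbhs]; apply: filterS => y /gc.
Qed.

Lemma partial_supp0 f i x : ~ supp f x -> partial i f x = 0.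
Proof.
move=> nfx; apply: (@partial_locally_cst (~` supp f) f 0) => //; last exact: supp0.
exact/closed_openC/closed_closure.
Qed.

Lemma compact_closed_row K : compact K -> closed K.
Proof. by apply: compact_closed; exact: norm_hausdorff. Qed.

(** Vanishing outside some compact subset of D is the practical criterion: it
avoids computing the support. *)
Lemma test_functionI D K f : Cinfty f -> compact K -> K `<=` D ->
  (forall x, ~ K x -> f x = 0) -> test_function D f.
Proof.
move=> Cf cK KD f0.
have sK : supp f `<=` K.
  rewrite /supp ((closure_id K).1 (compact_closed_row cK)).
  by apply: closure_subset => x /= fx; apply: contrapT => /f0 fx0; rewrite fx0 eqxx in fx.
split=> //; last exact: subset_trans sK _.
apply: subclosed_compact sK => //; exact: closed_closure.
Qed.

Lemma test_functionW D f g : test_function D f -> Cinfty g ->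
  (forall x, ~ supp f x -> g x = 0) -> test_function D g.
Proof. by move=> [Cf cf fD] Cg g0; exact: test_functionI cf fD g0. Qed.

Lemma test_function_subset D D' f : D `<=` D' -> test_function D f -> test_function D' f.
Proof. by move=> DD' [? ? fD]; split=> //; exact: subset_trans fD DD'. Qed.

Lemma test_function0 D f x : test_function D f -> ~ D x -> f x = 0.
Proof. by move=> [_ _ fD] nDx; apply: supp0 => /fD. Qed.

Lemma test_functionM D f g : test_function D f -> Cinfty g ->
  test_function D (fun x => f x * g x).
Proof.
move=> tf Cg; have [Cf _ _] := tf; apply: (test_functionW tf).
  exact: CinftyM.
by move=> x /supp0 ->; rewrite mul0r.
Qed.

Lemma test_functionMr D f g : test_function D f -> Cinfty g ->
  test_function D (fun x => g x * f x).
Proof. by move=> tf Cg; under eq_fun do rewrite mulrC; exact: test_functionM. Qed.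

Lemma test_functionZ D c f : test_function D f -> test_function D (fun x => c * f x).
Proof. by move=> tf; apply: test_functionMr => //; exact: Cinfty_cst. Qed.

Lemma test_function_partial D f i : test_function D f -> test_function D (partial i f).
Proof.
move=> tf; have [Cf _ _] := tf; apply: (test_functionW tf).
  exact: Cinfty_partial.
by move=> x; exact: partial_supp0.
Qed.

Lemma test_functionD D f g : test_function D f -> test_function D g ->
  test_function D (fun x => f x + g x).
Proof.
move=> [Cf cf fD] [Cg cg gD].
apply: (@test_functionI D (supp f `|` supp g)).
- exact: CinftyD.
- exact: compactU.
- by move=> x [/fD|/gD].
- by move=> x /not_orP[/supp0 -> /supp0 ->]; rewrite addr0.
Qed.

Lemma test_functionB D f g : test_function D f -> test_function D g ->
  test_function D (fun x => f x - g x).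
Proof.
move=> tf tg; have := test_functionD tf (test_functionZ (-1) tg).
by under eq_fun do rewrite mulN1r.
Qed.

Lemma test_function_cst0 D : test_function D (fun _ => 0).
Proof.
apply: (@test_functionI D set0) => //; first exact: Cinfty_cst.
exact: compact0.
Qed.

Lemma test_function_bounded D f : test_function D f ->
  exists2 M, 0 < M & forall x, `|f x| <= M.
Proof.
move=> [Cf cf fD].
have [M M0 fM] := compact_continuous_bounded cf (Cinfty_continuous Cf).
exists M => // x; have [/fM//|nx] := pselect (supp f x).
by rewrite supp0// normr0 ltW.
Qed.

Lemma test_function_uniform D f : test_function D f ->
  forall e : R, 0 < e ->
  exists2 d : R, 0 < d & forall x y, `|x - y| < d -> `|f x - f y| < e.
Proof.
move=> [Cf cf fD]; apply: uniform_continuity cf (Cinfty_continuous Cf) _.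
by move=> x; exact: supp0.
Qed.

End TestFunctions.

Section Step.
Context {R : realType}.

Definition step (t : R) : R := flat 0 t / (flat 0 t + flat 0 (1 - t)).

Lemma step_denom_gt0 (t : R) : 0 < flat 0 t + flat 0 (1 - t).
Proof.
have [t0|t0] := ltP 0 t; first by rewrite ltr_wpDr ?flat_ge0 ?flat_gt0.
by rewrite ltr_wpDl ?flat_ge0 ?flat_gt0// subr_gt0 (le_lt_trans t0).
Qed.

Lemma step_ge0 t : 0 <= step t.
Proof. by rewrite divr_ge0 ?flat_ge0// ltW// step_denom_gt0. Qed.

Lemma step_le1 t : step t <= 1.
Proof.
by rewrite ler_pdivrMr ?step_denom_gt0// mul1r lerDl flat_ge0.
Qed.

Lemma step1 t : 1 <= t -> step t = 1.
Proof.
move=> t1; rewrite /step [flat 0 (1 - t)]flat_eq0 ?subr_le0// addr0 divff//.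
by rewrite gt_eqF// flat_gt0// (lt_le_trans ltr01).
Qed.

Lemma step0 t : t <= 0 -> step t = 0.
Proof. by move=> t0; rewrite /step flat_eq0// mul0r. Qed.

Lemma Ck_along_step (V : normedModType R) (D : set V) k (f : V -> R) :
  Ck_along D k f -> Ck_along D k (fun y => step (f y)).
Proof.
move=> Cf; have C1 : Ck_along D k (fun y => flat 0 (1 - f y)).
  by apply/Ck_along_flat/Ck_alongB => //; exact: Ck_along_cst.
apply: Ck_alongM; first exact: Ck_along_flat.
apply: Ck_alongV; first by move=> y; rewrite gt_eqF ?step_denom_gt0.
by apply: Ck_alongD => //; exact: Ck_along_flat.
Qed.

End Step.

Section Boxes.
Context {R : realType} {n : nat}.
Notation V := 'rV[R]_n.
Implicit Types (a b x : V) (D K U : set V).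

Definition box a b : set V :=
  [set x | forall i, a ord0 i < x ord0 i < b ord0 i].

Definition closed_box a b : set V :=
  [set x | forall i, a ord0 i <= x ord0 i <= b ord0 i].

Lemma closed_box_compact a b : compact (closed_box a b).
Proof.
have := @rV_compact R n (fun i => `[a ord0 i, b ord0 i]%classic)
  (fun i => @segment_compact _ _ _).
by congr compact; apply/seteqP; split => x /= h i; have := h i; rewrite in_itv.
Qed.

Definition box_bump a b x : R :=
  \prod_i (flat 0 (x ord0 i - a ord0 i) * flat 0 (b ord0 i - x ord0 i)).

Lemma box_bump_ge0 a b x : 0 <= box_bump a b x.
Proof. by apply: prodr_ge0 => i _; rewrite mulr_ge0 ?flat_ge0. Qed.

Lemma box_bump_gt0 a b x : box a b x -> 0 < box_bump a b x.
Proof.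
move=> abx; apply: prodr_gt0 => i _; have /andP[ax xb] := abx i.
by rewrite mulr_gt0 ?flat_gt0 ?subr_gt0.
Qed.

Lemma box_bump_eq0 a b x : ~ box a b x -> box_bump a b x = 0.
Proof.
move=> /existsNP[i /negP]; rewrite negb_and -!leNgt => abx.
apply/eqP; rewrite /box_bump prodf_seq_eq0; apply/hasP; exists i.
  by rewrite mem_index_enum.
rewrite /= mulf_eq0; apply/orP.
by case/orP: abx => xi; [left|right]; rewrite flat_eq0 ?subr_le0.
Qed.

Lemma Cinfty_box_bump a b : Cinfty (box_bump a b).
Proof.
apply: Cinfty_prod => i _; apply: CinftyM; apply: Cinfty_flat; apply: CinftyB.
- exact: Cinfty_coord.
- exact: Cinfty_cst.
- exact: Cinfty_cst.
- exact: Cinfty_coord.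
Qed.

Lemma box_closed_box a b : box a b `<=` closed_box a b.
Proof. by move=> x abx i; have /andP[/ltW-> /ltW->] := abx i. Qed.

Lemma ball_box x (r : R) : 0 < r ->
  ball x r = box (x - const_mx r) (x + const_mx r).
Proof.
move=> r0; rewrite -ball_normE; apply/seteqP; split => y /=.
  move=> xy i; have := le_lt_trans (le_coord_norm (x - y) i) xy.
  by rewrite !mxE ltr_distlC.
move=> h; apply: row_norm_lt => // i; have := h i.
by rewrite !mxE ltr_distlC.
Qed.

Lemma closed_box_norm x (r : R) : 0 <= r ->
  closed_box (x - const_mx r) (x + const_mx r) = [set y | `|x - y| <= r].
Proof.
move=> r0; apply/seteqP; split => y /=.
  by move=> h; apply: row_norm_le => // i; have := h i; rewrite !mxE ler_distlC.
move=> xy i; have := le_trans (le_coord_norm (x - y) i) xy.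
by rewrite !mxE ler_distlC.
Qed.

(** A finite sum of box bumps is at least some c > 0 on K; composing 2/c times
this sum with the smooth step gives a function equal to 1 where the sum
exceeds c/2, a neighbourhood of K. *)
Lemma cutoff K U : compact K -> open U -> K `<=` U ->
  exists chi : V -> R, [/\ test_function U chi, forall x, 0 <= chi x <= 1 &
    exists W, [/\ open W, K `<=` W & forall x, W x -> chi x = 1]].
Proof.
move=> cK oU KU; have [d d0 dU] := compact_thickening cK oU KU.
have r0 : 0 < d / 2 by rewrite divr_gt0.
pose lo x : V := x - const_mx (d / 2); pose hi x : V := x + const_mx (d / 2).
have := cK; rewrite compact_cover => /(_ V K (fun x => ball x (d / 2))).
case=> [x Kx||D DK KD]; first exact: ball_open.
  by move=> x Kx; exists x => //; exact: ballxx.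
pose s : seq V := finmap.enum_fset D.
have sK p : p \in s -> K p by move=> ps; apply/set_mem/DK.
have Ks x : K x -> exists2 p, p \in s & ball p (d / 2) x.
  by move=> /KD[p /= pD px]; exists p.
pose F x := \sum_(p <- s) box_bump (lo p) (hi p) x.
have CF : Cinfty F by apply: Cinfty_sum => p _; exact: Cinfty_box_bump.
have F0 x : 0 <= F x by apply: sumr_ge0 => p _; exact: box_bump_ge0.
have FK x : K x -> 0 < F x.
  move=> /Ks[p pD]; rewrite ball_box// => /box_bump_gt0 Fp.
  rewrite /F (big_rem p)//= ltr_wpDr// sumr_ge0// => q _.
  exact: box_bump_ge0.
have [c c0 cF] := compact_continuous_min cK (Cinfty_continuous CF) FK.
exists (fun x => step (2 / c * F x)).
have Cchi : Cinfty (fun x => step (2 / c * F x)).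
  apply/CinftyP => k; apply: Ck_along_step; move: k.
  by apply/CinftyP; exact: CinftyZ.
split.
- apply: (@test_functionI _ _ _ (\big[setU/set0]_(p <- s) closed_box (lo p) (hi p))) => //.
  + by apply: bigsetU_compact => p _; exact: closed_box_compact.
  + move=> x; rewrite -bigcup_seq => -[p /= pD].
    rewrite closed_box_norm ?ltW// => xp; apply: (dU p) => //.
      exact: sK.
    by rewrite (le_lt_trans xp)// ltr_pdivrMr// ltr_pMr// ltr1n.
  + move=> x; rewrite -bigcup_seq => nx.
    rewrite /F big_seq big1 ?mulr0 ?step0// => p pD.
    by apply: box_bump_eq0 => /box_closed_box px; apply: nx; exists p.
- by move=> x; rewrite step_ge0 step_le1.
exists [set x | c / 2 < F x]; split.
- apply: (@open_comp _ _ F [set y | c / 2 < y]); last exact: open_gt.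
  by move=> x _; exact: Cinfty_continuous.
- by move=> x /cF /= cFx; rewrite (lt_le_trans _ cFx)// ltr_pdivrMr// ltr_pMr// ltr1n.
- move=> x /= Fx; rewrite step1//.
  by rewrite mulrAC ler_pdivlMr// mul1r -ler_pdivrMl// mulrC ltW.
Qed.

End Boxes.

(** * The space L^2 *)

Section L2Space.
Context {d : measure_display} {X : measurableType d} {R : realType}.
Variables (mu : {measure set X -> \bar R}) (D : set X).
Hypothesis mD : measurable D.
Implicit Types (f g h : X -> R).

Local Notation ip := (L2prod mu D).
Local Notation nm := (L2norm mu D).

Lemma L2P f : L2 mu D f <->
  measurable_fun D f /\ mu.-integrable D (EFin \o (fun x => f x ^+ 2)).
Proof.
have E : (EFin \o (fun x => (f \_ D) x ^+ 2)) = (EFin \o (fun x => f x ^+ 2)) \_ D.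
  apply/funext => x /=; rewrite !patchE; case: ifPn => //=.
  by rewrite expr0n.
split => [Lf|[mf iff]].
  split; last by apply/(integrable_mkcond _ mD); rewrite -E; exact: Lfun2_integrable_sqr.
  apply/(measurable_restrictT _ mD).
  by move: Lf; rewrite /L2 inE => /andP[]; rewrite inE.
rewrite /L2 inE; apply/andP; rewrite !inE; split.
  exact/(measurable_restrictT _ mD).
rewrite /= /finite_norm unlock poweR_lty//.
have := (integrable_mkcond _ mD).1 iff; rewrite -E => /integrableP[_].
apply: le_lt_trans; rewrite le_eqVlt; apply/orP; left; apply/eqP.
by apply: eq_integral => x _ /=; rewrite powR_mulrn// normrX.
Qed.

Lemma L2_measurable f : L2 mu D f -> measurable_fun D f.
Proof. by move/L2P => []. Qed.

Lemma L2_mul_integrable f g : L2 mu D f -> L2 mu D g ->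
  mu.-integrable D (EFin \o (fun x => f x * g x)).
Proof.
move=> Lf Lg; apply/(integrable_mkcond _ mD).
have -> : (EFin \o (fun x => f x * g x)) \_ D = EFin \o (f \_ D \* g \_ D).
  apply/funext => x /=; rewrite !patchE; case: ifPn => //= _.
  by rewrite mulr0.
by apply/Lfun1_integrable; exact: Lfun2_mul_Lfun1.
Qed.

Lemma L2normE f : nm f = Num.sqrt (\int[mu]_(x in D) (f x ^+ 2)).
Proof.
rewrite /L2norm unlock /Rintegral.
rewrite [in RHS]integral_mkcond.
have -> : (\int[mu]_x `|(EFin \o f \_ D) x| `^ 2 =
    \int[mu]_x ((fun x => (f x ^+ 2)%:E) \_ D) x)%E.
  apply: eq_integral => x _ /=; rewrite powR_mulrn// -normrX.
  rewrite !patchE; case: ifPn => _; first by rewrite ger0_norm// sqr_ge0.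
  by rewrite expr0n normr0.
have : (0 <= \int[mu]_x ((fun x => (f x ^+ 2)%:E) \_ D) x)%E.
  by apply: integral_ge0 => x _; rewrite patchE; case: ifPn => // _; rewrite lee_fin sqr_ge0.
case: (integral _ _ _) => [r| |] //=; first by rewrite lee_fin => r0; rewrite powR12_sqrt.
by rewrite sqrtr0 invr_eq0 pnatr_eq0.
Qed.

Lemma L2norm_ge0 f : 0 <= nm f.
Proof. by rewrite L2normE sqrtr_ge0. Qed.

Lemma L2prodC f g : ip f g = ip g f.
Proof. by apply: eq_Rintegral => x _; rewrite mulrC. Qed.

Lemma L2prod_sqr f : ip f f = nm f ^+ 2.
Proof.
rewrite L2normE sqr_sqrtr; last by apply: Rintegral_ge0 => x _; rewrite sqr_ge0.
by apply: eq_Rintegral => x _; rewrite expr2.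
Qed.

Lemma L2_0 : L2 mu D (fun=> 0).
Proof.
apply/L2P; split; first exact: measurable_cst.
rewrite (_ : _ \o _ = cst 0%E); first exact: integrable0.
by apply/funext => x /=; rewrite expr0n.
Qed.

Lemma L2Z c f : L2 mu D f -> L2 mu D (fun x => c * f x).
Proof.
move=> /L2P[mf iff]; apply/L2P; split; first exact: measurable_funM.
have := integrableZl mD (c ^+ 2) iff; apply: eq_integrable => // x _ /=.
by rewrite exprMn EFinM.
Qed.

Lemma L2D f g : L2 mu D f -> L2 mu D g -> L2 mu D (fun x => f x + g x).
Proof.
move=> Lf Lg; have [mf iff] := (L2P _).1 Lf; have [mg ig] := (L2P _).1 Lg.
apply/L2P; split; first exact: measurable_funD.
have := integrableD mD (integrableD mD iff ig)
  (integrableZl mD 2 (L2_mul_integrable Lf Lg)).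
apply: eq_integrable => // x _ /=.
by rewrite -EFinM -!EFinD; congr EFin; ring.
Qed.

Lemma L2N f : L2 mu D f -> L2 mu D (fun x => - f x).
Proof. by move=> /(L2Z (-1)); under eq_fun do rewrite mulN1r. Qed.

Lemma L2B f g : L2 mu D f -> L2 mu D g -> L2 mu D (fun x => f x - g x).
Proof. by move=> Lf Lg; apply: L2D => //; exact: L2N. Qed.

Lemma L2_norm_comp f : L2 mu D f -> L2 mu D (fun x => `|f x|).
Proof.
move=> /L2P[mf iff]; apply/L2P; split; first exact: measurableT_comp.
by apply: eq_integrable iff => // x _ /=; rewrite real_normK ?num_real.
Qed.

Lemma L2_boundedM f g M : measurable_fun D f -> (forall x, D x -> `|f x| <= M) ->
  L2 mu D g -> L2 mu D (fun x => f x * g x).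
Proof.
move=> mf fM /L2P[mg ig]; apply/L2P; split; first exact: measurable_funM.
apply: (le_integrable _ _ _ (integrableZl mD (M ^+ 2) ig)) => //.
  by apply/measurable_EFinP; apply: measurable_funX; exact: measurable_funM.
move=> x Dx /=; rewrite lee_fin exprMn normrM [leRHS]normrM ler_wpM2r// !normrX.
by rewrite ler_pXn2r ?nnegrE// (le_trans (fM _ Dx))// ler_norm.
Qed.

Lemma L2prodDl f g h : L2 mu D f -> L2 mu D g -> L2 mu D h ->
  ip (fun x => f x + g x) h = ip f h + ip g h.
Proof.
move=> Lf Lg Lh; rewrite /L2prod -RintegralD//; try exact: L2_mul_integrable.
by apply: eq_Rintegral => x _; rewrite mulrDl.
Qed.

Lemma L2prodZl c f g : L2 mu D f -> L2 mu D g ->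
  ip (fun x => c * f x) g = c * ip f g.
Proof.
move=> Lf Lg; rewrite /L2prod -RintegralZl//; try exact: L2_mul_integrable.
by apply: eq_Rintegral => x _; rewrite mulrA.
Qed.

Lemma L2prodDr f g h : L2 mu D f -> L2 mu D g -> L2 mu D h ->
  ip f (fun x => g x + h x) = ip f g + ip f h.
Proof. by move=> Lf Lg Lh; rewrite !(L2prodC f) L2prodDl. Qed.

Lemma L2prodZr c f g : L2 mu D f -> L2 mu D g ->
  ip f (fun x => c * g x) = c * ip f g.
Proof. by move=> Lf Lg; rewrite !(L2prodC f) L2prodZl. Qed.

Lemma L2prodNl f g : L2 mu D f -> L2 mu D g -> ip (fun x => - f x) g = - ip f g.
Proof.
move=> Lf Lg; rewrite -mulN1r -L2prodZl//.
by apply: eq_Rintegral => x _; rewrite mulN1r.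
Qed.

Lemma L2prodNr f g : L2 mu D f -> L2 mu D g -> ip f (fun x => - g x) = - ip f g.
Proof. by move=> Lf Lg; rewrite !(L2prodC f) L2prodNl. Qed.

Lemma L2prodBl f g h : L2 mu D f -> L2 mu D g -> L2 mu D h ->
  ip (fun x => f x - g x) h = ip f h - ip g h.
Proof. by move=> Lf Lg Lh; rewrite L2prodDl ?L2prodNl//; exact: L2N. Qed.

Lemma L2prodBr f g h : L2 mu D f -> L2 mu D g -> L2 mu D h ->
  ip f (fun x => g x - h x) = ip f g - ip f h.
Proof. by move=> Lf Lg Lh; rewrite !(L2prodC f) L2prodBl. Qed.

Lemma L2prod_ge0 f g : (forall x, D x -> 0 <= f x) -> (forall x, D x -> 0 <= g x) ->
  0 <= ip f g.
Proof. by move=> f0 g0; apply: Rintegral_ge0 => x Dx; rewrite mulr_ge0 ?f0 ?g0. Qed.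

Lemma eq_L2prod f f' g g' :
  (forall x, D x -> f x * g x = f' x * g' x) -> ip f g = ip f' g'.
Proof. by move=> e; apply: eq_Rintegral => x /set_mem /e. Qed.

Lemma L2prod0r f : ip f (fun=> 0) = 0.
Proof.
by rewrite /L2prod /Rintegral; under eq_integral do rewrite mulr0; rewrite integral0.
Qed.

Lemma L2_sum (I : Type) (r : seq I) (F : I -> X -> R) :
  (forall i, L2 mu D (F i)) -> L2 mu D (fun x => \sum_(i <- r) F i x).
Proof.
move=> LF; elim: r => [|i r IH].
  by under eq_fun do rewrite big_nil; exact: L2_0.
by under eq_fun do rewrite big_cons; exact: L2D.
Qed.

Lemma L2prod_sumr (I : Type) (r : seq I) f (F : I -> X -> R) :
  L2 mu D f -> (forall i, L2 mu D (F i)) ->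
  ip f (fun x => \sum_(i <- r) F i x) = \sum_(i <- r) ip f (F i).
Proof.
move=> Lf LF; elim: r => [|i r IH].
  by under eq_fun do rewrite big_nil; rewrite big_nil L2prod0r.
under eq_fun do rewrite big_cons.
by rewrite L2prodDr ?IH ?big_cons//; exact: L2_sum.
Qed.

Lemma L2prod_suml (I : Type) (r : seq I) (F : I -> X -> R) f :
  (forall i, L2 mu D (F i)) -> L2 mu D f ->
  ip (fun x => \sum_(i <- r) F i x) f = \sum_(i <- r) ip (F i) f.
Proof.
by move=> LF Lf; rewrite L2prodC L2prod_sumr//; apply: eq_bigr => i _; rewrite L2prodC.
Qed.

(** A nonnegative quadratic polynomial has a nonpositive discriminant; with
a = 0 it forces b = 0, which is how Euler-Lagrange equations will appear. *)
Lemma quadratic_discriminant (a b c : R) : 0 <= c ->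
  (forall t, 0 <= a + t * (2 * b) + t ^+ 2 * c) -> b ^+ 2 <= a * c.
Proof.
move=> c0 q.
have [c_eq0|cn0] := eqVneq c 0.
  rewrite c_eq0 mulr0; have [->|b0] := eqVneq b 0; first by rewrite expr0n.
  have := q (- (a + 1) / (2 * b)); rewrite c_eq0 mulr0 addr0 divfK ?mulf_neq0//.
  by rewrite opprD addrA subrr add0r oppr_ge0 ler10.
have cp : 0 < c by rewrite lt0r cn0.
have := q (- b / c); have -> : a + - b / c * (2 * b) + (- b / c) ^+ 2 * c = a - b ^+ 2 / c.
  by field.
by rewrite subr_ge0 ler_pdivrMr.
Qed.

Lemma L2prod_CauchySchwarz f g : L2 mu D f -> L2 mu D g ->
  `|ip f g| <= nm f * nm g.
Proof.
move=> Lf Lg.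
rewrite -(@ler_pXn2r _ 2)// ?nnegrE ?mulr_ge0 ?L2norm_ge0//.
rewrite real_normK ?num_real// exprMn -!L2prod_sqr.
apply: quadratic_discriminant; first by rewrite L2prod_sqr sqr_ge0.
move=> t; have -> : ip f f + t * (2 * ip f g) + t ^+ 2 * ip g g =
    nm (fun x => f x + t * g x) ^+ 2; last by rewrite sqr_ge0.
have Ltg := L2Z t Lg.
rewrite -L2prod_sqr L2prodDl ?L2prodDr//; try exact: L2D.
rewrite !L2prodZl// !L2prodZr// (L2prodC g f).
by ring.
Qed.

Lemma L2norm_sqrD f g : L2 mu D f -> L2 mu D g ->
  nm (fun x => f x + g x) ^+ 2 = nm f ^+ 2 + 2 * ip f g + nm g ^+ 2.
Proof.
move=> Lf Lg; rewrite -!L2prod_sqr L2prodDl ?L2prodDr//; try exact: L2D.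
by rewrite (L2prodC g f); ring.
Qed.

Lemma L2normZ c f : L2 mu D f -> nm (fun x => c * f x) = `|c| * nm f.
Proof.
move=> Lf; apply/eqP; rewrite -(@eqrXn2 _ 2)// ?L2norm_ge0// ?mulr_ge0 ?L2norm_ge0//.
rewrite exprMn -!L2prod_sqr L2prodZl ?L2prodZr//; last exact: L2Z.
by rewrite real_normK ?num_real// expr2 mulrA.
Qed.

Lemma L2normD f g : L2 mu D f -> L2 mu D g ->
  nm (fun x => f x + g x) <= nm f + nm g.
Proof.
move=> Lf Lg; rewrite -(@ler_pXn2r _ 2)// ?nnegrE ?addr_ge0 ?L2norm_ge0//.
rewrite L2norm_sqrD// sqrrD !lerD2r lerD2l -[leRHS]mulr_natl.
rewrite ler_pM2l//; apply: le_trans (L2prod_CauchySchwarz Lf Lg).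
exact: ler_norm.
Qed.

Lemma L2norm_distC f g : nm (fun x => f x - g x) = nm (fun x => g x - f x).
Proof.
by rewrite !L2normE; congr Num.sqrt; apply: eq_Rintegral => x _; rewrite -sqrrN opprB.
Qed.

Lemma L2norm_le f g : L2 mu D f -> L2 mu D g ->
  (forall x, D x -> `|f x| <= `|g x|) -> nm f <= nm g.
Proof.
move=> /L2P[mf iff] /L2P[mg ig] fg; rewrite !L2normE ler_wsqrtr//.
apply: le_Rintegral => // x Dx.
by rewrite -[leLHS]real_normK ?num_real// -[leRHS]real_normK ?num_real// ler_pXn2r ?nnegrE// fg.
Qed.

Lemma L2prod_cvgl (f_ : nat -> X -> R) f g :
  (forall k, L2 mu D (f_ k)) -> L2 mu D f -> L2 mu D g ->
  nm (fun x => f_ k x - f x) @[k --> \oo] --> 0 ->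
  ip (f_ k) g @[k --> \oo] --> ip f g.
Proof.
move=> Lf_ Lf Lg cf; apply/cvgrPdist_le => e e0.
have g1 : 0 < nm g + 1 by rewrite ltr_wpDl ?L2norm_ge0.
have /cvgr0Pnorm_le /(_ (e / (nm g + 1))) := cf.
rewrite divr_gt0// => /(_ isT); apply: filterS => k.
rewrite ger0_norm ?L2norm_ge0// => fk.
rewrite distrC -L2prodBl// (le_trans (L2prod_CauchySchwarz _ _))//; first exact: L2B.
rewrite (le_trans (ler_wpM2r (L2norm_ge0 _) fk))// mulrAC ler_pdivrMr//.
by apply: ler_wpM2l; [exact: ltW|rewrite lerDl].
Qed.

End L2Space.

(** * Completeness of L^2 *)

Lemma cvg_geometric_increments {R : realType} (u : nat -> R) (C : R) :
  (forall j, `|u j.+1 - u j| <= C * 2^-1 ^+ j) -> cvgn u.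
Proof.
move=> uC; have C0 : 0 <= C.
  by have := le_trans (normr_ge0 _) (uC 0%N); rewrite expr0 mulr1.
have cs : cvgn (series (telescope u)).
  apply: normed_cvg; apply: (@series_le_cvg _ _ (geometric C 2^-1)).
  - by move=> n /=.
  - by move=> n /=; rewrite mulr_ge0// exprn_ge0// invr_ge0.
  - by move=> n /=; exact: uC.
  apply: is_cvg_geometric_series.
  by rewrite ger0_norm ?invr_ge0// invf_lt1// ltr1n.
have -> : u = (fun n => u 0%N + series (telescope u) n).
  by apply/funext => n; exact: eq_sum_telescope.
by apply: is_cvgD => //; exact: is_cvg_cst.
Qed.

Lemma limn_einf_le {R : realType} (u : nat -> \bar R) (c : \bar R) N :
  (forall n, (N <= n)%N -> (u n <= c)%E) -> (limn_einf u <= c)%E.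
Proof.
move=> uc; rewrite limn_einf_lim; apply: lime_le; first exact: is_cvg_einfs.
near=> n; apply: (@le_trans _ _ (u (maxn n N))).
  by apply: ereal_inf_lbound; exists (maxn n N) => //=; rewrite leq_maxl.
by apply: uc; rewrite leq_maxr.
Unshelve. all: by end_near. Qed.

Section L2Complete.
Context {d : measure_display} {X : measurableType d} {R : realType}.
Variables (mu : {measure set X -> \bar R}) (D : set X).
Hypothesis mD : measurable D.
Local Notation nm := (L2norm mu D).

Lemma L2_integral f : L2 mu D f ->
  (\int[mu]_(x in D) (f x ^+ 2)%:E = (nm f ^+ 2)%:E)%E.
Proof.
move=> /(L2P mu mD)[mf iff]; rewrite -L2prod_sqr /L2prod /Rintegral fineK.
  by apply: eq_integral => x _; rewrite expr2.
by apply: integrable_fin_num => //; apply: eq_integrable iff => // x _ /=; rewrite expr2.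
Qed.

(** The series of the 4^j |u_(j+1) - u_j|^2 has a finite integral, hence a
finite sum almost everywhere, and this makes the increments geometric. *)
Lemma rapid_cvg_ae (u : nat -> X -> R) :
  (forall j, L2 mu D (u j)) ->
  (forall j, nm (fun x => u j.+1 x - u j x) <= 4^-1 ^+ j) ->
  {ae mu, forall x, D x -> cvgn (u ^~ x)}.
Proof.
move=> Lu du.
(* despite the weight 4^j the integrals are at most 2^-j *)
pose w j x := (4 ^+ j * (u j.+1 x - u j x) ^+ 2)%:E.
have mw j : measurable_fun D (w j).
  apply/measurable_EFinP; apply: measurable_funM; first exact: measurable_cst.
  by apply: measurable_funX; apply: measurable_funB; exact: L2_measurable.
have w0 j x : (0 <= w j x)%E by rewrite lee_fin mulr_ge0 ?sqr_ge0 ?exprn_ge0.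
have Ldu j : L2 mu D (fun x => u j.+1 x - u j x) by exact: L2B.
have iw j : (\int[mu]_(x in D) w j x <= (2^-1 ^+ j)%:E)%E.
  rewrite /w; under eq_integral do rewrite EFinM.
  rewrite ge0_integralZl_EFin//; last 2 first.
  - by move=> x _; rewrite lee_fin sqr_ge0.
  - by apply/measurable_EFinP; apply: measurable_funX; exact: L2_measurable.
  rewrite L2_integral// -EFinM lee_fin.
  have q0 : 0 <= 4^-1 ^+ j :> R by rewrite exprn_ge0 ?invr_ge0.
  have dj : nm (fun x => u j.+1 x - u j x) ^+ 2 <= (4^-1 ^+ j) ^+ 2.
    by rewrite ler_pXn2r ?nnegrE ?L2norm_ge0.
  apply: (le_trans (ler_wpM2l _ dj)); first by rewrite exprn_ge0.
  rewrite expr2 mulrA -exprMn divff// expr1n mul1r.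
  by apply: lerXn2r; rewrite ?nnegrE ?invr_ge0// lef_pV2 ?posrE// ler_nat.
have S0 x : D x -> (0 <= \sum_(j <oo) w j x)%E by move=> _; apply: nneseries_ge0.
have mS : measurable_fun D (fun x => \sum_(j <oo) w j x)%E.
  by apply: ge0_emeasurable_sum => // j x _ _; exact: w0.
have iS : mu.-integrable D (fun x => \sum_(j <oo) w j x)%E.
  apply/integrableP; split=> //.
  under eq_integral => x /set_mem Dx do rewrite gee0_abs ?S0//.
  rewrite integral_nneseries//.
  apply: (@le_lt_trans _ _ 2%:E); last exact: ltry.
  apply: lime_le.
    by apply: is_cvg_nneseries => n _ _; apply: integral_ge0.
  apply: nearW => n; rewrite (le_trans (lee_sum _ (fun j _ => iw j)))//.
  rewrite sumEFin lee_fin.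
  have : \sum_(0 <= i < n) 2^-1 ^+ i = 2 - 2 * 2^-1 ^+ n :> R.
    elim: n => [|n IHn]; first by rewrite big_geq// expr0 mulr1 subrr.
    by rewrite big_nat_recr//= IHn exprS; field.
  by move=> ->; rewrite gerBl mulr_ge0// exprn_ge0// invr_ge0.
have := integrable_ae mD iS; apply: filterS => x + Dx.
move=> /(_ Dx); set S := (X in X \is a fin_num) => Sfin.
apply: (@cvg_geometric_increments _ _ (Num.sqrt (fine S))) => j.
have wj : (w j x <= S)%E.
  apply: le_trans (nneseries_lim_ge j.+1 _); last by move=> *; exact: w0.
  by rewrite big_nat_recr//= leeDr// sume_ge0.
rewrite -(fineK Sfin) lee_fin in wj.
have S0' : 0 <= fine S by rewrite fine_ge0// S0.
rewrite -(@ler_pXn2r _ 2)// ?nnegrE ?mulr_ge0 ?sqrtr_ge0 ?exprn_ge0 ?invr_ge0//.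
rewrite real_normK ?num_real// exprMn sqr_sqrtr//.
have -> : (2^-1 ^+ j) ^+ 2 = (4 ^+ j)^-1 :> R.
  by rewrite -exprM mulnC exprM -exprVn; congr (_ ^+ _); field.
by rewrite ler_pdivlMr ?exprn_gt0// mulrC.
Qed.

(** Riesz-Fischer: a rapidly converging subsequence converges almost
everywhere, and Fatou's lemma along it bounds the distance to the limit. *)
Theorem L2_complete (f_ : nat -> X -> R) :
  (forall k, L2 mu D (f_ k)) ->
  (forall e, 0 < e -> exists N, forall k l, (N <= k)%N -> (N <= l)%N ->
    nm (fun x => f_ k x - f_ l x) <= e) ->
  exists2 f, L2 mu D f & nm (fun x => f_ k x - f x) @[k --> \oo] --> 0.
Proof.
move=> Lf cf.
have /choice[N NP] : forall j : nat, exists N, forall k l, (N <= k)%N -> (N <= l)%N ->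
    nm (fun x => f_ k x - f_ l x) <= 4^-1 ^+ j.
  by move=> j; apply: cf; rewrite exprn_gt0// invr_gt0.
pose m j := (\sum_(i < j.+1) N i + j)%N.
have Nm j i : (j <= i)%N -> (N j <= m i)%N.
  by move=> ji; rewrite /m (bigD1 (Ordinal (ji : (j < i.+1)%N)))//= -addnA leq_addr.
pose u j := f_ (m j).
have uC := @rapid_cvg_ae u (fun j => Lf _) (fun j => NP j _ _ (Nm _ _ (leqnSn j)) (Nm _ _ (leqnn j))).
pose f x := fine (limn_esup (fun j => (u j x)%:E)).
have mf : measurable_fun D f.
  apply: measurableT_comp => //.
  apply: measurable_fun_limn_esup => j; apply/measurable_EFinP.
  exact: (L2_measurable mD (Lf _)).
have fE x : cvgn (u ^~ x) -> u ^~ x @ \oo --> f x.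
  move=> cu; have cE : (fun j => (u j x)%:E) @ \oo --> (limn (u ^~ x))%:E.
    by apply/fine_cvgP; split; [exact: nearW|exact: cu].
  rewrite /f is_cvg_limn_esupE; last by apply/cvg_ex; eexists; exact: cE.
  by rewrite (cvg_lim _ cE).
have fatou_bound k e : 0 < e ->
    (exists K, forall l, (K <= l)%N -> nm (fun x => f_ k x - f_ l x) <= e) ->
    (\int[mu]_(x in D) ((f_ k x - f x) ^+ 2)%:E <= (e ^+ 2)%:E)%E.
  move=> e0 [K Kl].
  have mfk : measurable_fun D (f_ k) by exact: (L2_measurable mD (Lf _)).
  have mh j : measurable_fun D (fun x => ((f_ k x - u j x) ^+ 2)%:E).
    apply/measurable_EFinP; apply: measurable_funX; apply: measurable_funB => //.
    exact: (L2_measurable mD (Lf _)).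
  have h0 j x : D x -> (0 <= ((f_ k x - u j x) ^+ 2)%:E)%E.
    by move=> _; rewrite lee_fin sqr_ge0.
  apply: (@le_trans _ _ (\int[mu]_(x in D) limn_einf (fun j => ((f_ k x - u j x) ^+ 2)%:E))%E).
    apply: ae_ge0_le_integral => //.
    - by move=> x _; rewrite lee_fin sqr_ge0.
    - by apply/measurable_EFinP; apply: measurable_funX; exact: measurable_funB.
    - move=> x Dx; rewrite limn_einf_lim; apply: lime_ge; first exact: is_cvg_einfs.
      apply: nearW => n; apply: le_ereal_inf_tmp => _ [j _ <-]; exact: h0.
    - rewrite (_ : (fun x => _) =
        (fun x => - limn_esup (fun j => - ((f_ k x - u j x) ^+ 2)%:E))%E)//.
      apply: measurableT_comp => //; apply: measurable_fun_limn_esup => j.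
      exact: measurableT_comp.
    - apply: filterS uC => x cx Dx; have /fE ux := cx Dx.
      have cE : (fun j => ((f_ k x - u j x) ^+ 2)%:E) @ \oo --> ((f_ k x - f x) ^+ 2)%:E.
        apply/fine_cvgP; split; first exact: nearW.
        apply: (@cvg_comp _ _ _ (fun j => f_ k x - u j x) (fun y => y ^+ 2)).
          by apply: cvgB; [exact: cvg_cst|exact: ux].
        exact: exprn_continuous.
      rewrite is_cvg_limn_einfE; last by apply/cvg_ex; eexists; exact: cE.
      by rewrite (cvg_lim _ cE).
  apply: le_trans (fatou _ _ _ _) _ => //.
  apply: (@limn_einf_le _ _ _ K) => n Kn.
  rewrite L2_integral; last exact: (L2B mD (Lf _) (Lf _)).
  rewrite lee_fin; apply: lerXn2r; rewrite ?nnegrE ?L2norm_ge0 ?(ltW e0)//.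
  apply: Kl.
  by rewrite (leq_trans Kn)// /m leq_addl.
have Lfk k e : 0 < e ->
    (exists K, forall l, (K <= l)%N -> nm (fun x => f_ k x - f_ l x) <= e) ->
    L2 mu D (fun x => f_ k x - f x).
  move=> e0 Kl; apply/(L2P _ mD).
  have mB : measurable_fun D (fun x => f_ k x - f x).
    by apply: measurable_funB => //; exact: (L2_measurable mD (Lf _)).
  split=> //; apply/integrableP; split.
    by apply/measurable_EFinP; exact: measurable_funX.
  under eq_integral do rewrite gee0_abs ?lee_fin ?sqr_ge0//.
  exact: le_lt_trans (fatou_bound k e e0 Kl) (ltry _).
have Kl e : 0 < e -> exists N0, forall k, (N0 <= k)%N ->
    exists K, forall l, (K <= l)%N -> nm (fun x => f_ k x - f_ l x) <= e.
  by move=> /cf[N0 N0P]; exists N0 => k Nk; exists N0 => l Nl; exact: N0P.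
exists f.
  have [N0 /(_ N0 (leqnn _)) KN0] := Kl 1 ltr01.
  have := L2B mD (Lf N0) (Lfk _ _ ltr01 KN0).
  by under eq_fun do rewrite subKr.
apply/cvgr0Pnorm_le => e e0.
have [N0 N0P] := Kl e e0.
exists N0 => // k /= Nk; rewrite ger0_norm ?L2norm_ge0//.
rewrite -(@ler_pXn2r _ 2)// ?nnegrE ?L2norm_ge0 ?(ltW e0)//.
rewrite -lee_fin -L2_integral; first exact: fatou_bound (N0P k Nk).
exact: Lfk e0 (N0P k Nk).
Qed.

End L2Complete.

(** * Boxes generate the Borel sets *)

Section BorelSets.
Context {R : realType} {n : nat}.
Notation V := 'rV[R]_n.
Notation leb := (@lebesgue R n).

Lemma box_measurable (a b : V) : measurable (box a b).
Proof.
rewrite (_ : box a b =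
    \bigcap_(i in [set: 'I_n]) (row_coord i @^-1` `]a ord0 i, b ord0 i[%classic)).
  apply: fin_bigcap_measurable => [|i _]; first exact: finite_finset.
  by rewrite -[X in measurable X]setTI; exact: measurable_row_coord.
apply/seteqP; split => x /= h i; last by have := h i I; rewrite /= in_itv.
by move=> _; rewrite /= in_itv; exact: h.
Qed.

Definition rational_ball (p : 'rV[rat]_n * nat) : set V :=
  box (map_mx ratr p.1 - const_mx p.2.+1%:R^-1) (map_mx ratr p.1 + const_mx p.2.+1%:R^-1).

Definition rational_closed_ball (p : 'rV[rat]_n * nat) : set V :=
  closed_box (map_mx ratr p.1 - const_mx p.2.+1%:R^-1)
             (map_mx ratr p.1 + const_mx p.2.+1%:R^-1).

(** Balls with rational centres and radii 1/(k+1) form a countable base; the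
closed ball is required inside U so that test functions fit in. *)
Lemma open_rational_ball (U : set V) x : open U -> U x ->
  exists2 p, rational_ball p x & rational_closed_ball p `<=` U.
Proof.
move=> oU Ux; have [r r0 xrU] := open_contains_ball oU Ux.
have r20 : 0 < r / 2 by rewrite divr_gt0.
pose k := Num.truncn (r / 2)^-1.
have k0 : 0 < (k.+1%:R : R)^-1 by rewrite invr_gt0.
have kr : (k.+1%:R : R)^-1 <= r / 2.
  by rewrite -[leRHS]invrK lef_pV2 ?posrE ?invr_gt0// ltW// truncnS_gt.
have /choice[q qP] : forall i : 'I_n, exists q : rat,
    `|ratr q - x ord0 i| < k.+1%:R^-1.
  move=> i; have /rat_in_itvoo[q] : x ord0 i - k.+1%:R^-1 < x ord0 i + k.+1%:R^-1.
    by rewrite ltrD2l (lt_trans _ k0)// oppr_lt0.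
  by rewrite in_itv/= => qi; exists q; rewrite distrC ltr_distlC.
have xq : `|map_mx ratr (\row_i q i) - x| < k.+1%:R^-1.
  by apply: row_norm_lt => // i; rewrite !mxE; exact: qP.
exists (\row_i q i, k) => /=.
  by rewrite /rational_ball/= -ball_box// -ball_normE.
move=> y; rewrite /rational_closed_ball/= closed_box_norm ?ltW//= => qy.
apply: xrU; rewrite -ball_normE/=.
rewrite -(subrK (map_mx ratr (\row_i q i)) x) -addrA (le_lt_trans (ler_normD _ _))//.
by rewrite (splitr r) ltr_leD ?(lt_le_trans _ kr) ?(le_trans qy)// distrC.
Qed.

Lemma rational_ballW p : rational_ball p `<=` rational_closed_ball p.
Proof. exact: box_closed_box. Qed.

Definition boxes : set_system V := [set A | exists a b, A = box a b].

Lemma open_sigma_boxes (U : set V) : open U -> <<s boxes >> U.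
Proof.
move=> oU.
have -> : U = \bigcup_p (if `[< rational_closed_ball p `<=` U >]
                          then rational_ball p else set0).
  apply/seteqP; split => x.
    move=> Ux; have [p px pU] := open_rational_ball oU Ux.
    by exists p => //; case: asboolP.
  by move=> [p _]; case: asboolP => // h /rational_ballW /h.
apply: (@countable_bigcupT_measurable _ (g_sigma_algebraType boxes)).
  exact: countableP.
move=> p; case: ifPn => // _; apply: sub_sigma_algebra.
by do 2 eexists.
Qed.

Lemma measurable_boxes : @measurable _ V = <<s boxes >>.
Proof.
apply/seteqP; split; last first.
  apply: smallest_sub; first exact: sigma_algebra_measurable.
  by move=> _ [a [b ->]]; exact: box_measurable.
apply: smallest_sub; first exact: smallest_sigma_algebra.
have mcoord i : @measurable_fun _ _ (g_sigma_algebraType boxes) R setT (@row_coord R n i).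
  apply: (measurability _ (RGenOInfty.measurableE R)) => _ [_ [y ->] <-].
  rewrite setTI; apply: open_sigma_boxes.
  by apply: open_comp => [x _|]; [exact: coord_continuous|exact: interval_open].
by move=> A; rewrite -bigcup_seq => -[i _ [B mB <-]]; exact: mcoord.
Qed.

Lemma open_measurable_row (U : set V) : open U -> measurable U.
Proof.
move=> /open_sigma_boxes; apply: smallest_sub.
  exact: sigma_algebra_measurable.
by move=> _ [a [b ->]]; exact: box_measurable.
Qed.

Lemma continuous_measurable_row (f : V -> R) (D : set V) :
  measurable D -> continuous f -> measurable_fun D f.
Proof.
move=> mD cf; apply: (measurable_funS measurableT) => //.
apply: (measurability _ (RGenOInfty.measurableE R)) => _ [_ [y ->] <-].
rewrite setTI; apply: open_measurable_row.
by apply: open_comp => [x _|]; [exact: cf|exact: interval_open].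
Qed.

Lemma closed_box_measurable (a b : V) : measurable (closed_box a b).
Proof.
rewrite -[closed_box a b]setCK; apply: measurableC; apply: open_measurable_row.
apply: closed_openC; apply: compact_closed_row; exact: closed_box_compact.
Qed.

Lemma lebesgue_closed_box_lty (a b : V) : (leb (closed_box a b) < +oo)%E.
Proof.
have := @lebesgue_box R n (fun i => `[a ord0 i, b ord0 i]%classic) (fun i => measurable_itv _).
rewrite (_ : [set x | _] = closed_box a b) => [->|]; last first.
  by apply/seteqP; split => x /= h i; have := h i; rewrite in_itv.
suff : (0 <= \prod_(i < n) lebesgue_measure `[a ord0 i, b ord0 i]%classic < +oo)%E.
  by case/andP.
elim/big_ind : _ => [|x y /andP[x0 xo] /andP[y0 yo]|i _].
- by rewrite lee01 ltry.
- by rewrite mule_ge0//= lte_mul_pinfty// ge0_fin_numE.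
- rewrite measure_ge0/= lebesgue_measure_itv/=.
  by case: ifPn => _; [rewrite -EFinB ltry|rewrite ltry].
Qed.

End BorelSets.

Section ConsRow.
Context {R : realType} {n : nat}.
Implicit Types (t : R) (v : 'rV[R]_n).

Lemma cons_row0 t v : cons_row (t, v) ord0 ord0 = t.
Proof. by have /(congr1 fst) := cons_rowK (t, v). Qed.

Lemma cons_rowS t v i : cons_row (t, v) ord0 (lift ord0 i) = v ord0 i.
Proof. by have /(congr1 snd)/rowP/(_ i) := cons_rowK (t, v); rewrite mxE. Qed.

Lemma cons_rowP (x y : 'rV[R]_n.+1) : x ord0 ord0 = y ord0 ord0 ->
  (forall i, x ord0 (lift ord0 i) = y ord0 (lift ord0 i)) -> x = y.
Proof. by move=> x0 xS; apply/rowP => i; case: (unliftP ord0 i) => [j|] ->. Qed.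

Lemma cons_row_addS t v h i :
  cons_row (t, h *: delta_mx ord0 i + v) =
  h *: delta_mx ord0 (lift ord0 i) + cons_row (t, v).
Proof.
apply: cons_rowP => [|j].
  by rewrite cons_row0 [in RHS]mxE cons_row0 !mxE /= mulr0 add0r.
rewrite cons_rowS [in RHS]mxE cons_rowS !mxE /=.
by rewrite (inj_eq (@lift_inj _ _)).
Qed.

Lemma cons_row_add0 t v h :
  cons_row (h + t, v) = h *: delta_mx ord0 ord0 + cons_row (t, v).
Proof.
apply: cons_rowP => [|j].
  by rewrite cons_row0 [in RHS]mxE cons_row0 !mxE /= mulr1.
by rewrite cons_rowS [in RHS]mxE cons_rowS !mxE /= mulr0 add0r.
Qed.

Lemma continuous_cons_rowr t : continuous (fun v => cons_row (t, v)).
Proof.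
move=> v; apply/(@cvgrPdist_lt _ _ _ _ (nbhs_filter (v : 'rV[R]_n))) => e e0.
near=> v'.
apply: (@le_lt_trans _ _ `|v - v'|).
  apply: row_norm_le => // i; case: (unliftP ord0 i) => [j|] ->.
    rewrite mxE [X in _ + X]mxE !cons_rowS.
    by have := le_coord_norm (v - v') j; rewrite !mxE.
  by rewrite mxE [X in _ + X]mxE !cons_row0 subrr normr0.
by near: v'; apply: cvgr_dist_lt.
Unshelve. all: by end_near. Qed.

Lemma continuous_cons_rowl v : continuous (fun t => cons_row (t, v)).
Proof.
move=> t; apply/cvgrPdist_lt => e e0; near=> t'.
apply: (@le_lt_trans _ _ `|t - t'|).
  apply: row_norm_le => // i; case: (unliftP ord0 i) => [j|] ->.
    by rewrite mxE [X in _ + X]mxE !cons_rowS subrr normr0.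
  by rewrite mxE [X in _ + X]mxE !cons_row0.
by near: t'; apply: cvgr_dist_lt.
Unshelve. all: by end_near. Qed.

End ConsRow.

(** * The integral of a derivative vanishes *)

Section IntegralPartial.
Context {R : realType}.

Lemma continuous_compact_support_integrable n (g : 'rV[R]_n -> R) (M : R) :
  0 <= M -> continuous g -> (forall x, M < `|x| -> g x = 0) ->
  (lebesgue n).-integrable [set: 'rV[R]_n] (EFin \o g).
Proof.
move=> M0 cg g0; pose K : set 'rV[R]_n := closed_box (0 - const_mx M) (0 + const_mx M).
have mK : measurable K by exact: closed_box_measurable.
have [C C0 gC] := compact_continuous_bounded (@closed_box_compact R n _ _ : compact K) cg.
have iK : (lebesgue n).-integrable K (EFin \o g).
  apply: measurable_bounded_integrable => //.
  - exact: lebesgue_closed_box_lty.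
  - exact: continuous_measurable_row.
  - exists C; split; first exact: num_real.
    by move=> y Cy x Kx /=; rewrite (le_trans (gC _ Kx))// ltW.
have -> : EFin \o g = (EFin \o g) \_ K.
  apply/funext => x; rewrite patchE; case: ifPn => //; rewrite notin_setE => nK.
  rewrite /= g0// ltNge; apply/negP => xM; apply: nK.
  by rewrite /K closed_box_norm//= sub0r normrN.
exact/(integrable_mkcond _ mK).
Qed.

Let open_outside {V : normedModType R} (M : R) : open [set x : V | M < `|x|].
Proof.
apply: (@open_comp _ _ (fun x : V => `|x|) [set y | M < y]); last exact: open_gt.
by move=> x _; exact: norm_continuous.
Qed.

Lemma partial_outside n (f : 'rV[R]_n -> R) i (M : R) x :
  (forall x, M < `|x| -> f x = 0) -> M < `|x| -> partial i f x = 0.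
Proof. by move=> f0 Mx; exact: (partial_locally_cst i (open_outside M) Mx f0). Qed.

Lemma integral_derive_compact (F : R -> R) (M : R) : 0 <= M ->
  continuous F -> (forall x, derivable F x 1) -> continuous (derive1 F) ->
  (forall x, M < `|x| -> F x = 0) ->
  (\int[lebesgue_measure]_x (derive1 F x)%:E = 0)%E.
Proof.
move=> M0 cF dF cdF F0.
pose a := M + 1.
have Ma : M < a by rewrite /a ltrDl.
have a0 : 0 < a by rewrite (le_lt_trans M0).
have dF0 x : M < `|x| -> derive1 F x = 0.
  move=> Mx; rewrite derive1E -(derive_cst (0 : R) x (1 : R)).
  apply: near_eq_derive.
  have : nbhs x [set y : R | M < `|y|].
    by apply: open_nbhs_nbhs; split=> //; exact: open_outside.
  by apply: filterS => y /F0.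
rewrite (_ : (fun x => _) = (fun x => (derive1 F x)%:E) \_ `[- a, a]%classic); last first.
  apply/funext => x; rewrite patchE; case: ifPn => //.
  rewrite notin_setE /= in_itv/= => /negP nx; rewrite dF0//.
  by rewrite ltNge; apply: contra nx => xM; rewrite -ler_norml (le_trans xM) ?ltW.
have aa : - a < a by rewrite (lt_trans _ a0)// oppr_lt0.
have cw : {within `[- a, a], continuous (derive1 F)} by exact: continuous_subspaceT.
have dw : derivable_oo_LRcontinuous F (- a) a.
  split=> [x _||]; first exact: dF.
  + by apply: cvg_at_right_filter; exact: cF.
  + by apply: cvg_at_left_filter; exact: cF.
rewrite -integral_mkcond; apply: (etrans (continuous_FTC2 aa cw dw (fun _ _ => erefl))).
by rewrite !F0 ?subee// ?normrN gtr0_norm.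
Qed.

Lemma ge0_integral_cons_row n (f : 'rV[R]_n.+1 -> \bar R) :
  measurable_fun setT f -> (forall x, 0 <= f x)%E ->
  (\int[lebesgue n.+1]_x f x =
   \int[(lebesgue_measure \x lebesgue n)%E]_p f (cons_row p))%E.
Proof.
move=> mf f0.
have H := @ge0_integral_pushforward _ _ (measurableTypeR R * 'rV[R]_n)%type _ R
  (@cons_row R n) measurable_cons_row (lebesgue_measure \x lebesgue n)%E setT f
  measurableT mf (fun y _ => f0 y).
transitivity (\int[pushforward (lebesgue_measure \x lebesgue n)%E (@cons_row R n)]_x f x)%E.
  by [].
by rewrite [LHS]H preimage_setT.
Qed.

Lemma integrable_cons_row n (f : 'rV[R]_n.+1 -> \bar R) :
  (lebesgue n.+1).-integrable setT f ->
  (lebesgue_measure \x lebesgue n)%E.-integrable setT (f \o cons_row).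
Proof.
move=> /integrableP[mf fi]; apply/integrableP; split.
  exact: measurableT_comp measurable_cons_row.
by move: fi; rewrite ge0_integral_cons_row//; exact: measurableT_comp.
Qed.

Lemma integral_cons_row n (f : 'rV[R]_n.+1 -> \bar R) :
  (lebesgue n.+1).-integrable setT f ->
  (\int[lebesgue n.+1]_x f x =
   \int[(lebesgue_measure \x lebesgue n)%E]_p f (cons_row p))%E.
Proof.
move=> fi; have [mf _] := integrableP _ _ _ fi.
have H := @integral_pushforward _ _ (measurableTypeR R * 'rV[R]_n)%type _ R
  (@cons_row R n) measurable_cons_row (lebesgue_measure \x lebesgue n)%E setT f
  mf.
transitivity (\int[pushforward (lebesgue_measure \x lebesgue n)%E (@cons_row R n)]_x f x)%E.
  by [].
rewrite [LHS]H ?preimage_setT//; exact: integrable_cons_row.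
Qed.

Section Slices.
Context {n : nat} (f : 'rV[R]_n.+1 -> R) (t : R) (v : 'rV[R]_n).

Let lineS j : (fun h : R => f (cons_row (t, h *: delta_mx ord0 j + v))) =
  (fun h : R => f (h *: delta_mx ord0 (lift ord0 j) + cons_row (t, v))).
Proof. by apply/funext => h; rewrite cons_row_addS. Qed.

Let line0 : (fun h : R => f (cons_row (h *: (1 : R) + t, v))) =
  (fun h : R => f (h *: delta_mx ord0 ord0 + cons_row (t, v))).
Proof. by apply/funext => h; rewrite -cons_row_add0 [h%:A]mulr1. Qed.

Lemma slice_partialS j : partial j (fun w => f (cons_row (t, w))) v =
  partial (lift ord0 j) f (cons_row (t, v)).
Proof. by rewrite /partial derive_line lineS -derive_line. Qed.

Lemma slice_derivableS j :
  derivable f (cons_row (t, v)) (delta_mx ord0 (lift ord0 j)) ->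
  derivable (fun w => f (cons_row (t, w))) v (delta_mx ord0 j).
Proof.
move/(derivable1P _ _ _).1 => df; apply: (derivable1P _ _ _).2.
by rewrite lineS.
Qed.

Lemma slice_partial0 : derive1 (fun s => f (cons_row (s, v))) t =
  partial ord0 f (cons_row (t, v)).
Proof. by rewrite derive1E /partial derive_line line0 -derive_line. Qed.

Lemma slice_derivable0 :
  derivable f (cons_row (t, v)) (delta_mx ord0 ord0) ->
  derivable (fun s => f (cons_row (s, v))) t 1.
Proof.
move/(derivable1P _ _ _).1 => df; apply: (derivable1P _ _ _).2.
by rewrite line0.
Qed.

Lemma continuous_sliceS : continuous f -> continuous (fun w => f (cons_row (t, w))).
Proof.
move=> cf w; apply: (@continuous_comp _ _ _ (fun v => cons_row (t, v)) f).
  exact: continuous_cons_rowr.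
exact: cf.
Qed.

Lemma continuous_slice0 : continuous f -> continuous (fun s => f (cons_row (s, v))).
Proof.
move=> cf w; apply: (@continuous_comp _ _ _ (fun t => cons_row (t, v)) f).
  exact: continuous_cons_rowl.
exact: cf.
Qed.

Lemma le_norm_sliceS : `|v| <= `|cons_row (t, v)|.
Proof.
apply: row_norm_le => // j; rewrite -(cons_rowS t v j); exact: le_coord_norm.
Qed.

Lemma le_norm_slice0 : `|t| <= `|cons_row (t, v)|.
Proof. by have := le_coord_norm (cons_row (t, v)) ord0; rewrite cons_row0. Qed.

End Slices.

(** Fubini and induction on the dimension. For i = 0 the inner integral is over
the first coordinate, and vanishes by the fundamental theorem of calculus;
otherwise it is over the other coordinates, and vanishes by induction. *)
Lemma integral_partial_compact n (f : 'rV[R]_n -> R) (i : 'I_n) (M : R) :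
  0 <= M -> continuous f -> (forall x, derivable f x (delta_mx ord0 i)) ->
  continuous (partial i f) -> (forall x, M < `|x| -> f x = 0) ->
  (\int[lebesgue n]_x (partial i f x)%:E = 0)%E.
Proof.
move=> M0; elim: n f i => [f []//|n IHn] f i cf df cpf f0.
have pf0 x := @partial_outside _ f i M x f0.
have ig := continuous_compact_support_integrable M0 cpf pf0.
have igp := integrable_cons_row ig.
rewrite (integral_cons_row ig).
case: (unliftP ord0 i) => [j|] iE; rewrite iE in df cpf igp *.
  rewrite -(integral12_prod_meas1 igp); apply: integral0_eq => t _.
  transitivity (\int[lebesgue n]_v
      (partial j (fun v => f (cons_row (t, v))) v)%:E)%E.
    by apply: eq_integral => v _; rewrite slice_partialS.
  apply: IHn.
  - exact: continuous_sliceS.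
  - by move=> v; apply: slice_derivableS; exact: df.
  - rewrite (_ : partial j _ = fun v => partial (lift ord0 j) f (cons_row (t, v))).
      exact: continuous_sliceS.
    by apply/funext => v; rewrite slice_partialS.
  - by move=> v Mv; apply: f0; apply: lt_le_trans Mv _; exact: le_norm_sliceS.
rewrite -(integral21_prod_meas1 igp); apply: integral0_eq => v _.
transitivity (\int[lebesgue_measure]_t
    (derive1 (fun t => f (cons_row (t, v))) t)%:E)%E.
  by apply: eq_integral => t _; rewrite slice_partial0.
apply: (integral_derive_compact M0).
- exact: continuous_slice0.
- by move=> t; apply: slice_derivable0; exact: df.
- rewrite (_ : derive1 _ = fun t => partial ord0 f (cons_row (t, v))).
    exact: continuous_slice0.
  by apply/funext => t; rewrite slice_partial0.
- by move=> t Mt; apply: f0; apply: lt_le_trans Mt _; exact: le_norm_slice0.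
Qed.

End IntegralPartial.

(** * Integration on a bounded open set *)

Lemma box_setI {R : realType} {n : nat} (a1 b1 a2 b2 : 'rV[R]_n) :
  box a1 b1 `&` box a2 b2 =
  box (\row_i Num.max (a1 ord0 i) (a2 ord0 i)) (\row_i Num.min (b1 ord0 i) (b2 ord0 i)).
Proof.
apply/seteqP; split => x /=.
  move=> [h1 h2] i; rewrite !mxE gt_max lt_min.
  by have /andP[-> ->] := h1 i; have /andP[-> ->] := h2 i.
move=> h; split => i; have := h i; rewrite !mxE gt_max lt_min.
  by move=> /andP[/andP[-> _] /andP[-> _]].
by move=> /andP[/andP[_ ->] /andP[_ ->]].
Qed.

Section Domain.
Context {R : realType} {n : nat}.
Notation V := 'rV[R]_n.
Notation leb := (@lebesgue R n).
Variable Omega : set V.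
Hypotheses (oO : open Omega) (bO : bounded_set Omega).
Implicit Types (f g : V -> R).

Local Notation ip := (L2prod leb Omega).

Lemma domain_measurable : measurable Omega.
Proof. exact: open_measurable_row. Qed.

Let mO := domain_measurable.

Lemma domain_in_box : exists2 M : R, 0 < M & Omega `<=` closed_box (0 - const_mx M) (0 + const_mx M).
Proof.
have [M M0 OM] := ex_strict_bound_gt0 bO.
exists M => // x Ox; rewrite closed_box_norm ?ltW//= sub0r normrN ltW//.
exact: OM.
Qed.

Lemma domain_finite : (leb Omega < +oo)%E.
Proof.
have [M M0 OM] := domain_in_box; apply: le_lt_trans (lebesgue_closed_box_lty _ _).
apply: le_measure OM; rewrite inE//; exact: closed_box_measurable.
Qed.

Lemma continuous_domain_bounded f : continuous f ->
  exists2 C, 0 < C & forall x, Omega x -> `|f x| <= C.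
Proof.
move=> cf; have [M M0 OM] := domain_in_box.
have [C C0 fC] := compact_continuous_bounded
  (@closed_box_compact R n _ _ : compact (closed_box (0 - const_mx M) (0 + const_mx M))) cf.
by exists C => // x /OM; exact: fC.
Qed.

Lemma bounded_L2 f C : measurable_fun Omega f -> (forall x, Omega x -> `|f x| <= C) ->
  L2 leb Omega f.
Proof.
move=> mf fC; apply/(L2P _ mO); split => //.
apply: measurable_bounded_integrable => //.
- exact: domain_finite.
- exact: measurable_funX.
- exists (C ^+ 2); split; first exact: num_real.
  move=> y Cy x Ox /=; rewrite normrX (le_trans _ (ltW Cy))//.
  by rewrite lerXn2r ?nnegrE ?fC// (le_trans (normr_ge0 _) (fC _ Ox)).
Qed.

Lemma continuous_L2domain f : continuous f -> L2 leb Omega f.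
Proof.
move=> cf; have [C C0 fC] := continuous_domain_bounded cf.
by apply: bounded_L2 fC; exact: continuous_measurable_row.
Qed.

Lemma Cinfty_L2 f : Cinfty f -> L2 leb Omega f.
Proof. by move=> /Cinfty_continuous; exact: continuous_L2domain. Qed.

Lemma continuous_mul_L2 f g : continuous f -> L2 leb Omega g ->
  L2 leb Omega (fun x => f x * g x).
Proof.
move=> cf; have [C C0 fC] := continuous_domain_bounded cf.
by apply: (L2_boundedM mO _ fC); exact: continuous_measurable_row.
Qed.

Lemma L2_integrable f : L2 leb Omega f -> leb.-integrable Omega (EFin \o f).
Proof.
move=> Lf; have L1 : L2 leb Omega (fun=> 1) by apply/Cinfty_L2/Cinfty_cst.
have := L2_mul_integrable mO Lf L1; apply: eq_integrable => // x _ /=.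
by rewrite mulr1.
Qed.

Lemma test_function_L2 D f : test_function D f -> L2 leb Omega f.
Proof. by move=> [Cf _ _]; exact: Cinfty_L2. Qed.

Lemma integral_partial_test f i : test_function Omega f ->
  \int[leb]_(x in Omega) partial i f x = 0.
Proof.
move=> tf; have [Cf cf fO] := tf; have [M M0 OM] := domain_in_box.
have f0 x : M < `|x| -> f x = 0.
  move=> Mx; apply: (test_function0 tf) => /OM.
  by rewrite closed_box_norm ?ltW//= sub0r normrN leNgt Mx.
have := integral_partial_compact (ltW M0) (Cinfty_continuous Cf)
  (fun x => @Cinfty_derivable _ _ f i x Cf)
  (Cinfty_continuous (Cinfty_partial i Cf)) f0.
move=> H; rewrite /Rintegral.
have -> : (\int[leb]_(x in Omega) (partial i f x)%:E = 0)%E; last by [].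
rewrite -[RHS]H integral_mkcond; apply: eq_integral => x _; rewrite patchE.
case: ifPn => //; rewrite notin_setE => nOx.
by rewrite (test_function0 (test_function_partial i tf) nOx).
Qed.

Lemma integration_by_parts_test f z i : Cinfty f -> test_function Omega z ->
  ip f (partial i z) = - ip (partial i f) z.
Proof.
move=> Cf tz; have [Cz _ _] := tz.
have Lf := Cinfty_L2 Cf; have Lz := Cinfty_L2 Cz.
have Lfi := Cinfty_L2 (Cinfty_partial i Cf); have Lzi := Cinfty_L2 (Cinfty_partial i Cz).
apply/eqP; rewrite -addr_eq0; apply/eqP.
rewrite -[RHS](integral_partial_test i (test_functionMr tz Cf)).
rewrite /L2prod -RintegralD//; try exact: L2_mul_integrable.
by apply: eq_Rintegral => x _; rewrite partialM//; ring.
Qed.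

(** Fundamental lemma of the calculus of variations: g vanishes almost
everywhere on each of countably many balls covering U. *)
Section Fundamental.
Variables (U : set V) (g : V -> R).
Hypotheses (oU : open U) (UO : U `<=` Omega) (Lg : L2 leb Omega g).
Hypothesis gz : forall z, test_function U z -> ip g z = 0.

Let ig : leb.-integrable Omega (EFin \o g) := L2_integrable Lg.
Let mg : measurable_fun Omega g := L2_measurable mO Lg.

(** The functions b / (b + 1/(j+1)), with b the bump of the box, increase to the
indicator of the box; dominated convergence does the rest. *)
Lemma integral_box0 a b : closed_box a b `<=` U ->
  (\int[leb]_(x in box a b) (g x)%:E = 0)%E.
Proof.
move=> abU; have mB := box_measurable a b.
have BO : box a b `<=` Omega.
  by apply: (subset_trans (@box_closed_box _ _ a b)); exact: subset_trans abU UO.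
pose z (j : nat) x : R := box_bump a b x / (box_bump a b x + j.+1%:R^-1).
have j0 j : 0 < j.+1%:R^-1 :> R by rewrite invr_gt0.
have den0 j x : 0 < box_bump a b x + j.+1%:R^-1.
  by rewrite ltr_wpDl ?box_bump_ge0.
have Cz j : Cinfty (z j).
  apply: CinftyM; first exact: Cinfty_box_bump.
  apply: CinftyV; first by move=> x; rewrite gt_eqF.
  by apply: CinftyD; [exact: Cinfty_box_bump|exact: Cinfty_cst].
have z0 j x : ~ box a b x -> z j x = 0.
  by move=> nx; rewrite /z box_bump_eq0// mul0r.
have tz j : test_function U (z j).
  apply: (@test_functionI _ _ U (closed_box a b)) => //.
    exact: closed_box_compact.
  by move=> x nx; apply: z0 => /box_closed_box.
have z1 j x : `|z j x| <= 1.
  rewrite ger0_norm; last by rewrite divr_ge0 ?box_bump_ge0// ltW.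
  by rewrite ler_pdivrMr// mul1r lerDl ltW.
have igB : leb.-integrable (box a b) (EFin \o g) by exact: integrableS ig.
have mgB : measurable_fun (box a b) g by exact: measurable_funS mg.
have := @dominated_convergence _ _ _ leb _ mB (fun j x => (g x * z j x)%:E)
  (EFin \o g) (abse \o (EFin \o g)).
case.
- move=> j; apply/measurable_EFinP; apply: measurable_funM => //.
  by apply: continuous_measurable_row => //; exact: Cinfty_continuous.
- exact/measurable_EFinP.
- apply: aeW => x Bx; apply/fine_cvgP; split; first exact: nearW.
  rewrite /= -[X in _ --> X]mulr1; apply: cvgM; first exact: cvg_cst.
  have Ex := box_bump_gt0 Bx.
  rewrite -(divff (lt0r_neq0 Ex)); apply: cvgM; first exact: cvg_cst.
  apply: cvgV; first exact: lt0r_neq0.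
  rewrite -[X in _ --> X]addr0; apply: cvgD; first exact: cvg_cst.
  exact: cvg_harmonic.
- exact: integrable_abse.
- apply: aeW => x j Bx /=; rewrite lee_fin normrM -[leRHS]mulr1.
  by rewrite ler_wpM2l.
move=> _ _; set I := (X in X @ \oo --> _) => cI.
have I0 : I = cst 0%E.
  apply/funext => j; rewrite /I /=.
  have := gz (tz j); rewrite /L2prod /Rintegral.
  rewrite (_ : \int[leb]_(x in Omega) _ = \int[leb]_(x in box a b) (g x * z j x)%:E)%E; last first.
    rewrite [LHS]integral_mkcond [RHS]integral_mkcond; apply: eq_integral => x _.
    rewrite !patchE; case: ifPn => xO; case: ifPn => xB //.
      by rewrite z0 ?mulr0//; apply/set_mem; rewrite in_setC.
    by case/negP: xO; apply/mem_set/BO/set_mem.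
  have : (\int[leb]_(x in box a b) (g x * z j x)%:E \is a fin_num)%E.
    apply: integrable_fin_num => //; apply: (integrableS mO mB BO).
    by apply: L2_mul_integrable => //; exact: Cinfty_L2.
  by move=> H1 H2; rewrite -(fineK H1) H2.
rewrite I0 in cI; exact: (cvg_unique _ cI (cvg_cst _)).
Qed.

(** Inside a fixed box the vanishing extends from boxes to Borel sets: boxes are
stable under intersection and generate. *)
Lemma integral_box_measurable0 a b S : closed_box a b `<=` U -> measurable S ->
  (\int[leb]_(x in S `&` box a b) (g x)%:E = 0)%E.
Proof.
move=> abU; have mB := box_measurable a b.
have BO : box a b `<=` Omega.
  by apply: (subset_trans (@box_closed_box _ _ a b)); exact: subset_trans abU UO.
have igB A : measurable A -> leb.-integrable (A `&` box a b) (EFin \o g).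
  move=> mA; apply: integrableS ig => //; first exact: measurableI.
  by move=> x [_ /BO].
have mgB A : measurable A -> measurable_fun (A `&` box a b) (EFin \o g).
  by move=> /igB /integrableP[].
rewrite measurable_boxes.
apply: (dynkin_induction (P := fun S => (\int[leb]_(x in S `&` box a b) (g x)%:E = 0)%E) measurable_boxes).
- move=> _ _ [a1 [b1 ->]] [a2 [b2 ->]].
  by rewrite box_setI; do 2 eexists.
- by rewrite setTI integral_box0.
- move=> _ [a1 [b1 ->]]; rewrite box_setI.
  apply: integral_box0; apply: subset_trans abU => x h i.
  by have := h i; rewrite !mxE ge_max le_min => /andP[/andP[_ ->] /andP[_ ->]].
- move=> A mA A0.
  have : (\int[leb]_(x in box a b) (g x)%:E = 0)%E by exact: integral_box0.
  have BE : box a b = (A `&` box a b) `|` (~` A `&` box a b).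
    by rewrite -setIUl setUv setTI.
  rewrite [X in integral _ X _]BE integral_setU//.
  + by rewrite A0 add0e.
  + exact: measurableI.
  + by apply: measurableI => //; exact: measurableC.
  + by rewrite -BE -[box a b]setTI; exact: mgB.
  + by apply/disj_setPS; rewrite setIACA setICr set0I.
- move=> F mF tF F0; rewrite setI_bigcupl integral_bigcup.
  + by apply: eseries0 => k _ _; exact: F0.
  + by apply: trivIset_setIr.
  + by move=> k; exact: measurableI.
  + by rewrite -setI_bigcupl; apply: igB; exact: bigcup_measurable.
Qed.

Theorem fundamental_lemma : {ae leb, forall x, U x -> g x = 0}.
Proof.
pose N (p : 'rV[rat]_n * nat) : set V :=
  if `[< rational_closed_ball p `<=` U >] then rational_ball p `&` [set x | g x != 0]
  else set0.
have N0 p : leb.-negligible (N p).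
  rewrite /N; case: asboolP => [pU|_]; last exact: negligible_set0.
  have mB := box_measurable (map_mx ratr p.1 - const_mx p.2.+1%:R^-1 : V)
    (map_mx ratr p.1 + const_mx p.2.+1%:R^-1).
  have := @integral_ae_eq _ _ _ leb (rational_ball p) mB (cst 0%E) (EFin \o g).
  case.
  - apply: integrableS ig => //.
    by apply: (subset_trans (@rational_ballW _ _ p)); exact: subset_trans pU UO.
  - exact: measurable_cst.
  - move=> E Ep mE; rewrite integral0 -((setIidPl _ _).2 Ep).
    exact: integral_box_measurable0.
  - move=> A [mA A0 NA]; exists A; split => // x [px /= gx]; apply: NA => /= h.
    by have [gx0] := h px; rewrite gx0 eqxx in gx.
have : leb.-negligible (\bigcup_k (if unpickle k is Some p then N p else set0)).
  by apply: negligible_bigcup => k; case: unpickle => // ; exact: negligible_set0.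
move=> [A [mA A0 NA]]; exists A; split => // x /= /not_implyP[Ux /eqP gx].
apply: NA; have [p px pU] := open_rational_ball oU Ux.
by exists (pickle p) => //; rewrite pickleK /N; case: asboolP.
Qed.

End Fundamental.
End Domain.

(** * Convolution with a test function is smooth *)

Section ParameterIntegral.
Context {d : measure_display} {X : measurableType d} {R : realType}.
Variables (mu : {measure set X -> \bar R}) (D : set X).
Hypotheses (mD : measurable D) (muD : (mu D < +oo)%E).

Lemma is_derive_L2prod (psi : X -> R) (f f' : R -> X -> R) (u v C a : R) :
  L2 mu D psi -> u < a < v ->
  (forall t, u < t < v -> L2 mu D (f t)) ->
  (forall t y, u < t < v -> D y -> is_derive t 1 (f ^~ y) (f' t y)) ->
  (forall t y, u < t < v -> D y -> `|f' t y| <= C) ->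
  is_derive a 1 (fun t => L2prod mu D psi (f t)) (L2prod mu D psi (f' a)).
Proof.
move=> Lpsi auv Lf df fC.
have L1 : L2 mu D (fun=> C).
  apply/(L2P _ mD); split; first exact: measurable_cst.
  apply: measurable_bounded_integrable => //.
  exists (C ^+ 2); split; first exact: num_real.
  by move=> y Cy x Dx /=; rewrite normrX real_normK ?num_real// ltW.
pose F t y := psi y * f t y.
have Ia : [set` `]u, v[] a by rewrite /= in_itv.
have dF t y : [set` `]u, v[] t -> D y -> is_derive t 1 (F ^~ y) (psi y * f' t y).
  rewrite /= in_itv/= => tuv Dy; have dty := df t y tuv Dy.
  exact: (@is_deriveZ _ _ _ (f ^~ y) (psi y) t 1 (f' t y) dty).
have iF t : [set` `]u, v[] t -> mu.-integrable D (EFin \o F t).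
  by rewrite /= in_itv/= => tuv; apply: L2_mul_integrable => //; exact: Lf.
have dF1 t y : [set` `]u, v[] t -> D y -> derivable (F ^~ y) t 1.
  by move=> It Dy; have [] := dF t y It Dy.
have iG : mu.-integrable D (EFin \o (fun y => `|psi y| * `|C|)).
  by apply: L2_mul_integrable => //; apply: L2_norm_comp.
have Gub t y : [set` `]u, v[] t -> D y -> `|partial1of2 F t y| <= `|psi y| * `|C|.
  move=> It Dy; rewrite partial1of2E; have [_ ->] := dF t y It Dy.
  rewrite normrM ler_wpM2l// (le_trans _ (ler_norm C))//; exact: fC.
have G0 y : 0 <= `|psi y| * `|C| by rewrite mulr_ge0.
have h1 := derivable_under_integral mD Ia iF dF1 G0 iG Gub.
have h2 := differentiation_under_integral mD Ia iF dF1 G0 iG Gub.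
split; first exact: h1.
rewrite -derive1E; apply: (etrans h2).
apply: eq_Rintegral => y /set_mem Dy.
by rewrite partial1of2E; have [_ ->] := dF a y Ia Dy.
Qed.

End ParameterIntegral.

Section Convolution.
Context {R : realType} {n : nat}.
Notation V := 'rV[R]_n.
Notation leb := (@lebesgue R n).
Variable Omega : set V.
Hypotheses (oO : open Omega) (bO : bounded_set Omega).
Variable psi : V -> R.
Hypothesis Lpsi : L2 leb Omega psi.

Let mO : measurable Omega := domain_measurable oO.

Definition convolution (g : V -> R) (x : V) : R := L2prod leb Omega psi (fun y => g (x - y)).

Lemma reflect_L2 (g : V -> R) x : Cinfty g -> L2 leb Omega (fun y => g (x - y)).
Proof. by move=> Cg; apply: (Cinfty_L2 oO bO); exact: Cinfty_reflect. Qed.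

Lemma conv_continuous (g : V -> R) : test_function setT g -> continuous (convolution g).
Proof.
move=> tg x; have [Cg _ _] := tg.
apply/(@cvgrPdist_le _ _ _ _ (nbhs_filter (x : V))) => e e0.
have L1 : L2 leb Omega (fun=> 1) by apply/(Cinfty_L2 oO bO)/Cinfty_cst.
pose K := L2norm leb Omega psi * L2norm leb Omega (fun=> 1) + 1.
have K0 : 0 < K by rewrite ltr_wpDl// mulr_ge0 ?L2norm_ge0.
have eK : 0 < e / K by rewrite divr_gt0.
have [d d0 gd] := test_function_uniform tg eK.
near=> x'.
rewrite -L2prodBr//; try exact: reflect_L2.
have LB : L2 leb Omega (fun y => g (x - y) - g (x' - y)).
  by apply: L2B => //; exact: reflect_L2.
rewrite (le_trans (L2prod_CauchySchwarz mO Lpsi LB))//.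
have nB : L2norm leb Omega (fun y => g (x - y) - g (x' - y)) <=
    e / K * L2norm leb Omega (fun=> 1).
  rewrite -[X in X * _]ger0_norm ?(ltW eK)// -L2normZ//.
  apply: (L2norm_le mO) => //; first exact: L2Z.
  move=> y _; rewrite mulr1 [leRHS]ger0_norm ?(ltW eK)//.
  rewrite ltW// gd// opprB addrA subrK.
  by near: x'; apply: (@cvgr_dist_lt _ _ _ _ (nbhs_filter (x : V))).
rewrite (le_trans (ler_wpM2l (L2norm_ge0 _ _ _) nB))//.
rewrite mulrCA mulrAC ler_pdivrMr//; apply: ler_wpM2l; first exact: ltW.
by rewrite lerDl.
Unshelve. all: by end_near. Qed.

Lemma is_derive_line (f : V -> R) (v z : V) (t : R) : derivable f (t *: v + z) v ->
  is_derive t 1 (fun s : R => f (s *: v + z)) ('D_v f (t *: v + z)).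
Proof.
have E : (fun h : R => f ((h *: (1 : R) + t) *: v + z)) =
    (fun h : R => f (h *: v + (t *: v + z))).
  by apply/funext => h; rewrite [h%:A]mulr1 scalerDl addrA.
move=> df; split.
  by apply: (derivable1P _ _ _).2; rewrite E; exact: (derivable1P _ _ _).1.
by rewrite derive_line E -derive_line.
Qed.

Lemma is_derive_conv (g : V -> R) i x : test_function setT g ->
  is_derive x (delta_mx ord0 i) (convolution g) (convolution (partial i g) x).
Proof.
move=> tg; have [Cg _ _] := tg.
have [C C0 gC] := test_function_bounded (test_function_partial i tg).
pose e : V := delta_mx ord0 i.
have m1 : -1 < (0 : R) < 1 by rewrite ltrN10 ltr01.
have Lf t : L2 leb Omega (fun y => g (t *: e + x - y)) by exact: reflect_L2.
have df (t : R) (y : V) : is_derive t 1 (fun s : R => g (s *: e + x - y))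
    (partial i g (t *: e + x - y)).
  have -> : (fun s : R => g (s *: e + x - y)) = (fun s : R => g (s *: e + (x - y))).
    by apply/funext => s; rewrite addrA.
  rewrite -addrA; apply: is_derive_line; exact: Cinfty_derivable.
have [d1 d2] := @is_derive_L2prod _ _ _ leb Omega mO (domain_finite oO bO) psi
  (fun t y => g (t *: e + x - y)) (fun t y => partial i g (t *: e + x - y))
  (-1) 1 C 0 Lpsi m1 (fun t _ => Lf t) (fun t y _ _ => df t y)
  (fun t y _ _ => gC _).
split; first by apply: (derivable1P _ _ _).2.
rewrite derive_line; apply: (etrans d2).
by rewrite /convolution; apply: eq_L2prod => y _; rewrite scale0r add0r.
Qed.

Lemma partial_conv (g : V -> R) i : test_function setT g ->
  partial i (convolution g) = convolution (partial i g).
Proof. by move=> tg; apply/funext => x; have [_] := is_derive_conv i x tg. Qed.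

Lemma conv_Cinfty (g : V -> R) : test_function setT g -> Cinfty (convolution g).
Proof.
move=> + k; elim: k g => [|k IHk] g tg.
  by split=> //; exact: conv_continuous.
split; first exact: conv_continuous.
move=> i; split=> [x|]; first by have [] := is_derive_conv i x tg.
by rewrite partial_conv//; apply: IHk; exact: test_function_partial.
Qed.

End Convolution.

(** * A radial mollifier whose variation in scale is a Laplacian *)

Section Kernel.
Context {R : realType} {n : nat}.
Notation V := 'rV[R]_n.
Implicit Types (s : R) (x y z : V) (f : V -> R).

Definition laplacian f : V -> R := fun x => \sum_i partial i (partial i f) x.

Lemma laplacian_reflect f x y : Cinfty f ->
  laplacian (fun z => f (x - z)) y = laplacian f (x - y).
Proof.
move=> Cf; apply: eq_bigr => i _.
have -> : partial i (fun z => f (x - z)) = fun z => (fun w => - partial i f w) (x - z).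
  by apply/funext => z; rewrite partial_reflect.
rewrite (@partial_reflect _ _ (fun w => - partial i f w)); last exact/CinftyN/Cinfty_partial.
by rewrite partialN ?opprK//; exact: Cinfty_partial.
Qed.

Lemma Cinfty_laplacian f : Cinfty f -> Cinfty (laplacian f).
Proof. by move=> Cf; apply: Cinfty_sum => i _; do 2 apply: Cinfty_partial. Qed.

Definition sqnorm z : R := \sum_i z ord0 i ^+ 2.

Lemma sqnorm_ge0 z : 0 <= sqnorm z.
Proof. by apply: sumr_ge0 => i _; rewrite sqr_ge0. Qed.

Lemma sqnormN z : sqnorm (- z) = sqnorm z.
Proof. by apply: eq_bigr => i _; rewrite mxE sqrrN. Qed.

Lemma Cinfty_sqnorm : Cinfty sqnorm.
Proof.
apply: Cinfty_sum => i _.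
by under eq_fun do rewrite expr2; apply: CinftyM; exact: Cinfty_coord.
Qed.

Lemma partial_sqnorm i z : partial i sqnorm z = 2 * z ord0 i.
Proof.
rewrite partial_sum; last first.
  by move=> j; under eq_fun do rewrite expr2; apply: CinftyM; exact: Cinfty_coord.
rewrite (bigD1 i)//= big1 ?addr0 => [|j ji];
  (under [X in partial i X]eq_fun do rewrite expr2);
  rewrite partialM; try exact: Cinfty_coord; rewrite partial_coord.
  by rewrite /cst/= eqxx mulr1 -mulr2n mulr_natl.
by rewrite /cst/= (negbTE ji) mulr0 addr0.
Qed.

(** 1 - |z|^2 / s^2 with the Euclidean norm, positive exactly on the ball of
radius s. The norm of row vectors is the maximum norm, whence the factor n + 1
in the criteria of positivity. *)
Definition profile s z : R := 1 - s^-1 ^+ 2 * sqnorm z.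

Lemma Cinfty_profile s : Cinfty (profile s).
Proof. by apply: CinftyB; [exact: Cinfty_cst|exact/CinftyZ/Cinfty_sqnorm]. Qed.

Lemma partial_profile s i z : partial i (profile s) z = - (s^-1 ^+ 2 * (2 * z ord0 i)).
Proof.
rewrite partialB; [|exact: Cinfty_cst|exact/CinftyZ/Cinfty_sqnorm].
by rewrite partial_cst partialZ ?partial_sqnorm ?sub0r//; exact: Cinfty_sqnorm.
Qed.

Lemma profile_le1 s z : profile s z <= 1.
Proof. by rewrite gerBl mulr_ge0 ?sqr_ge0 ?sqnorm_ge0. Qed.

Lemma profile_outside s z : 0 < s -> s <= `|z| -> profile s z <= 0.
Proof.
move=> s0 sz; rewrite subr_le0 exprVn -ler_pdivrMl ?invr_gt0 ?exprn_gt0//.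
rewrite invrK mulr1 leNgt; apply/negP => zs.
have : `|z| < s.
  apply: row_norm_lt => // i; rewrite -(@ltr_pXn2r _ 2)// ?nnegrE ?(ltW s0)//.
  rewrite real_normK ?num_real//; apply: le_lt_trans zs.
  by rewrite /sqnorm (bigD1 i)//= lerDl sumr_ge0// => j _; rewrite sqr_ge0.
by rewrite ltNge sz.
Qed.

Lemma profile_inside s z : 0 < s -> `|z| * n.+1%:R < s -> 0 < profile s z.
Proof.
move=> s0 zs; rewrite subr_gt0 exprVn -ltr_pdivlMl ?invr_gt0 ?exprn_gt0//.
rewrite invrK mulr1.
have z0 : 0 <= `|z| * n.+1%:R by rewrite mulr_ge0.
apply: (@le_lt_trans _ _ ((`|z| * n.+1%:R) ^+ 2)); last first.
  by rewrite ltr_pXn2r ?nnegrE ?(ltW s0).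
apply: (@le_trans _ _ (\sum_(i < n) `|z| ^+ 2)).
  apply: ler_sum => i _; rewrite -[leLHS]real_normK ?num_real//.
  by rewrite lerXn2r ?nnegrE//; exact: le_coord_norm.
rewrite sumr_const card_ord -[leLHS]mulr_natr exprMn ler_wpM2l ?sqr_ge0//.
by rewrite -natrX ler_nat (leq_trans (leqnSn _))// expnS expn1 leq_pmulr.
Qed.

(** The exponents are tuned so that d/ds (mollifier s) is exactly the Laplacian
of (potential s); the potential being nonnegative, averages of superharmonic
functions decrease with s. *)
Definition mollifier s z : R := s^-1 ^+ n * flat 2 (profile s z).

Definition potential s z : R := 2^-1 * s * s^-1 ^+ n * flat 0 (profile s z).

(** The common value of both sides of that identity. *)
Definition dmollifier s z : R :=
  - n%:R * s^-1 * s^-1 ^+ n * flat 2 (profile s z) +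
  s^-1 ^+ n * ((flat 4 (profile s z) - 2 * flat 3 (profile s z)) *
               (2 * s^-1 ^+ 3 * sqnorm z)).

Lemma Cinfty_mollifier s : Cinfty (mollifier s).
Proof. by apply: CinftyZ; apply: Cinfty_flat; exact: Cinfty_profile. Qed.

Lemma Cinfty_potential s : Cinfty (potential s).
Proof. by apply: CinftyZ; apply: Cinfty_flat; exact: Cinfty_profile. Qed.

Lemma mollifierN s z : mollifier s (- z) = mollifier s z.
Proof. by rewrite /mollifier /profile sqnormN. Qed.

Lemma mollifier_ge0 s z : 0 < s -> 0 <= mollifier s z.
Proof. by move=> s0; rewrite mulr_ge0 ?flat_ge0// exprn_ge0// invr_ge0 ltW. Qed.

Lemma potential_ge0 s z : 0 < s -> 0 <= potential s z.
Proof.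
move=> s0; rewrite mulr_ge0 ?flat_ge0// mulr_ge0//; last by rewrite exprn_ge0// invr_ge0 ltW.
by rewrite mulr_ge0 ?(ltW s0)// invr_ge0.
Qed.

Lemma mollifier_eq0 s z : 0 < s -> s <= `|z| -> mollifier s z = 0.
Proof. by move=> s0 sz; rewrite /mollifier flat_eq0 ?mulr0//; exact: profile_outside. Qed.

Lemma potential_eq0 s z : 0 < s -> s <= `|z| -> potential s z = 0.
Proof. by move=> s0 sz; rewrite /potential flat_eq0 ?mulr0//; exact: profile_outside. Qed.

Lemma dmollifier_eq0 s z : 0 < s -> s <= `|z| -> dmollifier s z = 0.
Proof.
move=> s0 sz; have p0 := profile_outside s0 sz.
by rewrite /dmollifier !(flat_eq0 _ p0) !mulr0 subrr mul0r mulr0 addr0.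
Qed.

Lemma mollifier_gt0 s z : 0 < s -> `|z| * n.+1%:R < s -> 0 < mollifier s z.
Proof.
move=> s0 zs; rewrite mulr_gt0 ?exprn_gt0 ?invr_gt0//.
by apply: flat_gt0; exact: profile_inside.
Qed.

Lemma potential_gt0 s z : 0 < s -> `|z| * n.+1%:R < s -> 0 < potential s z.
Proof.
move=> s0 zs; rewrite mulr_gt0//.
  by rewrite mulr_gt0 ?exprn_gt0 ?invr_gt0// mulr_gt0// invr_gt0.
by apply: flat_gt0; exact: profile_inside.
Qed.

Lemma laplacian_potential s z : 0 < s -> laplacian (potential s) z = dmollifier s z.
Proof.
move=> s0; have Cp := Cinfty_profile s.
have Cx i : Cinfty (fun y : V => y ord0 i) := Cinfty_coord i.
have p1 i : partial i (potential s) =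
    fun y => (- s^-1 * s^-1 ^+ n) * (flat 2 (profile s y) * y ord0 i).
  apply/funext => y; rewrite partialZ; last exact: Cinfty_flat.
  rewrite partial_flat// partial_profile mul0r subr0.
  by field; rewrite gt_eqF.
have p2 i : partial i (partial i (potential s)) z =
    (- s^-1 * s^-1 ^+ n) * flat 2 (profile s z) +
    2 * s^-1 ^+ 3 * s^-1 ^+ n * (flat 4 (profile s z) - 2 * flat 3 (profile s z)) * z ord0 i ^+ 2.
  rewrite p1 partialZ; last by apply: CinftyM => //; exact: Cinfty_flat.
  rewrite partialM//; last exact: Cinfty_flat.
  rewrite partial_flat// partial_profile partial_coord /cst/= eqxx mulr1.
  by field; rewrite gt_eqF.
rewrite /laplacian (eq_bigr _ (fun i _ => p2 i)) big_split/=.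
have E B : \sum_(i < n) B * z ord0 i ^+ 2 = B * sqnorm z by rewrite /sqnorm mulr_sumr.
rewrite E.
rewrite sumr_const card_ord -[X in X + _]mulr_natl /dmollifier.
by ring.
Qed.

Lemma is_derive_mollifier s z : 0 < s ->
  is_derive s 1 (fun t => mollifier t z) (dmollifier s z).
Proof.
move=> s0; have sn0 : s != 0 by rewrite gt_eqF.
have dp : is_derive s 1 (fun t => profile t z) (2 * s^-1 ^+ 3 * sqnorm z).
  have d2 := is_derive_expV 2 sn0.
  rewrite /profile; apply: is_derive_eq.
  by rewrite scaler0 /GRing.scale/=; ring.
have df := @is_derive_comp R _ (flat 2) (fun t => profile t z) s 1 _ _
  (is_derive_flat 2 (profile s z)) dp.
have dn := is_derive_expV n sn0.
rewrite /mollifier; apply: is_derive_eq.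
transitivity (s^-1 ^+ n * ((flat 4 (profile s z) - 2 * flat 3 (profile s z)) *
  (2 * s^-1 ^+ 3 * sqnorm z)) + flat 2 (profile s z) * (- n%:R * s^-1 ^+ n.+1)).
  by [].
by rewrite /dmollifier (exprS s^-1 n); ring.
Qed.

(** A bound uniform in s away from 0, for differentiation under the integral. *)
Lemma dmollifier_bound (s1 S : R) : 0 < s1 -> exists C, forall s z,
  s1 < s -> sqnorm z <= S -> `|dmollifier s z| <= C.
Proof.
move=> s10; pose q := s1^-1.
have [c c0 flat_ub] : exists2 c : nat -> R, forall m, 0 <= c m &
    forall m s z, flat m (profile s z) <= c m.
  exists (fun m => m.+2`!%:R) => // m s z.
  have [p0|p0] := ltP 0 (profile s z); last by rewrite flat_eq0.
  rewrite (le_trans (flat_le _ _))// -[leRHS]mulr1 ler_wpM2l//.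
  by rewrite exprn_ile1 ?profile_le1// ltW.
exists (n%:R * q * q ^+ n * c 2%N + q ^+ n * ((c 4%N + 2 * c 3%N) * (2 * q ^+ 3 * S))).
move=> s z ss zS.
have s0 : 0 < s := lt_trans s10 ss.
have sq : s^-1 <= q by rewrite lef_pV2 ?posrE// ltW.
have sV0 : 0 <= s^-1 by rewrite invr_ge0 ltW.
have q0 : 0 <= q by rewrite invr_ge0 ltW.
have sqk k : s^-1 ^+ k <= q ^+ k by rewrite lerXn2r ?nnegrE.
have sk0 k : 0 <= s^-1 ^+ k by rewrite exprn_ge0.
have z0 := sqnorm_ge0 z.
rewrite /dmollifier.
set P := flat 4 _ - 2 * flat 3 _; set A := 2 * s^-1 ^+ 3 * sqnorm z.
have PF : `|P| <= c 4%N + 2 * c 3%N.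
  rewrite (le_trans (ler_normB _ _))// lerD//; first by rewrite ger0_norm ?flat_ge0.
  by rewrite ger0_norm ?mulr_ge0 ?flat_ge0// ler_wpM2l.
have A0 : 0 <= A by rewrite !mulr_ge0.
have AB : A <= 2 * q ^+ 3 * S by apply: ler_pM => //; [rewrite mulr_ge0|rewrite ler_wpM2l].
rewrite (le_trans (ler_normD _ _))// lerD//.
  rewrite !mulNr normrN ger0_norm; last by rewrite !mulr_ge0 ?flat_ge0.
  apply: ler_pM; rewrite ?mulr_ge0 ?flat_ge0//.
  by apply: ler_pM; rewrite ?mulr_ge0// ler_wpM2l.
rewrite normrM (ger0_norm (sk0 n)) normrM (ger0_norm A0).
by apply: ler_pM; rewrite ?mulr_ge0//; apply: ler_pM.
Qed.

Lemma kernel_test_reflect (U : set V) (k : V -> R) s x : Cinfty k -> 0 < s ->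
  (forall z, s <= `|z| -> k z = 0) ->
  (forall y, `|x - y| <= s -> U y) -> test_function U (fun y => k (x - y)).
Proof.
move=> Ck s0 k0 sU.
apply: (@test_functionI _ _ U (closed_box (x - const_mx s) (x + const_mx s))).
- exact: Cinfty_reflect.
- exact: closed_box_compact.
- by rewrite closed_box_norm ?(ltW s0)// => y /= xy; exact: sU.
- move=> y; rewrite closed_box_norm ?(ltW s0)//= => /negP; rewrite -ltNge => sy.
  by rewrite k0// ltW.
Qed.

Lemma potential_test_reflect (U : set V) s x : 0 < s ->
  (forall y, `|x - y| <= s -> U y) -> test_function U (fun y => potential s (x - y)).
Proof.
move=> s0; apply: (kernel_test_reflect (Cinfty_potential s) s0) => z.
exact: potential_eq0.
Qed.

Lemma mollifier_test s : 0 < s -> test_function setT (mollifier s).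
Proof.
move=> s0; have := @kernel_test_reflect setT _ s 0 (Cinfty_mollifier s) s0
  (fun z => mollifier_eq0 s0) (fun _ _ => I).
by under eq_fun do rewrite sub0r mollifierN.
Qed.

End Kernel.

(** * Translation invariance of the Lebesgue measure *)

Section Translation.
Context {R : realType} {n : nat}.
Notation V := 'rV[R]_n.
Notation leb := (@lebesgue R n).
Implicit Types (c : V).

Definition translate c : V -> V := fun x => x + c.

Lemma measurable_translate c : measurable_fun setT (translate c).
Proof.
apply: measurable_fun_row => i.
rewrite (_ : _ \o _ = fun x : V => x ord0 i + c ord0 i); last first.
  by apply/funext => x; rewrite /= /row_coord mxE.
apply: measurable_funD; first exact: measurable_row_coord.
exact: measurable_cst.
Qed.

Lemma lebesgue_box_length (a b : V) :
  leb (box a b) = (\prod_(i < n) lebesgue_measure `]a ord0 i, b ord0 i[%classic)%E.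
Proof.
rewrite -(@lebesgue_box R n (fun i => `]a ord0 i, b ord0 i[%classic)).
  by congr (leb _); apply/seteqP; split => x /= h i; have := h i; rewrite in_itv.
by move=> i; exact: measurable_itv.
Qed.

(** Two measures that agree on boxes and are finite on an exhausting sequence of
boxes coincide. *)
Lemma lebesgue_translate c A : measurable A -> leb (translate c @^-1` A) = leb A.
Proof.
move=> mA; symmetry.
pose phi_mixin := isMeasurableFun.Build _ _ _ _ _ (measurable_translate c).
pose phi : {mfun V >-> V} := HB.pack (translate c) phi_mixin.
pose g (k : nat) : set V := box (0 - const_mx k%:R) (0 + const_mx k%:R).
apply: (@measure_unique _ R _ boxes g measurable_boxes _ _ _ leb (pushforward leb phi)) => //.
- move=> _ _ [a1 [b1 ->]] [a2 [b2 ->]].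
  by rewrite box_setI; do 2 eexists.
- by move=> k; do 2 eexists.
- apply/seteqP; split => // x _.
  exists (Num.truncn `|x|).+1 => // i; rewrite !mxE sub0r add0r -ltr_norml.
  by rewrite (le_lt_trans (le_coord_norm x i))// truncnS_gt.
- move=> _ [a [b ->]].
  transitivity (leb (box (a - c) (b - c))).
    apply: (etrans (lebesgue_box_length a b)).
    apply: (etrans _ (esym (lebesgue_box_length (a - c) (b - c)))).
    apply: eq_bigr => i _.
    rewrite !lebesgue_measure_itv/= !mxE !lte_fin ltrD2r.
    by case: ifPn => // _; rewrite -!EFinB opprB addrA subrK.
  rewrite /pushforward; congr (leb _).
  apply/seteqP; split => x /= h i; have := h i; rewrite !mxE.
    by rewrite ltrBlDr ltrBrDr.
  by rewrite ltrBlDr ltrBrDr.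
- move=> k; apply: le_lt_trans (lebesgue_closed_box_lty (0 - const_mx k%:R) (0 + const_mx k%:R)).
  apply: le_measure; rewrite ?inE; last exact: box_closed_box.
    exact: box_measurable.
  exact: closed_box_measurable.
Qed.

Lemma integral_translate c (f : V -> \bar R) : measurable_fun setT f ->
  (forall x, 0 <= f x)%E ->
  (\int[leb]_x f (x + c)%R = \int[leb]_x f x)%E.
Proof.
move=> mf f0.
have H := @ge0_integral_pushforward _ _ V V R (translate c) (measurable_translate c)
  leb setT f measurableT mf (fun y _ => f0 y).
rewrite preimage_setT in H; rewrite -[LHS]H.
apply: eq_measure_integral => [|mt A mA _]; first exact: measurable_translate.
exact: (lebesgue_translate c mA).
Qed.

End Translation.

Section PositiveIntegral.
Context {R : realType} {n : nat}.
Notation V := 'rV[R]_n.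
Notation leb := (@lebesgue R n).

Lemma lebesgue_ball_gt0 (x : V) (r : R) : 0 < r -> (0 < leb (ball x r))%E.
Proof.
move=> r0; rewrite ball_box//; rewrite [ltRHS]lebesgue_box_length.
elim/big_ind : _ => [|u v u0 v0|i _]; first exact: lte01.
  exact: mule_gt0.
have xr : x ord0 i - r < x ord0 i + r.
  by rewrite ltrD2l (lt_trans _ r0)// oppr_lt0.
by rewrite lebesgue_measure_itv/= !mxE lte_fin xr -EFinB lte_fin subr_gt0.
Qed.

Lemma integral_gt0 (D : set V) (h : V -> R) (x : V) (r c : R) : measurable D ->
  leb.-integrable D (EFin \o h) -> (forall y, D y -> 0 <= h y) ->
  0 < r -> ball x r `<=` D -> 0 < c -> (forall y, ball x r y -> c <= h y) ->
  0 < \int[leb]_(y in D) h y.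
Proof.
move=> mD ih h0 r0 xD c0 ch; have mB : measurable (ball x r).
  by rewrite ball_box//; exact: box_measurable.
have [mh _] := integrableP _ _ _ ih.
have ihB : leb.-integrable (ball x r) (EFin \o h) by exact: integrableS ih.
rewrite /Rintegral fine_gt0//; apply/andP; split; last first.
  have := integrable_fin_num mD ih; rewrite fin_numElt => /andP[_].
  by [].
apply: (@lt_le_trans _ _ (\int[leb]_(y in ball x r) (h y)%:E)%E); last first.
  exact: ge0_subset_integral.
apply: (@lt_le_trans _ _ (\int[leb]_(y in ball x r) c%:E)%E).
  by rewrite integral_cst// mule_gt0// lebesgue_ball_gt0.
apply: ge0_le_integral => //.
- by move=> y _; rewrite lee_fin ltW.
- by case/integrableP: ihB.
Qed.

End PositiveIntegral.

(** * Averages of weakly superharmonic functions *)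

Section MollifierMass.
Context {R : realType} {n : nat}.
Notation V := 'rV[R]_n.
Notation leb := (@lebesgue R n).

Definition mass (s : R) : R := \int[leb]_x mollifier s x.

Lemma continuous_mollifier_shift s (y : V) : continuous (fun x : V => mollifier s (x - y)).
Proof.
move=> x; apply: (@continuous_comp _ _ _ (fun z : V => z - y) (mollifier s)).
  by apply: (@cvgB _ V _ (nbhs x) _ id (fun=> y)); [exact: cvg_id|exact: cvg_cst].
exact: (Cinfty_continuous (Cinfty_mollifier s)).
Qed.

Lemma mollifier_shift_far s (y x : V) : 0 < s -> `|y| + s < `|x| ->
  mollifier s (x - y) = 0.
Proof.
move=> s0 yx; apply: mollifier_eq0 => //.
rewrite -(lerD2l `|y|); apply: (le_trans (ltW yx)).
by rewrite -[X in `|X| <= _](subrK y) addrC ler_normD.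
Qed.

Lemma mollifier_shift_integrable s (y : V) : 0 < s ->
  leb.-integrable setT (EFin \o (fun x => mollifier s (x - y))).
Proof.
move=> s0; apply: (@continuous_compact_support_integrable _ _ _ (`|y| + s)).
- by rewrite addr_ge0 ?(ltW s0).
- exact: continuous_mollifier_shift.
- by move=> x; exact: mollifier_shift_far.
Qed.

Lemma mass_translate s (y : V) : 0 < s -> \int[leb]_x mollifier s (x - y) = mass s.
Proof.
move=> s0; rewrite /mass /Rintegral; congr fine.
apply: (@integral_translate _ _ (- y) (fun x => (mollifier s x)%:E)).
  apply/measurable_EFinP; apply: continuous_measurable_row => //.
  exact: (Cinfty_continuous (Cinfty_mollifier s)).
by move=> x; rewrite lee_fin mollifier_ge0.
Qed.

End MollifierMass.

Section Superharmonic.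
Context {R : realType} {n : nat}.
Notation V := 'rV[R]_n.
Notation leb := (@lebesgue R n).
Variable Omega : set V.
Hypotheses (oO : open Omega) (bO : bounded_set Omega).
Variables psi f : V -> R.
Hypotheses (Lpsi : L2 leb Omega psi) (Lf : L2 leb Omega f).
Hypothesis psi_eq : forall z, test_function Omega z ->
  L2prod leb Omega psi (laplacian z) = - L2prod leb Omega f z.

Local Notation ip := (L2prod leb Omega).
Let mO : measurable Omega := domain_measurable oO.

Definition average (s : R) : V -> R := convolution Omega psi (mollifier s).

(** Differentiation under the integral brings the derivative of the mollifier,
which is the Laplacian of the potential centred at x; the latter is a test
function, so the weak equation turns the integral against psi into one
against f. *)
Lemma is_derive_average s x : 0 < s -> (forall y, `|x - y| <= s -> Omega y) ->
  is_derive s 1 (fun t => average t x) (- ip f (fun y => potential s (x - y))).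
Proof.
move=> s0 sO.
have [S S0 SP] := continuous_domain_bounded bO
  (Cinfty_continuous (Cinfty_reflect x Cinfty_sqnorm)).
have [C CP] := @dmollifier_bound R n (s / 2) S (divr_gt0 s0 (ltr0Sn _ 1)).
have sI : s / 2 < s < s + 1 by rewrite ltrDl ltr01 andbT ltr_pdivrMr// ltr_pMr// ltr1n.
have := @is_derive_L2prod _ _ _ leb Omega mO (domain_finite oO bO) psi
  (fun t y => mollifier t (x - y)) (fun t y => dmollifier t (x - y))
  (s / 2) (s + 1) C s Lpsi sI.
have -> : ip psi (fun y => dmollifier s (x - y)) = - ip f (fun y => potential s (x - y)).
  rewrite -psi_eq; last exact: potential_test_reflect.
  apply: eq_L2prod => y _; congr (_ * _).
  by rewrite laplacian_reflect ?laplacian_potential//; exact: Cinfty_potential.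
apply.
- by move=> t _; apply: (reflect_L2 oO bO); exact: Cinfty_mollifier.
- move=> t y /andP[st _] _; apply: is_derive_mollifier.
  by apply: lt_trans st; rewrite divr_gt0.
- move=> t y /andP[st _] Oy; apply: CP => //.
  by rewrite (le_trans (ler_norm _))// SP.
Qed.

Lemma average_MVT s1 s2 x : 0 < s1 -> s1 < s2 -> (forall y, `|x - y| <= s2 -> Omega y) ->
  exists2 s, s1 < s < s2 & average s2 x - average s1 x =
    - ip f (fun y => potential s (x - y)) * (s2 - s1).
Proof.
move=> s10 s12 sO.
have dA s : 0 < s <= s2 ->
    is_derive s 1 (fun t => average t x) (- ip f (fun y => potential s (x - y))).
  move=> /andP[s0 ss2]; apply: is_derive_average => // y xy; apply: sO.
  exact: le_trans ss2.
have [c c12 E] : exists2 c, c \in `]s1, s2[%R & average s2 x - average s1 x =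
    - ip f (fun y => potential c (x - y)) * (s2 - s1).
  apply: (@MVT R (fun t => average t x) (fun t => - ip f (fun y => potential t (x - y))) s1 s2 s12).
    move=> s; rewrite in_itv/= => /andP[s1s ss2]; apply: dA.
    by rewrite (lt_trans s10 s1s) ltW.
  apply: derivable_within_continuous => s; rewrite in_itv/= => /andP[s1s ss2].
  by have [] := dA s; rewrite ?ss2 ?(lt_le_trans s10 s1s).
by exists c => //; move: c12; rewrite in_itv.
Qed.

(** The mean value property of harmonic functions. *)
Lemma average_const s1 s2 x : 0 < s1 -> s1 <= s2 ->
  (forall y, `|x - y| <= s2 -> Omega y /\ f y = 0) ->
  average s2 x = average s1 x.
Proof.
move=> s10; rewrite le_eqVlt => /predU1P[->//|s12] sO.
have [s /andP[s1s ss2] E] := average_MVT s10 s12 (fun y h => (sO y h).1).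
apply/eqP; rewrite -subr_eq0 E.
rewrite (_ : ip f _ = ip (fun=> 0) (fun=> 0)); last first.
  apply: eq_L2prod => y _; have [xy|xy] := leP `|x - y| s2.
    by rewrite (sO y xy).2 !mul0r.
  rewrite potential_eq0 ?mulr0 ?(lt_trans s10 s1s)//.
  by rewrite ltW// (lt_trans ss2).
by rewrite (_ : ip _ _ = 0) ?oppr0 ?mul0r// /L2prod /Rintegral; under eq_integral do rewrite mulr0; rewrite integral0.
Qed.

Hypothesis f_ge0 : forall x, Omega x -> 0 <= f x.

(** The mean value inequality of superharmonic functions. *)
Lemma average_nonincreasing s1 s2 x : 0 < s1 -> s1 <= s2 ->
  (forall y, `|x - y| <= s2 -> Omega y) ->
  average s2 x <= average s1 x.
Proof.
move=> s10; rewrite le_eqVlt => /predU1P[->//|s12] sO.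
have [s /andP[s1s ss2] E] := average_MVT s10 s12 sO.
rewrite -subr_le0 E mulNr oppr_le0 mulr_ge0 ?subr_ge0 ?(ltW s12)//.
apply: L2prod_ge0 => y Oy; [exact: f_ge0|apply: potential_ge0].
exact: lt_trans s1s.
Qed.

Hypothesis psi_ge0 : forall x, Omega x -> 0 <= psi x.

Lemma average_ge0 s x : 0 < s -> 0 <= average s x.
Proof.
by move=> s0; apply: L2prod_ge0 => y Oy; [exact: psi_ge0|exact: mollifier_ge0].
Qed.

(** The mollifier is bounded below by a positive constant on the inner ball of
radius r, so it dominates |g|; as psi is nonnegative, the integral of psi g is
squeezed between two multiples of a vanishing average. *)
Lemma average_eq0_orthogonal s r x x' (g : V -> R) : 0 < s -> 0 <= r ->
  average s x = 0 -> continuous g ->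
  (forall y, `|x' - y| <= r -> `|x - y| * n.+1%:R < s) ->
  (forall y, r < `|x' - y| -> g y = 0) ->
  ip psi g = 0.
Proof.
move=> s0 r0 A0 cg rs g0.
pose K : set V := closed_box (x' - const_mx r) (x' + const_mx r).
have KE : K = [set y | `|x' - y| <= r] by exact: closed_box_norm.
have cK : compact K by exact: closed_box_compact.
have Cm : Cinfty (fun y => mollifier s (x - y)) by exact/Cinfty_reflect/Cinfty_mollifier.
have [c c0 cP] := compact_continuous_min cK (Cinfty_continuous Cm)
  (fun y Ky => mollifier_gt0 s0 (rs y (eq_rect _ (fun A : set V => A y) Ky _ KE))).
have [M M0 MP] := compact_continuous_bounded cK cg.
have Lg := continuous_L2domain oO bO cg.
have Lm : L2 leb Omega (fun y => mollifier s (x - y)) by exact: (Cinfty_L2 oO bO).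
have dom y : `|g y| <= M / c * mollifier s (x - y).
  have m0 := mollifier_ge0 (x - y) s0.
  have [Ky|nKy] := pselect (K y).
    rewrite (le_trans (MP y Ky))// mulrAC ler_pdivlMr// ler_wpM2l ?(ltW M0)//.
    exact: cP.
  rewrite g0; first by rewrite normr0 mulr_ge0// divr_ge0 ?(ltW M0) ?(ltW c0).
  by move: nKy; rewrite KE /= => /negP; rewrite -ltNge.
have ub (h : V -> R) : L2 leb Omega h ->
    (forall y, h y <= M / c * mollifier s (x - y)) -> ip psi h <= 0.
  move=> Lh hP; rewrite -subr_ge0 sub0r.
  have -> : - ip psi h = M / c * average s x - ip psi h by rewrite A0 mulr0 sub0r.
  rewrite /average /convolution -L2prodZr// -L2prodBr//; last exact: L2Z.
  by apply: L2prod_ge0 => y Oy; [exact: psi_ge0|rewrite subr_ge0].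
apply/eqP; rewrite eq_le; apply/andP; split.
  by apply: ub => // y; exact: le_trans (ler_norm _) (dom y).
rewrite -oppr_le0 -(L2prodNr mO Lpsi Lg); apply: ub; first exact: L2N.
by move=> y; rewrite (le_trans _ (dom y))// -normrN ler_norm.
Qed.

Lemma average_eq0_near s e z z' : 0 < s -> 0 < e -> average s z = 0 ->
  `|z - z'| < e -> e * (2 * n.+2%:R) <= s -> average e z' = 0.
Proof.
move=> s0 e0 A0 zz' es.
apply: (@average_eq0_orthogonal s e z z') => //; first exact: ltW.
- exact/Cinfty_continuous/Cinfty_reflect/Cinfty_mollifier.
- move=> y z'y; apply: lt_le_trans es.
  have zy : `|z - y| < 2 * e.
    rewrite -(subrK z' z) -addrA (le_lt_trans (ler_normD _ _))//.
    by rewrite mulr_natl mulr2n ltr_leD.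
  rewrite [ltRHS]mulrA [e * 2]mulrC ltr_pM// ltr_nat//.
- by move=> y ey; rewrite mollifier_eq0// ltW.
Qed.

(** Strong maximum principle. Let Z be the set of points of Omega at which some
average vanishes. By average_eq0_near it is open, and monotonicity in the scale
lets a vanishing average at a point close to z be enlarged to a ball of fixed
size, so Z is also closed in Omega. If Z were not empty it would contain z0, and
psi would be orthogonal to the Laplacian of a potential centred there, that is
f would be orthogonal to a positive function near z0. *)
Theorem average_gt0 (z0 : V) : connected Omega -> Omega z0 -> continuous f -> 0 < f z0 ->
  forall s x, 0 < s -> Omega x -> 0 < average s x.
Proof.
move=> cO Oz0 cf fz0 s x s0 Ox.
have n2 : 0 < 2 * n.+2%:R :> R by rewrite mulr_gt0.
have n21 : 1 <= 2 * n.+2%:R :> R by rewrite -natrM ler1n.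
rewrite lt0r average_ge0// andbT; apply/eqP => Asx.
pose Z : set V := [set z | Omega z /\ exists2 s, 0 < s & average s z = 0].
have oZ : open Z.
  rewrite openE => z [Oz [t t0 At]]; apply/nbhs_ballP.
  have [r r0 rO] := open_contains_ball oO Oz.
  have e0 : 0 < t / (2 * n.+2%:R) by rewrite divr_gt0.
  exists (Num.min r (t / (2 * n.+2%:R))); first by rewrite /= lt_min r0.
  move=> z'; rewrite -ball_normE/= lt_min => /andP[zr zt]; split.
    by apply: rO; rewrite -ball_normE.
  exists (t / (2 * n.+2%:R)); first exact: e0.
  by apply: (average_eq0_near t0 e0 At zt); rewrite divfK// gt_eqF.
have ZE : Z = Omega.
  apply: cO; first by exists x; split; [exact: Ox|exists s].
    exists Z; first exact: oZ.
    by apply/seteqP; split => z; [move=> Zz; split; [case: Zz|exact: Zz]|case].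
  exists (closure Z); first exact: closed_closure.
  apply/seteqP; split => z.
    by move=> Zz; split; [case: Zz|exact: subset_closure].
  move=> [Oz cz]; split; first exact: Oz.
  have [d d0 dO] := open_contains_ball oO Oz.
  pose e := d / 2 / (2 * n.+2%:R).
  have e0 : 0 < e by rewrite !divr_gt0.
  have [z' [[Oz' [t t0 At]]]] := cz _ (nbhsx_ballx z e e0).
  rewrite -ball_normE/= => zz'.
  pose t' := Num.min (t / (2 * n.+2%:R)) (d / 2).
  have t'0 : 0 < t' by rewrite lt_min !divr_gt0.
  have At' : average t' z' = 0.
    apply: (average_eq0_near t0 t'0 At); first by rewrite subrr normr0.
    by rewrite -ler_pdivlMr// ge_min lexx.
  have ed : e <= d / 2 by rewrite ler_pdivrMr// ler_peMr// divr_ge0// ltW.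
  have AS : average (d / 2) z' = 0.
    apply/eqP; rewrite eq_le average_ge0 ?divr_gt0// andbT -At'.
    apply: average_nonincreasing; [exact: t'0|by rewrite ge_min lexx orbT|].
    move=> y z'y; apply: dO; rewrite -ball_normE/=.
    rewrite -(subrK z' z) -addrA (le_lt_trans (ler_normD _ _))// (splitr d).
    by rewrite ltr_leD// (lt_le_trans zz').
  exists e; first exact: e0.
  apply: (average_eq0_near _ e0 AS); first by rewrite divr_gt0.
    by rewrite distrC.
  by rewrite /e divfK// gt_eqF.
have : Z z0 by rewrite ZE.
move=> [_ [t t0 At]].
have [d d0 dO] := open_contains_ball oO Oz0.
have [r r0 rf] : exists2 r : R, 0 < r & ball z0 r `<=` [set y | f z0 / 2 < f y].
  apply/nbhs_ballP; have /cvgrPdist_lt /(_ (f z0 / 2)) := cf z0.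
  rewrite divr_gt0// => /(_ isT); apply: filterS => y /=.
  move=> /(le_lt_trans (ler_norm _)); rewrite ltrBlDl -ltrBlDr.
  by rewrite {1}(splitr (f z0)) addrK.
pose e := Num.min (t / (2 * n.+2%:R)) (d / 2).
have e0 : 0 < e by rewrite lt_min !divr_gt0.
have eO y : `|z0 - y| <= e -> Omega y.
  move=> ye; apply: dO; rewrite -ball_normE/= (le_lt_trans ye)// gt_min.
  by apply/orP; right; rewrite ltr_pdivrMr// ltr_pMr// ltr1n.
have tp := potential_test_reflect e0 eO.
have Cp : Cinfty (fun y => potential e (z0 - y)) by case: tp.
have : ip f (fun y => potential e (z0 - y)) = 0.
  apply/eqP; rewrite -oppr_eq0 -psi_eq//; apply/eqP.
  apply: (@average_eq0_orthogonal t e z0 z0 _ t0 (ltW e0) At).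
  - exact/Cinfty_continuous/Cinfty_laplacian.
  - move=> y ye; apply: (@le_lt_trans _ _ (e * n.+1%:R)); first by rewrite ler_wpM2r.
    have : e <= t / (2 * n.+2%:R) by rewrite ge_min lexx.
    rewrite ler_pdivlMr//; apply: lt_le_trans.
    by rewrite ltr_pM2l// -natrM ltr_nat mul2n -addnn ltn_addr.
  - move=> y ey; rewrite laplacian_reflect; last exact: Cinfty_potential.
    by rewrite laplacian_potential// dmollifier_eq0// ltW.
apply/eqP; rewrite gt_eqF//.
pose r' := Num.min r (e / n.+2%:R).
have r'0 : 0 < r' by rewrite lt_min r0 divr_gt0.
have r'e : r' < e.
  by rewrite /r' gt_min; apply/orP; right; rewrite ltr_pdivrMr// ltr_pMr// ltr1n.
pose K : set V := closed_box (z0 - const_mx r') (z0 + const_mx r').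
have KE : K = [set y | `|z0 - y| <= r'] by apply: closed_box_norm; exact: ltW.
have pK y : K y -> 0 < potential e (z0 - y).
  rewrite KE /= => yr; apply: potential_gt0 => //.
  have re : r' <= e / n.+2%:R by rewrite ge_min lexx orbT.
  apply: (@le_lt_trans _ _ (r' * n.+1%:R)); first by rewrite ler_wpM2r.
  move: re; rewrite ler_pdivlMr//; apply: lt_le_trans.
  by rewrite ltr_pM2l// ltr_nat.
have cK : compact K by exact: closed_box_compact.
have [c c0 cP] := compact_continuous_min cK (Cinfty_continuous Cp) pK.
apply: (@integral_gt0 R n Omega (fun y => f y * potential e (z0 - y)) z0 r'
  (f z0 / 2 * c) mO _ _ r'0).
- by apply: L2_mul_integrable => //; exact: (Cinfty_L2 oO bO).
- by move=> y Oy; rewrite mulr_ge0 ?f_ge0// potential_ge0.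
- by move=> y; rewrite -ball_normE/= => yr; apply: eO; rewrite ltW// (lt_trans yr).
- by rewrite mulr_gt0// divr_gt0.
- move=> y; rewrite -ball_normE/= => yr; apply: ler_pM.
  + by rewrite divr_ge0// ltW.
  + exact: ltW.
  + by apply/ltW/rf; rewrite -ball_normE/= (lt_le_trans yr)// /r' ge_min lexx.
  + by apply: cP; rewrite KE /= ltW.
Qed.

End Superharmonic.

(** * Averages recover harmonic functions *)

Section ConvolutionAdjoint.
Context {R : realType} {n : nat}.
Notation V := 'rV[R]_n.
Notation leb := (@lebesgue R n).
Variable Omega : set V.
Hypotheses (oO : open Omega) (bO : bounded_set Omega).
Variables psi z m : V -> R.
Hypotheses (Lpsi : L2 leb Omega psi) (Lz : L2 leb Omega z).
Hypothesis tm : test_function setT m.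
Hypothesis mN : forall x, m (- x) = m x.

Let mO : measurable Omega := domain_measurable oO.

Let F (p : (V * V)%type) : R := (z \_ Omega) p.1 * (psi \_ Omega) p.2 * m (p.1 - p.2).

Let measurable_F : measurable_fun [set: (V * V)%type] F.
Proof.
apply: measurable_funM.
  apply: measurable_funM.
    apply: (measurableT_comp (f := z \_ Omega)); last exact: measurable_fst.
    by apply/(measurable_restrictT _ mO); exact: L2_measurable Lz.
  apply: (measurableT_comp (f := psi \_ Omega)); last exact: measurable_snd.
  by apply/(measurable_restrictT _ mO); exact: L2_measurable Lpsi.
apply: (measurableT_comp (f := m)).
  by apply: continuous_measurable_row => //; apply: Cinfty_continuous; case: tm.
apply: measurable_fun_row => i.
rewrite (_ : _ \o _ = fun p : (V * V)%type => p.1 ord0 i - p.2 ord0 i); last first.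
  by apply/funext => p; rewrite /= /row_coord !mxE.
apply: measurable_funB.
  by apply: (measurableT_comp (f := row_coord i)); [exact: measurable_row_coord|exact: measurable_fst].
by apply: (measurableT_comp (f := row_coord i)); [exact: measurable_row_coord|exact: measurable_snd].
Qed.

Let abs_restrict_integral (g : V -> R) : L2 leb Omega g ->
  leb.-integrable setT (fun x => `|(g \_ Omega) x|%:E).
Proof.
move=> Lg; have := integrable_abse ((integrable_mkcond _ mO).1 (L2_integrable oO bO Lg)).
apply: eq_integrable => // x _ /=.
by rewrite !patchE; case: ifPn => //=.
Qed.

Let integrable_F : (leb \x leb)%E.-integrable [set: (V * V)%type] (EFin \o F).
Proof.
have [C C0 mC] := test_function_bounded tm.
have iz := abs_restrict_integral Lz; have ip := abs_restrict_integral Lpsi.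
have mz := measurable_int _ iz; have mp := measurable_int _ ip.
apply/(integrable12ltyP leb leb); first exact/measurable_EFinP.
pose P : \bar R := (\int[leb]_y `|(psi \_ Omega) y|%:E)%E.
have P0 : (0 <= P)%E by apply: integral_ge0 => y _; rewrite lee_fin.
have Poo : (P < +oo)%E.
  have [_ H] := integrableP _ _ _ ip; apply: le_lt_trans H; rewrite le_eqVlt.
  by apply/orP; left; apply/eqP; apply: eq_integral => y _ /=; rewrite normr_id.
have [r PE] : exists r, P = r%:E by move: P0 Poo; case: (P) => // r; exists r.
apply: (@le_lt_trans _ _ (\int[leb]_x ((C * r)%:E * `|(z \_ Omega) x|%:E))%E).
  apply: ge0_le_integral => //.
  - by move=> x _; exact: integral_ge0.
  - apply: (@measurable_fun_fubini_tonelli_F _ _ _ _ _ leb (fun p => `|(EFin \o F) p|%E)) => //.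
    by apply: measurableT_comp => //; exact/measurable_EFinP.
  - exact: measurable_funeM.
  - move=> x _.
    apply: (@le_trans _ _ (\int[leb]_y ((C * `|(z \_ Omega) x|)%:E * `|(psi \_ Omega) y|%:E))%E).
      apply: ge0_le_integral => //.
      + apply: measurableT_comp => //; apply/measurable_EFinP.
        apply: (measurableT_comp (f := F)); [exact: measurable_F|exact: measurable_pair1].
      + exact: measurable_funeM.
      + move=> y _ /=; rewrite -EFinM lee_fin !normrM mulrC mulrA ler_wpM2r//.
        by rewrite ler_wpM2r.
    rewrite ge0_integralZl//; last by rewrite lee_fin mulr_ge0// ltW.
    by rewrite -/P PE -!EFinM lee_fin mulrAC.
have r0 : 0 <= r by rewrite -lee_fin -PE.
rewrite ge0_integralZl//; last by rewrite lee_fin mulr_ge0// ltW.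
apply: lte_mul_pinfty => //; first by rewrite lee_fin mulr_ge0// ltW.
have [_ H] := integrableP _ _ _ iz; apply: le_lt_trans H; rewrite le_eqVlt.
by apply/orP; left; apply/eqP; apply: eq_integral => y _ /=; rewrite normr_id.
Qed.

Let slice (g : V -> R) x : L2 leb Omega g ->
  (\int[leb]_y ((g \_ Omega) y * m (x - y))%:E = (convolution Omega g m x)%:E)%E.
Proof.
move=> Lg; rewrite /convolution /L2prod /Rintegral fineK; last first.
  apply: integrable_fin_num => //; apply: L2_mul_integrable => //.
  by apply: (reflect_L2 oO bO); case: tm.
rewrite [RHS]integral_mkcond; apply: eq_integral => y _.
by rewrite !patchE; case: ifPn => //; rewrite mul0r.
Qed.

Let pairing (g h : V -> R) :
  (\int[leb]_x ((g \_ Omega) x * h x)%:E = \int[leb]_(x in Omega) (g x * h x)%:E)%E.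
Proof.
rewrite [RHS]integral_mkcond; apply: eq_integral => y _.
by rewrite !patchE; case: ifPn => //; rewrite mul0r.
Qed.

(** Fubini, the kernel being symmetric. *)
Lemma conv_self_adjoint : L2prod leb Omega (convolution Omega psi m) z =
  L2prod leb Omega psi (convolution Omega z m).
Proof.
have Cm : Cinfty m by case: tm.
rewrite L2prodC /L2prod /Rintegral; congr fine; rewrite -!pairing.
have -> : (\int[leb]_x ((z \_ Omega) x * convolution Omega psi m x)%:E =
    \int[leb]_x \int[leb]_y (EFin \o F) (x, y))%E.
  apply: eq_integral => x _; rewrite EFinM -slice// -integralZl//; last first.
    apply: eq_integrable ((integrable_mkcond _ mO).1 (L2_mul_integrable mO Lpsi (reflect_L2 oO bO x Cm))) => //.
    by move=> y _ /=; rewrite !patchE; case: ifPn => //; rewrite mul0r.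
  by apply: eq_integral => y _; rewrite /= -EFinM /F/= mulrA.
have -> : (\int[leb]_y ((psi \_ Omega) y * convolution Omega z m y)%:E =
    \int[leb]_y \int[leb]_x (EFin \o F) (x, y))%E.
  apply: eq_integral => y _; rewrite EFinM -slice// -integralZl//; last first.
    apply: eq_integrable ((integrable_mkcond _ mO).1 (L2_mul_integrable mO Lz (reflect_L2 oO bO y Cm))) => //.
    by move=> x _ /=; rewrite !patchE; case: ifPn => //; rewrite mul0r.
  by apply: eq_integral => x _; rewrite /= -EFinM /F/= mulrCA mulrA -[m (y - x)]mN opprB.
exact: (Fubini integrable_F).
Qed.

End ConvolutionAdjoint.

Section MollifyHarmonic.
Context {R : realType} {n : nat}.
Notation V := 'rV[R]_n.
Notation leb := (@lebesgue R n).

Lemma laplacian_cst_orthogonal (B : set V) (z : V -> R) : open B -> bounded_set B ->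
  test_function B z -> L2prod leb B (fun=> 1) (laplacian z) = 0.
Proof.
move=> oB bB tz; rewrite (L2prod_sumr (domain_measurable oB)).
- rewrite big1// => i _; rewrite /L2prod.
  rewrite -[RHS](integral_partial_test bB i (test_function_partial i tz)).
  by apply: eq_Rintegral => x _; rewrite mul1r.
- by apply: (Cinfty_L2 oB bB); exact: Cinfty_cst.
- by move=> i; apply: (test_function_L2 oB bB); do 2 apply: test_function_partial; exact: tz.
Qed.

(** The mean value property of the harmonic function 1. *)
Lemma mass_const (s d : R) : 0 < s -> s <= d -> @mass R n s = @mass R n d.
Proof.
move=> s0 sd; have d0 := lt_le_trans s0 sd.
pose B : set V := ball (0 : V) (d + 1).
have oB : open B by exact: ball_open.
have bB : bounded_set B.
  exists (d + 1); split=> [|M dM x]; first exact: num_real.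
  by rewrite /B -ball_normE/= sub0r normrN => xd; rewrite ltW// (lt_trans xd).
have L1 : L2 leb B (fun=> 1) by apply: (Cinfty_L2 oB bB); exact: Cinfty_cst.
have dB (y : V) : `|0 - y| <= d -> B y.
  by move=> yd; rewrite /B -ball_normE/= (le_lt_trans yd)// ltrDl.
have massE t : 0 < t -> t <= d -> @mass R n t = average B (fun=> 1) t 0.
  move=> t0 td; rewrite /mass /average /convolution /L2prod /Rintegral; congr fine.
  rewrite [RHS]integral_mkcond; apply: eq_integral => y _; rewrite patchE.
  case: ifPn => [_|]; first by rewrite mul1r sub0r mollifierN.
  rewrite notin_setE => nBy; rewrite mollifier_eq0//.
  rewrite leNgt; apply/negP => yt; apply: nBy; apply: dB.
  by rewrite sub0r normrN ltW// (lt_le_trans yt).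
rewrite (massE s s0 sd) (massE d d0 (lexx d)); apply/esym.
apply: (@average_const R n B oB bB (fun=> 1) (fun=> 0) L1 _ s d 0 s0 sd).
  move=> z tz; by rewrite laplacian_cst_orthogonal// L2prodC L2prod0r oppr0.
by move=> y yd; split => //; exact: dB.
Qed.

Lemma mass_gt0 (s : R) : 0 < s -> 0 < @mass R n s.
Proof.
move=> s0; have e0 : 0 < s / n.+2%:R by rewrite divr_gt0.
pose K : set V := closed_box (0 - const_mx (s / n.+2%:R)) (0 + const_mx (s / n.+2%:R)).
have KE : K = [set y | `|0 - y| <= s / n.+2%:R] by apply: closed_box_norm; exact: ltW.
have pK y : K y -> 0 < mollifier s y.
  rewrite KE /= sub0r normrN ler_pdivlMr// => ys; apply: mollifier_gt0 => //.
  have [->|y0] := eqVneq y 0; first by rewrite normr0 mul0r.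
  by apply: lt_le_trans ys; rewrite ltr_pM2l ?normr_gt0// ltr_nat.
have cK : compact K by exact: closed_box_compact.
have [c c0 cP] := compact_continuous_min cK (Cinfty_continuous (Cinfty_mollifier s)) pK.
apply: (@integral_gt0 R n setT (mollifier s) 0 (s / n.+2%:R) c measurableT _ _ e0) => //.
- have := mollifier_shift_integrable (0 : V) s0.
  by apply: eq_integrable => // x _; rewrite /= subr0.
- by move=> y _; exact: mollifier_ge0.
- by move=> y; rewrite -ball_normE/= => yr; apply: cP; rewrite KE /= ltW.
Qed.

Variable Omega : set V.
Hypotheses (oO : open Omega) (bO : bounded_set Omega).

Lemma convolution_mollifier_near (z : V -> R) (s e : R) y : test_function Omega z ->
  0 < s -> (forall x x', `|x - x'| < s -> `|z x - z x'| <= e) ->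
  `|convolution Omega z (mollifier s) y - @mass R n s * z y| <= e * @mass R n s.
Proof.
move=> tz s0 ze; have [Cz _ _] := tz.
have cz := Cinfty_continuous Cz.
have mE x : mollifier s (y - x) = mollifier s (x - y) by rewrite -mollifierN opprB.
have im := mollifier_shift_integrable y s0.
have ic (g : V -> R) : continuous g ->
    leb.-integrable setT (EFin \o (fun x => g x * mollifier s (x - y))).
  move=> cg; apply: (@continuous_compact_support_integrable _ _ _ (`|y| + s)).
  - by rewrite addr_ge0 ?(ltW s0).
  - by move=> x; exact: (continuousM (cg x) (@continuous_mollifier_shift _ _ s y x)).
  - by move=> x yx; rewrite mollifier_shift_far ?mulr0.
have -> : convolution Omega z (mollifier s) y =
    \int[leb]_x (z x * mollifier s (x - y)).
  rewrite /convolution /L2prod Rintegral_mkcond; apply: eq_Rintegral => x _.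
  rewrite patchE mE; case: ifPn => //; rewrite notin_setE => nx.
  by have -> : z x = 0 by [exact: test_function0 tz nx]; rewrite mul0r.
have -> : @mass R n s * z y = \int[leb]_x (z y * mollifier s (x - y)).
  by rewrite -(mass_translate y s0) mulrC; apply: esym; exact: RintegralZl.
have -> : e * @mass R n s = \int[leb]_x (e * mollifier s (x - y)).
  by rewrite -(mass_translate y s0); apply: esym; exact: RintegralZl.
have icst (c : R) := ic (fun=> c) (@cst_continuous _ _ c).
have icd : continuous (fun x => z x - z y).
  by move=> x; exact: (continuousB (cz x) (@cst_continuous _ _ (z y) x)).
have -> : \int[leb]_x (z x * mollifier s (x - y)) - \int[leb]_x (z y * mollifier s (x - y)) =
    \int[leb]_x ((z x - z y) * mollifier s (x - y)).
  rewrite -(RintegralB measurableT (ic z cz) (icst (z y))).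
  by apply: eq_Rintegral => x _; rewrite mulrBl.
apply: (le_trans (le_normr_Rintegral measurableT (ic _ icd))).
apply: le_Rintegral => //.
  exact: (integrable_abse (ic _ icd)).
move=> x _; rewrite normrM (ger0_norm (mollifier_ge0 _ s0)).
have [xy|xy] := ltP `|x - y| s; last by rewrite mollifier_eq0// !mulr0.
by rewrite ler_wpM2r ?mollifier_ge0// ze.
Qed.

Variables psi f : V -> R.
Hypothesis Lpsi : L2 leb Omega psi.
Hypothesis psi_eq : forall z, test_function Omega z ->
  L2prod leb Omega psi (laplacian z) = - L2prod leb Omega f z.

Local Notation ip := (L2prod leb Omega).
Let mO : measurable Omega := domain_measurable oO.

(** On U the averages do not depend on the scale; moved to the other side of the
pairing, an average at a tiny scale is z times the mass, up to the oscillation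
of z. *)
Lemma average_mollify (U : set V) (d : R) (z : V -> R) : U `<=` Omega -> 0 < d ->
  (forall x y, U x -> `|x - y| <= d -> Omega y /\ f y = 0) ->
  test_function U z ->
  ip (average Omega psi d) z = @mass R n d * ip psi z.
Proof.
move=> UO d0 Ud tz.
have tzO : test_function Omega z by exact: (test_function_subset UO tz).
have Lz := test_function_L2 oO bO tz.
have LA s : 0 < s -> L2 leb Omega (convolution Omega z (mollifier s)).
  by move=> s0; apply: (continuous_L2domain oO bO); apply: conv_continuous => //; exact: mollifier_test.
have L1 : L2 leb Omega (fun=> 1) by apply/(Cinfty_L2 oO bO)/Cinfty_cst.
have [M M0 ME] : exists2 M : R, 0 < M & @mass R n d = M.
  by exists (@mass R n d); [exact: mass_gt0|].
rewrite ME; apply/eqP; rewrite -subr_eq0 -normr_eq0 eq_le normr_ge0 andbT.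
apply/ler_addgt0Pl => e e0; rewrite addr0.
pose C := L2norm leb Omega psi * (M * L2norm leb Omega (fun=> 1)).
have C0 : 0 <= C by rewrite /C !mulr_ge0 ?L2norm_ge0 ?(ltW M0).
have [q q0 qC] : exists2 q, 0 < q & q * C <= e.
  exists (e / (C + 1)); first by rewrite divr_gt0 ?ltr_wpDl.
  by rewrite mulrAC ler_pdivrMr ?ltr_wpDl// ler_wpM2l ?(ltW e0) ?lerDl.
have [r r0 rP] := test_function_uniform tz q0.
have [s s0 [sd sr]] : exists2 s, 0 < s & s <= d /\ s <= r.
  by exists (Num.min r d); [rewrite lt_min r0|rewrite !ge_min !lexx orbT].
have -> : ip (average Omega psi d) z = ip (average Omega psi s) z.
  apply: eq_L2prod => x _; have [Ux|nUx] := pselect (U x).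
    apply: (congr1 (fun t => t * z x)); apply: (average_const oO bO Lpsi psi_eq s0 sd) => y; exact: (Ud _ _ Ux).
  by rewrite (test_function0 tz nUx) !mulr0.
have -> : ip (average Omega psi s) z = ip psi (convolution Omega z (mollifier s)).
  by apply: conv_self_adjoint => //; [exact: mollifier_test|exact: mollifierN].
have LD : L2 leb Omega (fun x => convolution Omega z (mollifier s) x - M * z x).
  by apply: L2B => //; [exact: LA|exact: L2Z].
have -> : ip psi (convolution Omega z (mollifier s)) - M * ip psi z =
    ip psi (fun x => convolution Omega z (mollifier s) x - M * z x).
  by rewrite -(L2prodZr mO M Lpsi Lz) -(L2prodBr mO Lpsi (LA s s0) (L2Z mO M Lz)).
apply: (le_trans (L2prod_CauchySchwarz mO Lpsi LD)).
apply: le_trans qC; rewrite /C mulrCA ler_wpM2l ?L2norm_ge0// [leRHS]mulrA.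
have qM : 0 <= q * M by rewrite mulr_ge0// ltW.
rewrite -[in leRHS](ger0_norm qM) -(L2normZ mO (q * M) L1).
apply: (L2norm_le mO LD (L2Z mO (q * M) L1)) => x _.
rewrite mulr1 (ger0_norm qM) -ME -(mass_const s0 sd).
apply: (convolution_mollifier_near x tzO s0) => y y' yy'; apply/ltW/rP.
exact: lt_le_trans sr.
Qed.

(** Weyl's lemma: away from f, psi has a smooth representative. *)
Lemma average_ae (U : set V) (d : R) : open U -> U `<=` Omega -> 0 < d ->
  (forall x y, U x -> `|x - y| <= d -> Omega y /\ f y = 0) ->
  {ae leb, forall x, U x -> average Omega psi d x / @mass R n d = psi x}.
Proof.
move=> oU UO d0 Ud.
have CA : Cinfty (average Omega psi d) by apply: conv_Cinfty => //; exact: mollifier_test.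
have LA := Cinfty_L2 oO bO CA.
have m0 := mass_gt0 d0.
have := @fundamental_lemma R n Omega oO bO U
  (fun x => average Omega psi d x - @mass R n d * psi x) oU UO.
case.
- by apply: L2B => //; exact: L2Z.
- move=> z tz; have Lz := test_function_L2 oO bO tz.
  rewrite L2prodBl ?L2prodZl//; last exact: L2Z.
  by rewrite (average_mollify UO d0 Ud tz) subrr.
move=> N [mN N0 NP]; exists N; split => // x /= nx; apply: NP => /= h; apply: nx => Ux.
have /eqP := h Ux; rewrite subr_eq0 => /eqP ->.
by rewrite mulrC mulKf// gt_eqF.
Qed.

End MollifyHarmonic.

(** * The Dirichlet problem by minimization *)

Section DirichletProblem.
Context {R : realType} {n : nat}.
Notation V := 'rV[R]_n.
Notation leb := (@lebesgue R n).

(** The direction of the Poincare inequality; it makes the dimension positive. *)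
Variable i0 : 'I_n.
Variable Omega : set V.
Hypotheses (oO : open Omega) (bO : bounded_set Omega).
Variable f : V -> R.
Hypotheses (Cf : Cinfty f) (f_ge0 : forall x, 0 <= f x).
Implicit Types (u v w z : V -> R).

Local Notation ip := (L2prod leb Omega).
Local Notation nm := (L2norm leb Omega).
Local Notation test := (test_function Omega).
Let mO : measurable Omega := domain_measurable oO.
Let Lf : L2 leb Omega f := Cinfty_L2 oO bO Cf.
Let LT z (tz : test z) : L2 leb Omega z := test_function_L2 oO bO tz.
Let LP i z (tz : test z) : L2 leb Omega (partial i z) := LT (test_function_partial i tz).

Definition dirichlet u v : R := \sum_i ip (partial i u) (partial i v).

Definition energy v : R := dirichlet v v / 2 - ip f v.

Lemma dirichlet_ge_partial v i : nm (partial i v) ^+ 2 <= dirichlet v v.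
Proof.
rewrite /dirichlet (bigD1 i)//= L2prod_sqr lerDl sumr_ge0// => j _.
by rewrite L2prod_sqr sqr_ge0.
Qed.

(** Integrating d_i (x_i v^2) = v^2 + 2 x_i v d_i v, where |x_i| is bounded on
Omega. *)
Lemma poincare : exists2 C : R, 0 < C & forall v, test v -> nm v ^+ 2 <= C * dirichlet v v.
Proof.
have [M M0 OM] := domain_in_box bO.
exists ((2 * M) ^+ 2); first by rewrite exprn_gt0// mulr_gt0.
move=> v tv; have [Cv _ _] := tv.
pose X (x : V) := x ord0 i0.
have CX : Cinfty X by exact: Cinfty_coord.
have Xb x : Omega x -> `|X x| <= M.
  move=> /OM; rewrite (closed_box_norm 0 (ltW M0)) /mkset sub0r normrN.
  by apply: le_trans; exact: le_coord_norm.
have LX : L2 leb Omega (fun x => X x * v x).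
  by apply: (Cinfty_L2 oO bO); exact: CinftyM.
have E : nm v ^+ 2 = - (2 * ip (fun x => X x * v x) (partial i0 v)).
  apply/eqP; rewrite -addr_eq0 -L2prod_sqr -L2prodZl//; last exact: LP.
  have tX : test (fun x => X x * v x) by exact: test_functionMr.
  rewrite -[X in _ == X](integral_partial_test bO i0 (test_functionM tX Cv)).
  rewrite /L2prod -RintegralD//; last 2 first.
  - exact: L2_mul_integrable (LT tv) (LT tv).
  - by apply: L2_mul_integrable => //; [exact: L2Z|exact: LP].
  apply/eqP; apply: eq_Rintegral => x _.
  rewrite partialM//; last by case: tX.
  by rewrite partialM// partial_coord eqxx mulr1; ring.
have XM : nm (fun x => X x * v x) <= M * nm v.
  rewrite -[M in leRHS](gtr0_norm M0) -(L2normZ mO M (LT tv)).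
  apply: (L2norm_le mO LX (L2Z mO M (LT tv))) => x Ox.
  by rewrite !normrM ler_wpM2r// (gtr0_norm M0) Xb.
have vn : nm v <= 2 * M * nm (partial i0 v).
  have [->|v0] := eqVneq (nm v) 0.
    by rewrite !mulr_ge0 ?L2norm_ge0// ltW.
  have {}v0 : 0 < nm v by rewrite lt0r v0 L2norm_ge0.
  rewrite -(ler_pM2l v0) -expr2 E.
  apply: (le_trans (ler_norm _)); rewrite normrN normrM ger0_norm//.
  rewrite [leRHS](_ : _ = 2 * (M * nm v * nm (partial i0 v))); last by ring.
  rewrite ler_wpM2l//; apply: (le_trans (L2prod_CauchySchwarz mO LX (LP i0 tv))).
  by rewrite ler_wpM2r ?L2norm_ge0.
have [vv0 g0] : 0 <= nm v /\ 0 <= 2 * M * nm (partial i0 v).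
  by rewrite L2norm_ge0 (le_trans _ vn)// L2norm_ge0.
apply: (@le_trans _ _ ((2 * M * nm (partial i0 v)) ^+ 2)).
  by rewrite lerXn2r ?nnegrE.
by rewrite exprMn ler_wpM2l ?sqr_ge0// dirichlet_ge_partial.
Qed.

Lemma energy_expand u z t : test u -> test z ->
  energy (fun x => u x + t * z x) =
  energy u + t * (dirichlet u z - ip f z) + t ^+ 2 * (dirichlet z z / 2).
Proof.
move=> tu tz; have [Cu _ _] := tu; have [Cz _ _] := tz.
have DE : dirichlet (fun x => u x + t * z x) (fun x => u x + t * z x) =
    dirichlet u u + t * (2 * dirichlet u z) + t ^+ 2 * dirichlet z z.
  rewrite /dirichlet !mulr_sumr -!big_split; apply: eq_bigr => i _ /=.
  have -> : partial i (fun x => u x + t * z x) = fun x => partial i u x + t * partial i z x.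
    by apply/funext => x; rewrite partialD ?partialZ//; exact: CinftyZ.
  have := LP i tu; have := LP i tz.
  set a := partial i u; set b := partial i z => Lb La.
  have Ltb := L2Z mO t Lb.
  rewrite L2prodDl ?L2prodDr ?L2prodZl ?L2prodZr ?[ip b a]L2prodC//; last exact: L2D.
  by move: (ip a a) (ip a b) (ip b b) => p q r; ring.
rewrite /energy DE (L2prodDr mO Lf (LT tu) (L2Z mO t (LT tz))) (L2prodZr mO t Lf (LT tz)).
by move: (dirichlet u u) (dirichlet u z) (dirichlet z z) (ip f u) (ip f z) => a b c p q; field.
Qed.

(** By Young's inequality, with the constant of the Poincare inequality. *)
Lemma energy_lower_bound : exists m : R, forall v, test v -> m <= energy v.
Proof.
have [C C0 P] := poincare.
exists (- (nm f ^+ 2 * C / 2)) => v tv.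
have D0 : 0 <= dirichlet v v := le_trans (sqr_ge0 _) (dirichlet_ge_partial v i0).
have fv : `|ip f v| <= nm f * nm v := L2prod_CauchySchwarz mO Lf (LT tv).
have CS : ip f v <= (nm f ^+ 2 * C + C^-1 * nm v ^+ 2) / 2.
  apply: (le_trans (ler_norm _)); apply: (le_trans fv).
  rewrite ler_pdivlMr// -subr_ge0.
  rewrite (_ : _ - _ = C * (nm f - C^-1 * nm v) ^+ 2); last by field; rewrite gt_eqF.
  by rewrite mulr_ge0 ?sqr_ge0// ltW.
have : C^-1 * nm v ^+ 2 <= dirichlet v v by rewrite mulrC ler_pdivrMr// mulrC P.
rewrite /energy; lra.
Qed.

(** Replacing v by the smooth function sqrt (v^2 + d^2) - d, which is nonnegative
with the same support, does not increase the gradient and costs at most d times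
the integral of f in the linear term, because f is nonnegative. *)
Lemma energy_nonneg v e : test v -> 0 < e ->
  exists w, [/\ test w, forall x, 0 <= w x & energy w <= energy v + e].
Proof.
move=> tv e0; have [Cv _ _] := tv.
have L1 : L2 leb Omega (fun=> 1) by apply/(Cinfty_L2 oO bO)/Cinfty_cst.
have f1 : 0 <= ip f (fun=> 1) by apply: L2prod_ge0.
pose d := e / (ip f (fun=> 1) + 1).
have d0 : 0 < d by rewrite divr_gt0// ltr_wpDl.
pose g x := v x ^+ 2 + d ^+ 2.
have g0 x : 0 < g x by rewrite ltr_wpDl ?sqr_ge0 ?exprn_gt0.
have vg x : `|v x| <= Num.sqrt (g x).
  by rewrite -sqrtr_sqr ler_wsqrtr// lerDl sqr_ge0.
have Cg : Cinfty g.
  by apply: CinftyD; [under eq_fun do rewrite expr2; exact: CinftyM|exact: Cinfty_cst].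
have Csg := Cinfty_sqrt g0 Cg.
pose w x := Num.sqrt (g x) - d.
have Cw : Cinfty w by apply: CinftyB => //; exact: Cinfty_cst.
have tw : test w.
  apply: (test_functionW tv Cw) => x nx.
  by rewrite /w /g (supp0 nx) expr0n add0r sqrtr_sqr gtr0_norm ?subrr.
have w0 x : 0 <= w x.
  by rewrite subr_ge0 -[leLHS](gtr0_norm d0) -sqrtr_sqr ler_wsqrtr// lerDr sqr_ge0.
have wv x : v x - d <= w x by rewrite lerD2r (le_trans (ler_norm _)).
exists w; split => //.
have Dw : dirichlet w w <= dirichlet v v.
  apply: ler_sum => i _; rewrite !L2prod_sqr lerXn2r ?nnegrE ?L2norm_ge0//.
  apply: (L2norm_le mO (LP i tw) (LP i tv)) => x _.
  rewrite partialB//; last exact: Cinfty_cst.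
  rewrite partial_cst subr0 partial_sqrt// /g partialD; [|by under eq_fun do rewrite expr2; exact: CinftyM|exact: Cinfty_cst].
  rewrite partial_cst addr0; under [X in partial i X]eq_fun do rewrite expr2.
  rewrite partialM// -/(g x); have S0 : 0 < Num.sqrt (g x) by rewrite sqrtr_gt0.
  have -> : (2 * Num.sqrt (g x))^-1 * (v x * partial i v x + v x * partial i v x) =
      v x / Num.sqrt (g x) * partial i v x.
    by move: S0; move: (Num.sqrt _) (v x) (partial i v x) => S p q S0; field; rewrite gt_eqF.
  rewrite normrM -[leRHS]mul1r ler_wpM2r// normrM normfV (gtr0_norm S0).
  by rewrite ler_pdivrMr// mul1r vg.
have fw : ip f v - d * ip f (fun=> 1) <= ip f w.
  have Ld := L2Z mO d L1; have Lvd := L2B mO (LT tv) Ld.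
  rewrite -(L2prodZr mO d Lf L1) -(L2prodBr mO Lf (LT tv) Ld).
  rewrite -subr_ge0 -(L2prodBr mO Lf (LT tw) Lvd).
  by apply: L2prod_ge0 => // x _; rewrite mulr1 subr_ge0.
have de : d * ip f (fun=> 1) <= e.
  by rewrite mulrAC ler_pdivrMr ?ltr_wpDl// ler_wpM2l ?(ltW e0) ?lerDl.
by move: Dw fw de; rewrite /energy; move: (dirichlet w w) (dirichlet v v) (ip f w) (ip f v) (d * ip f (fun=> 1)) => a b p q r Dw fw de; lra.
Qed.

Lemma minimizing_sequence : exists2 m : R,
  (forall v, test v -> m <= energy v) &
  exists v_ : nat -> V -> R, forall k,
    [/\ test (v_ k), forall x, 0 <= v_ k x & energy (v_ k) <= m + k.+1%:R^-1].
Proof.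
have [l lP] := energy_lower_bound.
have [T T0] : exists z, test z by exists (fun=> 0); exact: test_function_cst0.
pose A : set R := [set energy v | v in [set v | test v]].
have hA : has_inf A.
  split; first by exists (energy T); exists T.
  by exists l => _ [v tv <-]; exact: lP.
exists (inf A) => [v tv|].
  by apply: inf_lbound; [case: hA|exists v].
suff : forall k, exists v, [/\ test v, forall x, 0 <= v x & energy v <= inf A + k.+1%:R^-1].
  by move=> /choice[v_ vP]; exists v_.
move=> k; have e0 : 0 < (k.+1%:R^-1 : R) / 2 by rewrite divr_gt0// invr_gt0.
have [_ [v tv <-] vA] := inf_adherent e0 hA.
have [w [tw w0 wv]] := energy_nonneg tv e0.
exists w; split => //; apply: (le_trans wv).
by rewrite [in leRHS](splitr k.+1%:R^-1) addrA lerD2r ltW.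
Qed.

(** The midpoint of two almost minimizers has at least the minimal energy, so
they are close. *)
Lemma energy_parallelogram m u v e : (forall z, test z -> m <= energy z) ->
  test u -> test v -> energy u <= m + e -> energy v <= m + e ->
  dirichlet (fun x => v x - u x) (fun x => v x - u x) <= 8 * e.
Proof.
move=> mP tu tv ue ve; have tw := test_functionB tv tu.
set w := (fun x => v x - u x) in tw *.
have E1 := energy_expand 1 tu tw; have E2 := energy_expand 2^-1 tu tw.
have := mP _ (test_functionD tu (test_functionZ 2^-1 tw)).
have vE : (fun x => u x + 1 * w x) = v by apply/funext => x; rewrite /w mul1r addrC subrK.
rewrite vE in E1; rewrite E2; clear E2 vE; move: ue ve E1; rewrite !expr2.
move: (dirichlet w w) (dirichlet u w) (energy u) (energy v) (ip f w) => a b p q r; lra.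
Qed.

(** A minimizing sequence of nonnegative test functions is Cauchy, together with
its derivatives, and the energy being quadratic its limit satisfies the
Euler-Lagrange equation. The limit psi0 is nonnegative only almost everywhere;
taking |psi0| makes it so at every point without spoiling the convergence. *)
Theorem dirichlet_solution : exists (v_ : nat -> V -> R) (psi : V -> R) (G : 'I_n -> V -> R),
  [/\ forall k, test (v_ k),
      L2 leb Omega psi /\ forall i, L2 leb Omega (G i),
      forall x, 0 <= psi x,
      nm (fun x => v_ k x - psi x) @[k --> \oo] --> 0 /\
        forall i, nm (fun x => partial i (v_ k) x - G i x) @[k --> \oo] --> 0 &
      forall z, test z -> \sum_i ip (G i) (partial i z) = ip f z].
Proof.
have [m mP [v_ vP]] := minimizing_sequence.
have [C C0 CP] := poincare.
have tv k : test (v_ k) by have [] := vP k.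
have v0 k x : 0 <= v_ k x by have [_] := vP k.
have Ev k : energy (v_ k) <= m + k.+1%:R^-1 by have [] := vP k.
have cauchy c : 0 < c -> forall e, 0 < e -> exists N, forall k l, (N <= k)%N -> (N <= l)%N ->
    c * dirichlet (fun x => v_ k x - v_ l x) (fun x => v_ k x - v_ l x) <= e ^+ 2.
  move=> c0 e e0; have e1 : 0 < e ^+ 2 / (8 * c) by rewrite divr_gt0 ?exprn_gt0 ?mulr_gt0.
  have [N NP] : exists N, N.+1%:R^-1 <= e ^+ 2 / (8 * c).
    have [N _ /(_ N (leqnn N)) h] := near_infty_natSinv_lt (PosNum e1).
    by exists N; exact: ltW.
  exists N => k l Nk Nl.
  have En j : (N <= j)%N -> energy (v_ j) <= m + e ^+ 2 / (8 * c).
    move=> Nj; apply: (le_trans (Ev j)); rewrite lerD2l; apply: le_trans NP.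
    by rewrite lef_pV2 ?posrE// ler_nat ltnS.
  have h := energy_parallelogram mP (tv l) (tv k) (En _ Nl) (En _ Nk).
  apply: (@le_trans _ _ (c * (8 * (e ^+ 2 / (8 * c))))); first by rewrite ler_pM2l.
  by rewrite le_eqVlt; apply/orP; left; apply/eqP; clear h; move: e c c0 {e0 e1 NP En} => e c c0; field; rewrite gt_eqF.
have [psi0 Lpsi0 cpsi0] : exists2 psi, L2 leb Omega psi & nm (fun x => v_ k x - psi x) @[k --> \oo] --> 0.
  apply: (L2_complete mO (fun k => LT (tv k))) => e e0.
  have [N NP] := cauchy C C0 e e0; exists N => k l Nk Nl.
  rewrite -(@ler_pXn2r _ 2)// ?nnegrE ?L2norm_ge0 ?(ltW e0)//.
  apply: le_trans (NP k l Nk Nl); apply: CP; exact: test_functionB.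
have /choice[G GP] i : exists G, L2 leb Omega G /\
    nm (fun x => partial i (v_ k) x - G x) @[k --> \oo] --> 0.
  suff [G LG cG] : exists2 G, L2 leb Omega G & nm (fun x => partial i (v_ k) x - G x) @[k --> \oo] --> 0.
    by exists G.
  apply: (L2_complete mO (fun k => LP i (tv k))) => e e0.
  have [N NP] := cauchy 1 ltr01 e e0; exists N => k l Nk Nl.
  rewrite -(@ler_pXn2r _ 2)// ?nnegrE ?L2norm_ge0 ?(ltW e0)//.
  apply: le_trans (NP k l Nk Nl); rewrite mul1r.
  have -> : (fun x => partial i (v_ k) x - partial i (v_ l) x) = partial i (fun x => v_ k x - v_ l x).
    by apply/funext => x; rewrite partialB//; [case: (tv k)|case: (tv l)].
  exact: dirichlet_ge_partial.
exists v_, (fun x => `|psi0 x|), G; split => //.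
- by split=> [|i]; [exact: L2_norm_comp|case: (GP i)].
- split=> [|i]; last by case: (GP i).
  apply: (squeeze_cvgr _ (cvg_cst 0) cpsi0); apply: nearW => k.
  rewrite L2norm_ge0/=; apply: L2norm_le => //.
  + by apply: L2B => //; [exact: LT|exact: L2_norm_comp].
  + by apply: L2B => //; exact: LT.
  + move=> x _; rewrite -[v_ k x in leLHS]ger0_norm//; exact: ler_dist_dist.
move=> z tz; pose c := \sum_i ip (G i) (partial i z) - ip f z.
suff : c = 0 by move/eqP; rewrite subr_eq0 => /eqP.
have cc : (dirichlet (v_ k) z - ip f z) @[k --> \oo] --> c.
  apply: cvgB; last exact: cvg_cst.
  apply: cvg_big; first exact: add_continuous.
  by move=> i _; have [LG cG] := GP i; exact: (L2prod_cvgl mO (fun k => LP i (tv k)) LG (LP i tz) cG).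
have q t : 0 <= 0 + t * (2 * (c / 2)) + t ^+ 2 * (dirichlet z z / 2).
  have c2 : (t * (dirichlet (v_ k) z - ip f z) + t ^+ 2 * (dirichlet z z / 2) + k.+1%:R^-1)
      @[k --> \oo] --> t * c + t ^+ 2 * (dirichlet z z / 2) + 0.
    apply: cvgD; last exact: cvg_harmonic.
    by apply: cvgD; [apply: cvgM; [exact: cvg_cst|exact: cc]|exact: cvg_cst].
  rewrite add0r [2 * _]mulrC divfK// -[leRHS]addr0.
  apply: (ler_cvg_to (cvg_cst 0) c2); apply: nearW => k.
  have := mP _ (test_functionD (tv k) (test_functionZ t tz)).
  rewrite (energy_expand t (tv k) tz) => h; have := le_trans h (lerD (lerD (Ev k) (lexx _)) (lexx _)).
  by rewrite -!addrA lerDl; rewrite addrC -!addrA [_ + k.+1%:R^-1]addrC.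
have D0 : 0 <= dirichlet z z / 2.
  by rewrite divr_ge0// sumr_ge0// => i _; rewrite L2prod_sqr sqr_ge0.
have := @quadratic_discriminant _ 0 (c / 2) (dirichlet z z / 2) D0 q.
rewrite mul0r => H; have : (c / 2) ^+ 2 == 0 by rewrite eq_le H sqr_ge0.
by rewrite sqrf_eq0 mulf_eq0 invr_eq0 pnatr_eq0 orbF => /eqP.
Qed.

End DirichletProblem.

(** * Gluing the solution to a constant *)

Section WeakDerivatives.
Context {R : realType} {n : nat}.
Notation V := 'rV[R]_n.
Notation leb := (@lebesgue R n).

Variable Omega : set V.
Hypotheses (oO : open Omega) (bO : bounded_set Omega).
Local Notation ip := (L2prod leb Omega).
Local Notation nm := (L2norm leb Omega).
Let mO : measurable Omega := domain_measurable oO.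

Lemma L2prod_ae (f g z : V -> R) : L2 leb Omega f -> L2 leb Omega g -> L2 leb Omega z ->
  {ae leb, forall x, Omega x -> f x = g x} -> ip f z = ip g z.
Proof.
move=> Lf Lg Lz fg; rewrite /L2prod /Rintegral; congr fine.
have mi h : L2 leb Omega h -> measurable_fun Omega (fun x => (h x * z x)%:E).
  by move=> Lh; exact: (measurable_int _ (L2_mul_integrable mO Lh Lz)).
apply: ae_eq_integral => //; [exact: mi|exact: mi|].
by apply: filterS fg => x h Ox; rewrite h.
Qed.

Lemma weak_partial_limit (u_ : nat -> V -> R) (phi Phi : V -> R) i z :
  (forall k, test_function Omega (u_ k)) -> L2 leb Omega phi -> L2 leb Omega Phi ->
  nm (fun x => u_ k x - phi x) @[k --> \oo] --> 0 ->
  nm (fun x => partial i (u_ k) x - Phi x) @[k --> \oo] --> 0 ->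
  test_function Omega z -> ip phi (partial i z) = - ip Phi z.
Proof.
move=> tu Lphi LPhi cu cp tz.
have Lu k := test_function_L2 oO bO (tu k).
have Lp k := test_function_L2 oO bO (test_function_partial i (tu k)).
have c1 := L2prod_cvgl mO Lu Lphi (test_function_L2 oO bO (test_function_partial i tz)) cu.
have c2 := L2prod_cvgl mO Lp LPhi (test_function_L2 oO bO tz) cp.
suff c3 : ip (u_ k) (partial i z) @[k --> \oo] --> - ip Phi z.
  exact: (cvg_unique _ c1 c3).
have -> : (fun k => ip (u_ k) (partial i z)) = (fun k => - ip (partial i (u_ k)) z).
  by apply/funext => k; rewrite (integration_by_parts_test oO bO)//; case: (tu k).
exact: cvgN.
Qed.

End WeakDerivatives.

Section CutoffWeight.
Context {R : realType} {n : nat}.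
Notation V := 'rV[R]_n.
Notation leb := (@lebesgue R n).
Variable Omega : set V.
Hypotheses (oO : open Omega) (bO : bounded_set Omega).
Variables (f psi : V -> R) (G : 'I_n -> V -> R) (v_ : nat -> V -> R).
Hypotheses (Lpsi : L2 leb Omega psi) (LG : forall i, L2 leb Omega (G i)).
Hypothesis tv : forall k, test_function Omega (v_ k).
Local Notation ip := (L2prod leb Omega).
Local Notation nm := (L2norm leb Omega).
Hypothesis cpsi : nm (fun x => v_ k x - psi x) @[k --> \oo] --> 0.
Hypothesis cG : forall i, nm (fun x => partial i (v_ k) x - G i x) @[k --> \oo] --> 0.
Hypothesis G_eq : forall z, test_function Omega z -> \sum_i ip (G i) (partial i z) = ip f z.
Let mO : measurable Omega := domain_measurable oO.

Lemma limit_weak_partial i z : test_function Omega z -> ip psi (partial i z) = - ip (G i) z.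
Proof. by move=> tz; exact: (weak_partial_limit oO bO tv Lpsi (LG i) cpsi (cG i) tz). Qed.

Lemma limit_laplacian z : test_function Omega z ->
  ip psi (laplacian z) = - ip f z.
Proof.
move=> tz; rewrite (L2prod_sumr mO)//; last first.
  by move=> i; apply: (test_function_L2 oO bO); do 2 apply: test_function_partial; exact: tz.
rewrite -(G_eq tz) -sumrN; apply: eq_bigr => i _.
by rewrite limit_weak_partial//; exact: test_function_partial.
Qed.

Variable chi : V -> R.
Hypotheses (tchi : test_function Omega chi) (chi01 : forall x, 0 <= chi x <= 1).
Hypothesis chif : forall x, (1 - chi x) * f x = 0.

Definition weight x : R := chi x + (1 - chi x) * psi x.
Definition weight_partial i x : R :=
  partial i chi x + (1 - chi x) * G i x - partial i chi x * psi x.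
Definition weight_approx k x : R := chi x + (1 - chi x) * v_ k x.

Let Cchi : Cinfty chi. Proof. by case: tchi. Qed.
Let C1chi : Cinfty (fun x => 1 - chi x).
Proof. by apply: CinftyB; [exact: Cinfty_cst|]. Qed.

Lemma weight_L2 : L2 leb Omega weight.
Proof.
apply: L2D => //; first exact: (Cinfty_L2 oO bO).
by apply: (continuous_mul_L2 oO bO) => //; exact: Cinfty_continuous.
Qed.

Lemma weight_partial_L2 i : L2 leb Omega (weight_partial i).
Proof.
have Cp := Cinfty_partial i Cchi.
apply: L2B => //; first apply: L2D => //; first exact: (Cinfty_L2 oO bO).
  by apply: (continuous_mul_L2 oO bO) => //; exact: Cinfty_continuous.
by apply: (continuous_mul_L2 oO bO) => //; exact: Cinfty_continuous.
Qed.

Lemma weight_approx_test k : test_function Omega (weight_approx k).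
Proof. by apply: test_functionD => //; apply: test_functionMr. Qed.

Let chi1 x : `|1 - chi x| <= 1.
Proof.
have /andP[c0 c1] := chi01 x; rewrite ger0_norm ?subr_ge0//.
by rewrite gerBl.
Qed.

Lemma weight_approx_cvg : nm (fun x => weight_approx k x - weight x) @[k --> \oo] --> 0.
Proof.
apply: (squeeze_cvgr _ (cvg_cst 0) cpsi); apply: nearW => k.
rewrite L2norm_ge0/=; apply: L2norm_le => //.
- apply: L2B => //; last exact: weight_L2.
  exact: test_function_L2 (weight_approx_test k).
- by apply: L2B => //; exact: test_function_L2 (tv k).
move=> x _; rewrite /weight_approx /weight.
rewrite (_ : _ - _ = (1 - chi x) * (v_ k x - psi x)); last by ring.
by rewrite normrM -[leRHS]mul1r ler_wpM2r.
Qed.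

Lemma weight_partial_cvg i :
  nm (fun x => partial i (weight_approx k) x - weight_partial i x) @[k --> \oo] --> 0.
Proof.
have [B B0 BP] := continuous_domain_bounded bO (Cinfty_continuous (Cinfty_partial i Cchi)).
have c0 : (nm (fun x => partial i (v_ k) x - G i x) + B * nm (fun x => v_ k x - psi x))
    @[k --> \oo] --> (0 + B * 0 : R).
  by apply: cvgD; [exact: cG|apply: cvgM; [exact: cvg_cst|exact: cpsi]].
rewrite mulr0 addr0 in c0.
apply: (squeeze_cvgr _ (cvg_cst 0) c0); apply: nearW => k.
have Lv : L2 leb Omega (v_ k) := test_function_L2 oO bO (tv k).
have Lvi : L2 leb Omega (partial i (v_ k)) := test_function_L2 oO bO (test_function_partial i (tv k)).
have L1 : L2 leb Omega (fun x => partial i (v_ k) x - G i x) by exact: L2B.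
have L2' : L2 leb Omega (fun x => v_ k x - psi x) by exact: L2B.
have Lc1 : L2 leb Omega (fun x => (1 - chi x) * (partial i (v_ k) x - G i x)).
  by apply: (continuous_mul_L2 oO bO) => //; exact: Cinfty_continuous.
have Lc2 : L2 leb Omega (fun x => - partial i chi x * (v_ k x - psi x)).
  by apply: (continuous_mul_L2 oO bO) => //; exact/Cinfty_continuous/CinftyN/Cinfty_partial.
rewrite L2norm_ge0/=.
have -> : (fun x => partial i (weight_approx k) x - weight_partial i x) =
    (fun x => (1 - chi x) * (partial i (v_ k) x - G i x) + - partial i chi x * (v_ k x - psi x)).
  apply/funext => x; have Cv : Cinfty (v_ k) by case: (tv k).
  rewrite /weight_approx partialD//; last exact: CinftyM.
  rewrite partialM// partialB//; last exact: Cinfty_cst.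
  by rewrite partial_cst /cst /weight_partial; ring.
apply: (le_trans (L2normD mO Lc1 Lc2)); apply: lerD.
  apply: L2norm_le => // x _; rewrite normrM -[leRHS]mul1r.
  by rewrite ler_wpM2r.
rewrite -[B in leRHS](gtr0_norm B0) -(L2normZ mO B L2').
apply: L2norm_le => //; first exact: L2Z.
by move=> x Ox; rewrite !normrM normrN ler_wpM2r// (gtr0_norm B0) BP.
Qed.

(** - Delta (chi + (1 - chi) psi), up to (1 - chi) f = 0. *)
Definition weight_source x : R :=
  - laplacian chi x + 2 * (\sum_i G i x * partial i chi x) + psi x * laplacian chi x.

Let Lc (g h : V -> R) : Cinfty g -> L2 leb Omega h -> L2 leb Omega (fun x => g x * h x).
Proof. by move=> Cg; apply: (continuous_mul_L2 oO bO) => //; exact: Cinfty_continuous. Qed.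

Let Lcr (g h : V -> R) : Cinfty g -> L2 leb Omega h -> L2 leb Omega (fun x => h x * g x).
Proof. by move=> Cg Lh; under eq_fun do rewrite mulrC; exact: Lc. Qed.

Let LGc i : L2 leb Omega (fun x => G i x * partial i chi x).
Proof. by apply: Lcr => //; exact: Cinfty_partial. Qed.

Let Cl : Cinfty (laplacian chi) := Cinfty_laplacian Cchi.

Lemma weight_source_L2 : L2 leb Omega weight_source.
Proof.
apply: L2D; [exact: mO| |exact: Lcr].
apply: L2D; [exact: mO|exact/L2N/(Cinfty_L2 oO bO)|].
by apply: L2Z => //; exact: L2_sum.
Qed.

(** Leibniz' rule in weak form: the factors coming from chi are moved onto the test
function, and the equation of psi is tested with (1 - chi) z. *)
Lemma weight_eq z : test_function Omega z ->
  \sum_i ip (weight_partial i) (partial i z) = ip weight_source z.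
Proof.
move=> tz; have [Cz _ _] := tz; have Lz := test_function_L2 oO bO tz.
have Lzi i := test_function_L2 oO bO (test_function_partial i tz).
have Cc i : Cinfty (partial i chi) by exact: Cinfty_partial.
have Ccc i : Cinfty (partial i (partial i chi)) by exact: Cinfty_partial.
have E i : ip (weight_partial i) (partial i z) =
    - ip (partial i (partial i chi)) z + ip (G i) (partial i (fun x => (1 - chi x) * z x))
    + 2 * ip (fun x => G i x * partial i chi x) z
    + ip (fun x => psi x * partial i (partial i chi) x) z.
  have L1 := Cinfty_L2 oO bO (Cc i).
  have L2' := Lc C1chi (LG i).
  have L3 := Lc (Cc i) Lpsi.
  rewrite /weight_partial (L2prodBl mO (L2D mO L1 L2') L3 (Lzi i)).
  rewrite (L2prodDl mO L1 L2' (Lzi i)) (integration_by_parts_test oO bO i (Cc i) tz).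
  have tm : test_function Omega (fun x => (1 - chi x) * z x) by exact: test_functionMr.
  have Lm := test_function_L2 oO bO (test_function_partial i tm).
  have E1 : ip (fun x => (1 - chi x) * G i x) (partial i z) =
      ip (G i) (partial i (fun x => (1 - chi x) * z x)) + ip (fun x => G i x * partial i chi x) z.
    have LGz := LGc i.
    have -> : ip (fun x => G i x * partial i chi x) z = ip (G i) (fun x => partial i chi x * z x).
      by apply: eq_L2prod => x _; rewrite mulrA.
    rewrite -(L2prodDr mO (LG i) Lm (Lc (Cc i) Lz)); apply: eq_L2prod => x _.
    rewrite partialM// partialB//; last exact: Cinfty_cst.
    by rewrite partial_cst /cst; ring.
  have tq : test_function Omega (fun x => partial i chi x * z x) by exact: test_functionMr.
  have E2 : ip (fun x => partial i chi x * psi x) (partial i z) =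
      - ip (fun x => G i x * partial i chi x) z - ip (fun x => psi x * partial i (partial i chi) x) z.
    have -> : ip (fun x => G i x * partial i chi x) z = ip (G i) (fun x => partial i chi x * z x).
      by apply: eq_L2prod => x _; rewrite mulrA.
    rewrite -(limit_weak_partial i tq).
    have -> : ip (fun x => psi x * partial i (partial i chi) x) z = ip psi (fun x => partial i (partial i chi) x * z x).
      by apply: eq_L2prod => x _; rewrite mulrA.
    rewrite -(L2prodBr mO Lpsi (test_function_L2 oO bO (test_function_partial i tq)) (Lc (Ccc i) Lz)).
    by apply: eq_L2prod => x _; rewrite partialM//; ring.
  by rewrite E1 E2; move: (ip _ _) (ip _ _) (ip _ _) (ip _ _) => p q r t; ring.
under eq_bigr do rewrite E.
rewrite !big_split/= sumrN -mulr_sumr G_eq; last exact: test_functionMr.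
have -> : ip f (fun x => (1 - chi x) * z x) = 0.
  rewrite -[RHS](L2prod0r leb Omega f); apply: eq_L2prod => x _.
  by rewrite mulrA [f x * _]mulrC chif mul0r mulr0.
rewrite addr0 /weight_source.
have LA : L2 leb Omega (fun x => - laplacian chi x) by exact/L2N/(Cinfty_L2 oO bO).
have LB0 := L2_sum mO (index_enum 'I_n) LGc.
have LB := L2Z mO 2 LB0.
rewrite (L2prodDl mO (L2D mO LA LB) (Lcr Cl Lpsi) Lz) (L2prodDl mO LA LB Lz).
rewrite (L2prodNl mO (Cinfty_L2 oO bO Cl) Lz) (L2prodZl mO 2 LB0 Lz).
rewrite (L2prod_suml mO _ LGc Lz) (L2prod_suml mO _ (fun i => Cinfty_L2 oO bO (Ccc i)) Lz).
congr (_ + _ + _).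
rewrite -(L2prod_suml mO _ (fun i => Lcr (Ccc i) Lpsi) Lz).
by apply: eq_L2prod => x _; rewrite mulr_sumr.
Qed.

End CutoffWeight.

(** With f a bump in O1 and psi the solution of - Delta psi = f, the function
phi = chi + (1 - chi) psi equals 1 on the closure of O1, and Delta phi is
supported in the region K' where chi is neither 1 nor 0 nearby. K' stays away
from the support of f, so there psi coincides with the smooth positive function
psit, an average divided by the mass. Then a = - Delta phi / phi, computed with
psit in place of psi, is smooth; outside the support of chi it vanishes, and the
flat function added to the denominator only keeps the latter positive
everywhere. *)
Theorem harmonic_weight {R : realType} {n : nat} (i0 : 'I_n) (Omega O1 : set 'rV[R]_n) :
  open Omega -> bounded_set Omega -> connected Omega ->
  open O1 -> O1 !=set0 -> compact (closure O1) -> closure O1 `<=` Omega ->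
  exists (a phi : 'rV[R]_n -> R) (Phi : 'I_n -> 'rV[R]_n -> R) (u_ : nat -> 'rV[R]_n -> R),
  [/\ Cinfty a,
      [/\ L2 (lebesgue n) Omega phi, forall i, L2 (lebesgue n) Omega (Phi i) &
          forall k, test_function Omega (u_ k)],
      L2norm (lebesgue n) Omega (fun x => u_ k x - phi x) @[k --> \oo] --> 0 /\
        (forall i, L2norm (lebesgue n) Omega (fun x => partial i (u_ k) x - Phi i x)
          @[k --> \oo] --> 0),
      forall x, closure O1 x -> phi x = 1 /\ forall i, Phi i x = 0 &
      forall z, test_function Omega z ->
        \sum_i L2prod (lebesgue n) Omega (Phi i) (partial i z) =
        L2prod (lebesgue n) Omega (fun x => a x * phi x) z].
Proof.
move=> oO bO cO oO1 [z0 Oz0] cO1 O1O.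
have mO := domain_measurable oO.
pose leb := @lebesgue R n; pose K := closure O1.
have [r r0 rO] := open_contains_ball oO1 Oz0.
have h0 : 0 < r / 2 by rewrite divr_gt0.
pose lo := z0 - const_mx (r / 2); pose hi := z0 + const_mx (r / 2).
pose B := closed_box lo hi.
have BE : B = [set y | `|z0 - y| <= r / 2] by apply: closed_box_norm; exact: ltW.
have BO1 : B `<=` O1.
  rewrite BE => y /= yr; apply: rO; rewrite -ball_normE/= (le_lt_trans yr)//.
  by rewrite ltr_pdivrMr// ltr_pMr// ltr1n.
have cB : compact B by exact: closed_box_compact.
have O1sO : O1 `<=` Omega by move=> x O1x; apply: O1O; exact: subset_closure.
pose f := box_bump lo hi.
have Cf : Cinfty f by exact: Cinfty_box_bump.
have f_ge0 x : 0 <= f x by exact: box_bump_ge0.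
have f0 x : ~ B x -> f x = 0 by move=> nB; apply: box_bump_eq0 => /box_closed_box.
have fz0 : 0 < f z0.
  apply: box_bump_gt0 => i; rewrite !mxE ltrDl h0 andbT.
  by rewrite ltrBlDr ltrDl.
have [v_ [psi [G [tv [Lpsi LG] psi_ge0 [cpsi cG] G_eq]]]] :=
  dirichlet_solution i0 oO bO Cf f_ge0.
have Lf := Cinfty_L2 oO bO Cf.
have psi_eq z := limit_laplacian oO bO Lpsi LG tv cpsi cG G_eq (z := z).
have [chi [tchi chi01 [W [oW KW chiW]]]] := cutoff cO1 oO O1O.
have [Cchi cchi chiO] := tchi.
pose K' := supp chi `&` ~` W.
have cK' : compact K'.
  apply: (subclosed_compact _ cchi) => //; last by move=> x [].
  by apply: closedI; [exact: closed_closure|exact: open_closedC].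
pose OB := Omega `&` ~` B.
have oOB : open OB by apply: openI => //; apply: closed_openC; exact: compact_closed_row.
have K'OB : K' `<=` OB.
  move=> x [sx nWx]; split; first exact: chiO.
  by move=> /BO1 /subset_closure /KW.
have [d0 d0p dP] := compact_thickening cK' oOB K'OB.
pose d := d0 / 2; have dp : 0 < d by rewrite divr_gt0.
pose U : set 'rV[R]_n := \bigcup_(x in K') ball x d.
have oU : open U by apply: bigcup_open => x _; exact: ball_open.
have K'U : K' `<=` U by move=> x K'x; exists x => //; exact: ballxx.
pose dd := d / 2; have ddp : 0 < dd by rewrite divr_gt0.
have Udd x y : U x -> `|x - y| <= dd -> Omega y /\ f y = 0.
  move=> [k K'k]; rewrite -ball_normE/= => kx xy.
  have [] : OB y.
    apply: (dP k) => //; rewrite -(subrK x k) -addrA (le_lt_trans (ler_normD _ _))//.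
    rewrite (splitr d0) ltr_leD//; apply: (le_trans xy).
    by rewrite ler_pdivrMr// ler_pMr// ler1n.
  by move=> Oy nB; split => //; exact: f0.
have UO : U `<=` Omega.
  by move=> x Ux; have [] := Udd x x Ux _; rewrite ?subrr ?normr0 ?ltW.
pose m := @mass R n dd; have mp : 0 < m by exact: mass_gt0.
pose psit x := m^-1 * average Omega psi dd x.
have Cpsit : Cinfty psit.
  by apply: CinftyZ; apply: (conv_Cinfty oO bO Lpsi); exact: mollifier_test.
have psit_ge0 x : 0 <= psit x.
  by apply: mulr_ge0; [rewrite invr_ge0 ltW|exact: average_ge0].
have psit_gt0 x : Omega x -> 0 < psit x.
  move=> Ox; apply: mulr_gt0; first by rewrite invr_gt0.
  apply: (average_gt0 oO bO Lpsi Lf psi_eq _ _ cO (O1sO _ Oz0) (Cinfty_continuous Cf) fz0 ddp Ox) => //.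
have psitE : {ae leb, forall x, U x -> psi x = psit x}.
  have := average_ae oO bO Lpsi psi_eq oU UO ddp Udd.
  by apply: filterS => x h Ux; rewrite -h// mulrC.
have Lpsit := Cinfty_L2 oO bO Cpsit.
have GE i : {ae leb, forall x, U x -> G i x = partial i psit x}.
  have Lpi := Cinfty_L2 oO bO (Cinfty_partial i Cpsit).
  have H := @fundamental_lemma R n Omega oO bO U (fun x => G i x - partial i psit x) oU UO (L2B mO (LG i) Lpi).
  have : {ae leb, forall x, U x -> G i x - partial i psit x = 0}.
    apply: H => z tz; have tzO := test_function_subset UO tz.
    have Lz := test_function_L2 oO bO tz.
    have Lzi := test_function_L2 oO bO (test_function_partial i tz).
    rewrite (L2prodBl mO (LG i) Lpi Lz).
    have -> : L2prod leb Omega (G i) z = - L2prod leb Omega psi (partial i z).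
      by rewrite (limit_weak_partial oO bO Lpsi LG tv cpsi cG i tzO) opprK.
    have -> : L2prod leb Omega (partial i psit) z = - L2prod leb Omega psit (partial i z).
      by rewrite (integration_by_parts_test oO bO i Cpsit tzO) opprK.
    rewrite /psit L2prodZl//; last by apply: (Cinfty_L2 oO bO); apply: (conv_Cinfty oO bO Lpsi); exact: mollifier_test.
    rewrite (average_mollify oO bO Lpsi psi_eq UO ddp Udd (test_function_partial i tz)).
    by rewrite mulKf ?subrr// gt_eqF.
  by apply: filterS => x h Ux; apply/eqP; rewrite -subr_eq0 h.
pose phit x := chi x + (1 - chi x) * psit x.
have Cphit : Cinfty phit.
  apply: CinftyD => //; apply: CinftyM => //.
  by apply: CinftyB => //; exact: Cinfty_cst.
have phit_ge0 x : 0 <= phit x.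
  have /andP[chi0 chi1] := chi01 x.
  by rewrite addr_ge0// mulr_ge0// subr_ge0.
have phit_gt0 x : supp chi x -> 0 < phit x.
  move=> sx; have /andP[chi0 chi1] := chi01 x.
  have p0 := psit_gt0 x (chiO _ sx).
  rewrite /phit; move: chi0; rewrite le_eqVlt => /predU1P[<-|chi0].
    by rewrite subr0 mul1r add0r.
  by rewrite ltr_pwDl// mulr_ge0 ?subr_ge0.
have [c cp cP] := compact_continuous_min cchi (Cinfty_continuous Cphit) phit_gt0.
(* the denominator is phit on the support of chi and never vanishes *)
pose den x := phit x + flat 0 (c - phit x).
have den_gt0 x : 0 < den x.
  have := phit_ge0 x; rewrite le_eqVlt => /predU1P[p0|p0].
    by rewrite /den -p0 subr0 add0r flat_gt0.
  by rewrite ltr_pwDl// flat_ge0.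
have Cden : Cinfty den.
  by apply: CinftyD => //; apply: Cinfty_flat; apply: CinftyB => //; exact: Cinfty_cst.
pose nu x := - laplacian chi x + 2 * (\sum_i partial i psit x * partial i chi x) + psit x * laplacian chi x.
have Cl := Cinfty_laplacian Cchi.
have Cnu : Cinfty nu.
  apply: CinftyD; last exact: CinftyM.
  apply: CinftyD; first exact: CinftyN.
  apply: CinftyZ; apply: Cinfty_sum => i _.
  by apply: CinftyM; exact: Cinfty_partial.
pose a x := nu x * (den x)^-1.
have Ca : Cinfty a.
  by apply: CinftyM => //; apply: CinftyV => // x; rewrite gt_eqF.
have chif x : (1 - chi x) * f x = 0.
  have [Bx|nBx] := pselect (B x); last by rewrite f0// mulr0.
  by rewrite chiW ?subrr ?mul0r//; apply/KW/subset_closure/BO1.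
have Lphi := weight_L2 oO bO Lpsi tchi.
have partialW i x : W x -> partial i chi x = 0.
  by move=> Wx; exact: (partial_locally_cst i oW Wx chiW).
exists a, (weight psi chi), (weight_partial psi G chi), (weight_approx v_ chi); split => //.
- split => // [i|k]; first exact: weight_partial_L2.
  exact: weight_approx_test.
- split=> [|i]; first exact: weight_approx_cvg.
  exact: weight_partial_cvg.
- move=> x /KW Wx; rewrite /weight /weight_partial chiW// subrr mul0r addr0.
  by split => // i; rewrite partialW// !mul0r addr0 subrr.
move=> z tz; rewrite (weight_eq oO bO Lpsi LG tv cpsi cG G_eq tchi chif tz).
apply: (L2prod_ae oO) => //.
- exact: weight_source_L2.
- by apply: (continuous_mul_L2 oO bO) => //; exact: Cinfty_continuous.
- exact: test_function_L2 tz.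
have GEall : {ae leb, forall x, forall i, U x -> G i x = partial i psit x}.
  by apply: filter_forall => i; exact: GE.
apply: filterS2 psitE GEall => x pE gE Ox.
have [K'x|nK'x] := pselect (K' x).
  have Ux := K'U _ K'x; have sx : supp chi x by case: K'x.
  have -> : weight psi chi x = den x.
    by rewrite /den flat_eq0 ?subr_le0 ?cP// addr0 /weight pE.
  rewrite /a divfK ?gt_eqF// /weight_source /nu pE//.
  congr (_ + 2 * _ + _); apply: eq_bigr => i _.
  by rewrite gE.
have p0 i : partial i chi x = 0 /\ partial i (partial i chi) x = 0.
  have [Wx|nWx] := pselect (W x).
    split; first exact: partialW.
    exact: (partial_locally_cst i oW Wx (partialW i)).
  have nsx : ~ supp chi x by move=> sx; apply: nK'x.
  have oS : open (~` supp chi) by apply: closed_openC; exact: closed_closure.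
  split; first exact: partial_supp0.
  by apply: (partial_locally_cst i oS nsx) => y; exact: partial_supp0.
have l0 : laplacian chi x = 0 by rewrite /laplacian big1// => i _; case: (p0 i).
have s0 (H : 'I_n -> R) : \sum_i H i * partial i chi x = 0.
  by rewrite big1// => i _; rewrite (p0 i).1 mulr0.
by rewrite /weight_source /a /nu l0 !s0 oppr0 !mulr0 !addr0 !mul0r.
Qed.

(** * A continuous function with vanishing weak derivative *)

Section StepDerivative.
Context {R : realType}.

Definition dstep (t : R) : R :=
  (flat 2 t * flat 0 (1 - t) + flat 0 t * flat 2 (1 - t)) /
  (flat 0 t + flat 0 (1 - t)) ^+ 2.

Lemma is_derive_flat0 (t : R) : is_derive t 1 (flat 0) (flat 2 t).
Proof. by have := is_derive_flat 0 t; rewrite mul0r subr0. Qed.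

Lemma is_derive_flat0_sub (t : R) :
  is_derive t 1 (fun x => flat 0 (1 - x)) (- flat 2 (1 - t)).
Proof.
have h1 : is_derive t (1 : R) (fun x : R => 1 - x) (-1).
  by apply: (is_derive_eq (is_deriveB (is_derive_cst (1 : R) t 1) (is_derive_id t 1))); rewrite sub0r.
have := @is_derive1_comp R (flat 0) (fun x => 1 - x) t (flat 2 (1 - t)) (-1) (is_derive_flat0 _) h1.
by rewrite mulrN1.
Qed.

Lemma is_derive_step (t : R) : is_derive t 1 step (dstep t).
Proof.
have d1 := is_derive_flat0 t; have d2 := is_derive_flat0_sub t.
have d3 : is_derive t 1 (fun x : R => flat 0 x + flat 0 (1 - x)) (flat 2 t - flat 2 (1 - t)).
  exact: is_deriveD.
have n0 : flat 0 t + flat 0 (1 - t) != 0 by rewrite gt_eqF ?step_denom_gt0.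
have d4 := @is_derive_comp R _ (fun y => y^-1) (fun x => flat 0 x + flat 0 (1 - x)) t 1
  _ _ (is_derive_inv n0) d3.
have := is_deriveM d1 d4; rewrite -/step => d5.
apply: (is_derive_eq d5).
rewrite /dstep /GRing.scale/=; move: n0; move: (flat 0 t) (flat 0 (1 - t)) (flat 2 t) (flat 2 (1 - t)).
by move=> a b p q n0; field.
Qed.

Lemma dstep_ge0 (t : R) : 0 <= dstep t.
Proof. by rewrite divr_ge0 ?sqr_ge0// addr_ge0// mulr_ge0// flat_ge0. Qed.

Lemma dstep_gt0 (t : R) : 0 < t < 1 -> 0 < dstep t.
Proof.
move=> /andP[t0 t1]; rewrite divr_gt0 ?exprn_gt0 ?step_denom_gt0//.
by rewrite ltr_pwDl ?mulr_gt0 ?flat_gt0 ?subr_gt0// mulr_ge0 ?flat_ge0.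
Qed.

Lemma dstep_eq0 (t : R) : ~~ (0 < t < 1) -> dstep t = 0.
Proof.
rewrite negb_and -!leNgt => /orP[t0|t1].
  by rewrite /dstep !(flat_eq0 _ t0) !mul0r addr0 mul0r.
have t1' : 1 - t <= 0 by rewrite subr_le0.
by rewrite /dstep !(flat_eq0 _ t1') !mulr0 addr0 mul0r.
Qed.

Definition jump (a e t : R) : R := step (e^-1 * (t - a)).

Lemma is_derive_jump (a e t : R) :
  is_derive t 1 (jump a e) (dstep (e^-1 * (t - a)) * e^-1).
Proof.
have h1 : is_derive t (1 : R) (fun x : R => e^-1 * (x - a)) e^-1.
  apply: (is_derive_eq (is_deriveZ e^-1 (is_deriveB (is_derive_id t 1) (is_derive_cst a t 1)))).
  by rewrite subr0 /GRing.scale/= mulr1.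
exact: (@is_derive1_comp R step (fun x => e^-1 * (x - a)) t _ _ (is_derive_step _) h1).
Qed.

Lemma Ck_along_derivable (D : set R) (phi : R -> R) : D 1 ->
  (forall k, Ck_along D k phi) -> forall k x, derivable (derive1n k phi) x 1.
Proof.
move=> D1 + k; elim: k phi => [|k IHk] phi Cphi x.
  by have [_ /(_ _ D1)[]] := Cphi 1%N.
rewrite derive1Sn; apply: IHk => j.
have [_ /(_ _ D1)[_]] := Cphi j.+1.
by have -> : derive1 phi = 'D_1 phi by apply/funext => y; rewrite derive1E.
Qed.

Lemma Ck_along_jump k (a e : R) : Ck_along (setT : set R) k (jump a e).
Proof.
apply: Ck_along_step.
apply: Ck_alongZ; apply: Ck_alongB; last exact: Ck_along_cst.
by apply: (@Ck_along_affine _ _ _ _ id id) => x; exact: cvg_id.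
Qed.

End StepDerivative.

Section WeaklyConstant.
Context {R : realType}.
Notation mu1 := (@lebesgue_measure R).

Lemma time_test_jump (T a b e : R) : 0 < e -> 0 < a -> a + e < T -> 0 < b -> b + e < T ->
  time_test_function T (fun t => jump a e t - jump b e t).
Proof.
move=> e0 a0 aT b0 bT; set phi := (fun t => _).
have Cphi k : Ck_along (setT : set R) k phi.
  by apply: Ck_alongB; exact: Ck_along_jump.
pose lo := Num.min a b; pose hi := Num.max (a + e) (b + e).
have out t : phi t != 0 -> t \in `[lo, hi].
  apply: contraNT; rewrite in_itv/= negb_and -!ltNge => /orP[tlo|thi].
    move: tlo; rewrite lt_min => /andP[ta tb].
    rewrite /phi /jump !step0 ?subrr//; rewrite pmulr_rle0 ?invr_gt0// subr_le0 ltW//.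
  move: thi; rewrite gt_max => /andP[ta tb].
  rewrite /phi /jump !step1 ?subrr//; rewrite ler_pdivlMl// mulr1 lerBrDl ltW//.
have sub : closure [set t | phi t != 0] `<=` `[lo, hi]%classic.
  have /closure_id -> : closed `[lo, hi]%classic by exact: interval_closed.
  by apply: closure_subset => t /= /out.
split.
- exact: (Ck_along_derivable (D := setT)).
- by apply: subclosed_compact sub; [exact: closed_closure|exact: segment_compact].
- apply: (subset_trans sub) => t /=; rewrite !in_itv/= => /andP[lt th]; apply/andP; split.
    by apply: lt_le_trans lt; rewrite lt_min a0.
  by apply: le_lt_trans th _; rewrite gt_max aT.
Qed.

Lemma derive_jump_diff (a b e t : R) :
  derive1 (fun t => jump a e t - jump b e t) t =
  dstep (e^-1 * (t - a)) * e^-1 - dstep (e^-1 * (t - b)) * e^-1.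
Proof.
have [_ <-] := is_deriveB (is_derive_jump a e t) (is_derive_jump b e t).
by rewrite derive1E.
Qed.

(** Were H a < c < H b, test with the difference of two jumps, from 0 to 1, located
near a and near b: its derivative is nonnegative where H < c, nonpositive where
H > c, and has integral 0, so the integral of (c - H) times it would be
positive and zero. *)
Lemma weakly_constant_le (T : R) (H : R -> R) (a b : R) : continuous H ->
  (forall phi, time_test_function T phi ->
    \int[mu1]_(t in `]0, T[) (H t * derive1 phi t) = 0) ->
  a \in `]0, T[ -> b \in `]0, T[ -> H b <= H a.
Proof.
move=> cH H0; rewrite !in_itv/= => /andP[a0 aT] /andP[b0 bT].
rewrite leNgt; apply/negP => Hab.
pose c := (H a + H b) / 2.
have ac : H a < c by rewrite ltr_pdivlMr// mulr_natr mulr2n ltrD2l.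
have cb : c < H b by rewrite ltr_pdivrMr// mulr_natr mulr2n ltrD2r.
have [ea ea0 aP] : exists2 r : R, 0 < r & forall t, `|a - t| < r -> H t < c.
  have : \forall t \near a, H t < c by exact: (cvgr_lt (H a) (cH a) c ac).
  move=> /nbhs_ballP[r r0 rP]; exists r => // t tr; apply: rP; exact: tr.
have [eb eb0 bP] : exists2 r : R, 0 < r & forall t, `|b - t| < r -> c < H t.
  have : \forall t \near b, c < H t by exact: (cvgr_gt (H b) (cH b) c cb).
  move=> /nbhs_ballP[r r0 rP]; exists r => // t tr; apply: rP; exact: tr.
have [e e0 [[e1 e2] [e3 e4]]] : exists2 e : R, 0 < e &
    (e < ea /\ e < eb) /\ (a + e < T /\ b + e < T).
  exists (Num.min (Num.min ea eb) (Num.min (T - a) (T - b)) / 2).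
    by rewrite divr_gt0// !lt_min ea0 eb0 !subr_gt0 aT bT.
  set q := Num.min _ _.
  have q0 : 0 < q by rewrite !lt_min ea0 eb0 !subr_gt0 aT bT.
  have q2 : q / 2 < q by rewrite ltr_pdivrMr// ltr_pMr// ltr1n.
  have [] : (q <= ea /\ q <= eb) /\ (q <= T - a /\ q <= T - b).
    by rewrite !ge_min !lexx ?orbT.
  move=> [qa qb] [qTa qTb]; split; split.
  - exact: lt_le_trans qa.
  - exact: lt_le_trans qb.
  - by rewrite -ltrBrDl (lt_le_trans q2).
  - by rewrite -ltrBrDl (lt_le_trans q2).
pose phi t := jump a e t - jump b e t.
have tphi : time_test_function T phi by exact: time_test_jump.
pose F t := (c - H t) * derive1 phi t.
pose pa t := dstep (e^-1 * (t - a)) * e^-1; pose pb t := dstep (e^-1 * (t - b)) * e^-1.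
have phiE t : derive1 phi t = pa t - pb t by exact: derive_jump_diff.
have ei : 0 < e^-1 by rewrite invr_gt0.
have p0 x t : 0 <= dstep (e^-1 * (t - x)) * e^-1 by rewrite mulr_ge0 ?dstep_ge0 ?ltW.
have rng x t : 0 < e^-1 * (t - x) < 1 = (x < t < x + e).
  by rewrite pmulr_rgt0// subr_gt0 ltr_pdivrMl// mulr1 ltrBlDl.
have hb t : (c - H t) * pb t <= 0.
    have [tb|tb] := boolP (0 < e^-1 * (t - b) < 1); last by rewrite /pb (dstep_eq0 tb) mul0r mulr0.
    rewrite mulr_le0_ge0 ?p0// subr_le0 ltW// bP//.
    move: tb; rewrite rng => /andP[bt tbe].
    by rewrite distrC gtr0_norm ?subr_gt0// ltrBlDl (lt_trans tbe)// ltrD2l.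
have F_ge0 t : 0 <= F t.
  rewrite /F phiE mulrBr subr_ge0; apply: (le_trans (hb t)).
  have [ta|ta] := boolP (0 < e^-1 * (t - a) < 1); last by rewrite /pa (dstep_eq0 ta) mul0r mulr0.
  rewrite mulr_ge0 ?p0// subr_ge0 ltW// aP//.
  move: ta; rewrite rng => /andP[at_ tae].
  by rewrite distrC gtr0_norm ?subr_gt0// ltrBlDl (lt_trans tae)// ltrD2l.
have F_gt0 t : a < t < a + e -> 0 < F t.
  move=> /[dup] ta /andP[at_ tae].
  rewrite /F phiE mulrBr subr_gt0; apply: (le_lt_trans (hb t)).
  apply: mulr_gt0; last by rewrite mulr_gt0// dstep_gt0// rng.
  by rewrite subr_gt0 aP// distrC gtr0_norm ?subr_gt0// ltrBlDl (lt_trans tae)// ltrD2l.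
have cphi' : continuous (derive1 phi).
  have [_ /(_ 1 I)[_ [cD _]]] : Ck_along (setT : set R) 1 phi.
    by apply: Ck_alongB; exact: Ck_along_jump.
  by have -> : derive1 phi = 'D_1 phi by apply/funext => t; rewrite derive1E.
have mI : measurable (`]0, T[%classic : set R) by exact: measurable_itv.
have ic (g : R -> R) : continuous g -> mu1.-integrable `]0, T[ (EFin \o g).
  move=> cg; apply: (@integrableS _ _ _ mu1 `[0, T]%classic) => //.
    by apply: subset_itv; rewrite bnd_simp.
  apply: continuous_compact_integrable; first exact: segment_compact.
  exact: continuous_subspaceT.
have cHphi : continuous (fun t => H t * derive1 phi t).
  by move=> t; apply: cvgM; [exact: cH|exact: cphi'].
have ccphi : continuous (fun t => c * derive1 phi t).
  by move=> t; apply: cvgM; [exact: cvg_cst|exact: cphi'].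
have FE t : F t = c * derive1 phi t - H t * derive1 phi t by rewrite /F mulrBl.
have cF : continuous F.
  by rewrite (_ : F = fun t => c * derive1 phi t - H t * derive1 phi t); [|exact/funext]; move=> t; apply: cvgB; [exact: ccphi|exact: cHphi].
have phi'0 : \int[mu1]_(t in `]0, T[) derive1 phi t = 0.
  have T0 : 0 <= T by rewrite ltW// (lt_trans a0).
  have Cphi1 : Ck_along (setT : set R) 1 phi by apply: Ck_alongB; exact: Ck_along_jump.
  have phi0 x : ~~ (0 < x < T) -> phi x = 0.
    move=> nx; have [_ _ sphi] := tphi.
    apply/eqP/negPn/negP => px; move/negP: nx; apply.
    have : [set t | phi t != 0] x by [].
    by move=> /subset_closure /sphi; rewrite /= in_itv.
  have := integral_derive_compact T0 (Ck_along_continuous Cphi1)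
    (fun x => (Cphi1.2 1 I).1 x) cphi' _.
  rewrite /Rintegral integral_mkcond => I0; rewrite -[RHS]/(fine 0%E) -I0; last first.
    move=> x Tx; apply: phi0; apply/negP => /andP[x0 xT].
    by move: Tx; rewrite gtr0_norm// ltNge ltW.
  congr fine; apply: eq_integral => t _; rewrite patchE; case: ifPn => //.
  rewrite notin_setE/= in_itv/= => /negP nt; rewrite phiE /pa /pb.
  rewrite !dstep_eq0 ?mul0r ?subrr// rng; apply: contra nt => /andP[xt tx].
    by rewrite (lt_trans b0 xt) (lt_trans tx).
  by rewrite (lt_trans a0 xt) (lt_trans tx).
have F0 : \int[mu1]_(t in `]0, T[) F t = 0.
  rewrite (_ : \int[mu1]_(t in `]0, T[) F t =
    \int[mu1]_(t in `]0, T[) (c * derive1 phi t - H t * derive1 phi t)); last first.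
    by apply: eq_Rintegral => t _; exact: FE.
  rewrite RintegralB//; [|exact: ic|exact: ic].
  by rewrite RintegralZl//; [rewrite phi'0 H0// mulr0 subrr|exact: ic].
have F0e : (\int[mu1]_(t in `]0%R, T[) `|(F t)%:E| = 0)%E.
  rewrite (_ : (\int[mu1]_(t in _) _)%E = (\int[mu1]_(t in `]0%R, T[) (F t)%:E)%E); last first.
    by apply: eq_integral => t _; rewrite gee0_abs ?lee_fin.
  rewrite -[LHS]fineK; first exact: (congr1 EFin F0).
  by apply: integrable_fin_num => //; exact: ic.
have mF : measurable_fun `]0, T[ (EFin \o F) by exact: measurable_int (ic F cF).
have /(ae_eq_integral_abs mu1 mI mF).1 := F0e.
move=> [N [mN N0 NP]].
have : (mu1 `]a, (a + e)%R[%classic <= mu1 N)%E.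
  apply: le_measure; [by rewrite inE; exact: measurable_itv|by rewrite inE|].
  move=> t /=; rewrite in_itv/= => ta; apply: NP => /= h.
  have := F_gt0 t ta; move: ta => /andP[at_ tae].
  have : `]0, T[%classic t by rewrite /= in_itv/= (lt_trans a0 at_) (lt_trans tae).
  by move=> /h -[->]; rewrite ltxx.
rewrite N0 lebesgue_measure_itv/= lte_fin ltrDl e0 -EFinB addrAC subrr add0r lee_fin.
by rewrite leNgt e0.
Qed.

End WeaklyConstant.

Lemma weakly_constant {R : realType} (T : R) (H : R -> R) : 0 < T -> continuous H ->
  (forall phi, time_test_function T phi ->
    \int[lebesgue_measure]_(t in `]0, T[) (H t * derive1 phi t) = 0) ->
  H 0 = H T.
Proof.
move=> T0 cH H0.
have Tm : T / 2 \in `]0, T[.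
  by rewrite in_itv/= divr_gt0//= ltr_pdivrMr// ltr_pMr// ltr1n.
have Hm t : t \in `]0, T[ -> H t = H (T / 2).
  by move=> It; apply/eqP; rewrite eq_le !(@weakly_constant_le _ T).
have -> : H 0 = H (T / 2).
  apply: (cvg_unique _ (cvg_at_right_filter (cH 0))) => //.
  apply: cvg_near_cst; near=> t; apply: Hm; rewrite in_itv/=.
  by apply/andP; split; near: t; [exact: nbhs_right_gt|exact: nbhs_right_lt].
apply: (cvg_unique _ _ (cvg_at_left_filter (cH T))) => //.
apply: cvg_near_cst; near=> t; apply: Hm; rewrite in_itv/=.
by apply/andP; split; near: t; [exact: nbhs_left_gt|exact: nbhs_left_lt].
Unshelve. all: by end_near.
Qed.

Section NullIntegral.
Import HBNNSimple.

(** The simple functions below the positive and negative parts of F are measurable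
even when F is not, and vanish almost everywhere. *)
Lemma Rintegral_ae0 {d : measure_display} {X : measurableType d} {R : realType}
    (mu : {measure set X -> \bar R}) (D : set X) (F : X -> R) : measurable D ->
  {ae mu, forall x, D x -> F x = 0} -> \int[mu]_(x in D) F x = 0.
Proof.
move=> mD F0.
have nn0 (f : X -> \bar R) : (forall x, 0 <= f x)%E -> {ae mu, forall x, f x = 0%E} ->
    (\int[mu]_x f x = 0)%E.
  move=> f0 fae; apply/eqP; rewrite eq_le integral_ge0// andbT.
  rewrite ge0_integralTE//.
  apply: ge_ereal_sup => _ [h hf <-].
  rewrite -integralT_nnsfun (_ : integral _ _ _ = 0%E)//.
  rewrite -[RHS](integral0 mu setT); apply: ae_eq_integral => //.
    exact/measurable_EFinP/measurable_funPT.
  apply: filterS fae => x fx0 _ /=; congr EFin; apply/eqP.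
  by rewrite eq_le fun_ge0 andbT; have := hf x; rewrite fx0 lee_fin.
have F0' : {ae mu, forall x, (((fun x => (F x)%:E) \_ D) x = 0)%E}.
  by apply: filterS F0 => x h; rewrite patchE; case: ifPn => // /set_mem /h ->.
rewrite /Rintegral integral_mkcond integralE !nn0 ?sube0//.
- by apply: filterS F0' => x h; rewrite funenegE h oppe0 maxxx.
- by apply: filterS F0' => x h; rewrite funeposE h maxxx.
Qed.

End NullIntegral.

(** * Elements of H^1_0 *)

Section SobolevSpace.
Context {R : realType} {N : nat}.
Notation V := 'rV[R]_N.+1.
Notation leb := (@lebesgue R N.+1).
Variable Omega : set V.
Hypotheses (oO : open Omega) (bO : bounded_set Omega).
Implicit Types (f g v z : V -> R).
Local Notation ip := (L2prod leb Omega).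
Local Notation nm := (L2norm leb Omega).
Let mO : measurable Omega := domain_measurable oO.

Lemma weak_partial_unique i f g g' : is_weak_partial Omega i f g ->
  is_weak_partial Omega i f g' -> {ae leb, forall x, Omega x -> g x = g' x}.
Proof.
move=> [Lg gP] [Lg' gP'].
have : {ae leb, forall x, Omega x -> g x - g' x = 0}.
  apply: (fundamental_lemma oO bO oO (@subset_refl _ Omega) (L2B mO Lg Lg')) => z tz.
  have Lz := test_function_L2 oO bO tz.
  by rewrite (L2prodBl mO Lg Lg' Lz) -[X in X - _]opprK -gP// gP'// opprK subrr.
by apply: filterS => x h /h /eqP; rewrite subr_eq0 => /eqP.
Qed.

Lemma weak_partialP i f g : is_weak_partial Omega i f g ->
  is_weak_partial Omega i f (weak_partial Omega i f).
Proof. by move=> fg; apply: xgetPex; exists g. Qed.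

Lemma weak_partial_ae i f g : is_weak_partial Omega i f g ->
  {ae leb, forall x, Omega x -> weak_partial Omega i f x = g x}.
Proof. by move=> fg; exact: weak_partial_unique (weak_partialP fg) fg. Qed.

Lemma L2norm_ae f g : L2 leb Omega f -> L2 leb Omega g ->
  {ae leb, forall x, Omega x -> f x = g x} -> nm f = nm g.
Proof.
move=> Lf Lg fg; apply/eqP; rewrite -(@eqrXn2 _ 2)// ?L2norm_ge0//; apply/eqP.
rewrite -!L2prod_sqr (L2prod_ae oO Lf Lg Lf fg) L2prodC.
exact: (L2prod_ae oO Lf Lg Lg fg).
Qed.

Lemma test_is_weak_partial i z : test_function Omega z ->
  is_weak_partial Omega i z (partial i z).
Proof.
move=> tz; split; first exact: test_function_L2 (test_function_partial i tz).
by move=> phi tphi; apply: (integration_by_parts_test oO bO) => //; case: tz.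
Qed.

Lemma is_weak_partialB i f f' g g' : L2 leb Omega f -> L2 leb Omega f' ->
  is_weak_partial Omega i f g -> is_weak_partial Omega i f' g' ->
  is_weak_partial Omega i (fun x => f x - f' x) (fun x => g x - g' x).
Proof.
move=> Lf Lf' [Lg gP] [Lg' gP']; split; first exact: L2B.
move=> phi tphi.
have Lphi := test_function_L2 oO bO tphi.
have Lphii := test_function_L2 oO bO (test_function_partial i tphi).
by rewrite (L2prodBl mO Lf Lf' Lphii) (L2prodBl mO Lg Lg' Lphi) gP// gP'// opprD.
Qed.

Lemma H1norm_ge f : nm f <= H1norm Omega f.
Proof.
rewrite /H1norm -[leLHS]ger0_norm ?L2norm_ge0// -sqrtr_sqr ler_wsqrtr//.
by rewrite lerDl sumr_ge0// => i _; rewrite sqr_ge0.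
Qed.

Lemma H1norm_ge_partial f i : nm (weak_partial Omega i f) <= H1norm Omega f.
Proof.
rewrite /H1norm -[leLHS]ger0_norm ?L2norm_ge0// -sqrtr_sqr ler_wsqrtr//.
rewrite (bigD1 i)// addrCA lerDl addr_ge0 ?sqr_ge0// sumr_ge0// => j _.
by rewrite sqr_ge0.
Qed.

Section Limit.
Variables (u_ : nat -> V -> R) (phi : V -> R) (Phi : 'I_N.+1 -> V -> R).
Hypotheses (tu : forall k, test_function Omega (u_ k)).
Hypotheses (Lphi : L2 leb Omega phi) (LPhi : forall i, L2 leb Omega (Phi i)).
Hypothesis cu : nm (fun x => u_ k x - phi x) @[k --> \oo] --> 0.
Hypothesis cp : forall i, nm (fun x => partial i (u_ k) x - Phi i x) @[k --> \oo] --> 0.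

Lemma limit_is_weak_partial i : is_weak_partial Omega i phi (Phi i).
Proof.
by split=> // z tz; exact: (weak_partial_limit oO bO tu Lphi (LPhi i) cu (cp i) tz).
Qed.

(** The derivatives chosen by weak_partial agree almost everywhere with the
limits of the derivatives. *)
Lemma limit_H10 : H10 Omega phi.
Proof.
split; first by split=> // i; exists (Phi i); exact: limit_is_weak_partial.
exists u_ => //.
have Lu k := test_function_L2 oO bO (tu k).
have E k : H1norm Omega (fun x => u_ k x - phi x) =
    Num.sqrt (nm (fun x => u_ k x - phi x) ^+ 2 +
              \sum_i nm (fun x => partial i (u_ k) x - Phi i x) ^+ 2).
  congr (Num.sqrt (_ + _)); apply: eq_bigr => i _; congr (_ ^+ 2).
  have W := is_weak_partialB (Lu k) Lphi (test_is_weak_partial i (tu k)) (limit_is_weak_partial i).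
  apply: L2norm_ae (weak_partial_ae W); [by case: (weak_partialP W)|by case: W].
rewrite (_ : (fun k => _) = (fun k => Num.sqrt (nm (fun x => u_ k x - phi x) ^+ 2 +
              \sum_i nm (fun x => partial i (u_ k) x - Phi i x) ^+ 2))); last exact/funext.
have sq0 (w : nat -> R) : w k @[k --> \oo] --> 0 -> w k ^+ 2 @[k --> \oo] --> 0.
  move=> w0; rewrite -[X in _ --> X](mulr0 0); under eq_fun do rewrite expr2.
  exact: cvgM.
have inner : nm (fun x => u_ k x - phi x) ^+ 2 +
    \sum_i nm (fun x => partial i (u_ k) x - Phi i x) ^+ 2 @[k --> \oo] --> 0.
  rewrite -[X in _ --> X]addr0; apply: cvgD; first exact: sq0.
  suff : \sum_i nm (fun x => partial i (u_ k) x - Phi i x) ^+ 2 @[k --> \oo]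
      --> \sum_(i < N.+1) (0 : R) by rewrite big1.
  apply: cvg_big; first exact: add_continuous.
  by move=> i _; exact: sq0.
have := cvg_comp _ _ inner (@sqrt_continuous R 0).
by rewrite sqrtr0.
Qed.

End Limit.

Lemma H10_approx v : H10 Omega v -> exists p_ : nat -> V -> R,
  [/\ forall k, test_function Omega (p_ k),
      nm (fun x => p_ k x - v x) @[k --> \oo] --> 0 &
      forall i, nm (fun x => partial i (p_ k) x - weak_partial Omega i v x)
        @[k --> \oo] --> 0].
Proof.
move=> [[Lv wv] [p_ tp cp]]; exists p_; split => // [|i].
  apply: (squeeze_cvgr _ (cvg_cst 0) cp); apply: nearW => k.
  by rewrite L2norm_ge0 H1norm_ge.
apply: (squeeze_cvgr _ (cvg_cst 0) cp); apply: nearW => k.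
rewrite L2norm_ge0; apply: le_trans (H1norm_ge_partial _ i).
have [g gP] := wv i; have W1 := weak_partialP gP.
have W := is_weak_partialB (test_function_L2 oO bO (tp k)) Lv (test_is_weak_partial i (tp k)) W1.
rewrite (L2norm_ae _ _ (weak_partial_ae W)) ?lexx//; [by case: (weak_partialP W)|by case: W].
Qed.

Lemma weak_equation_H10 (Phi : 'I_N.+1 -> V -> R) g v :
  (forall i, L2 leb Omega (Phi i)) -> L2 leb Omega g ->
  (forall z, test_function Omega z -> \sum_i ip (Phi i) (partial i z) = ip g z) ->
  H10 Omega v -> \sum_i ip (Phi i) (weak_partial Omega i v) = ip g v.
Proof.
move=> LPhi Lg eqn Hv; have [p_ [tp cp cpi]] := H10_approx Hv.
have [[Lv wv] _] := Hv.
have Lwv i : L2 leb Omega (weak_partial Omega i v).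
  by have [h hP] := wv i; case: (weak_partialP hP).
have Lp k := test_function_L2 oO bO (tp k).
have Lpi i k := test_function_L2 oO bO (test_function_partial i (tp k)).
have c1 : ip (p_ k) g @[k --> \oo] --> ip v g by exact: (L2prod_cvgl mO Lp Lv Lg cp).
have c2 : \sum_i ip (partial i (p_ k)) (Phi i) @[k --> \oo] -->
    \sum_i ip (weak_partial Omega i v) (Phi i).
  apply: cvg_big; first exact: add_continuous.
  by move=> i _; exact: (L2prod_cvgl mO (Lpi i) (Lwv i) (LPhi i) (cpi i)).
rewrite L2prodC; under eq_bigr do rewrite L2prodC.
suff E : (fun k => \sum_i ip (partial i (p_ k)) (Phi i)) = (fun k => ip (p_ k) g).
  by move: c2; rewrite E => c2; exact: (cvg_unique _ c2 c1).
apply/funext => k; rewrite [RHS]L2prodC -(eqn _ (tp k)).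
by apply: eq_bigr => i _; rewrite L2prodC.
Qed.

End SobolevSpace.

(** * Conservation of the weighted mean and the theorem *)

Section Conservation.
Context {R : realType} {N : nat}.
Notation V := 'rV[R]_N.+1.
Notation leb := (@lebesgue R N.+1).
Variables (T : R) (Omega omega : set V) (theta a phi : V -> R) (Phi : 'I_N.+1 -> V -> R).
Hypotheses (T0 : 0 < T) (oO : open Omega) (bO : bounded_set Omega).
Hypotheses (Ctheta : Cinfty_closure Omega theta) (Ca : Cinfty a).
Hypotheses (Hphi : H10 Omega phi) (phiP : forall i, is_weak_partial Omega i phi (Phi i)).
Hypothesis phi_eq : forall z, test_function Omega z ->
  \sum_i L2prod leb Omega (Phi i) (partial i z) = L2prod leb Omega (fun x => a x * phi x) z.
Hypothesis Phi_theta : forall x, Omega x -> theta x * Phi ord0 x = 0.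
Local Notation ip := (L2prod leb Omega).
Local Notation nm := (L2norm leb Omega).
Let mO : measurable Omega := domain_measurable oO.
Let Lphi : L2 leb Omega phi. Proof. by case: Hphi => -[]. Qed.
Let LPhi i : L2 leb Omega (Phi i). Proof. by case: (phiP i). Qed.
Let Lwphi i : L2 leb Omega (weak_partial Omega i phi).
Proof. by case: (weak_partialP (phiP i)). Qed.

(** Delta phi + a phi = 0 kills the first two terms, and d_1 phi = 0 on the support
of theta kills the coupling. *)
Lemma dual_equation_weight v1 v2 : H10 Omega v1 -> H10 Omega v2 ->
  dual_laplacian Omega v2 phi + dual_of_L2 Omega (fun x => a x * v2 x) phi +
  dual_partial Omega ord0 (fun x => theta x * v1 x) phi = 0.
Proof.
move=> [[Lv1 _] _] H2; have [[Lv2 wv2] _] := H2.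
have Lap : L2 leb Omega (fun x => a x * phi x).
  by apply: (continuous_mul_L2 oO bO) => //; exact: Cinfty_continuous.
have -> : dual_laplacian Omega v2 phi = - ip (fun x => a x * phi x) v2.
  apply: (etrans _ (congr1 -%R (weak_equation_H10 oO bO LPhi Lap phi_eq H2))).
  apply: (congr1 -%R).
  apply: eq_bigr => i _; have [h hP] := wv2 i.
  have [Lw _] := weak_partialP hP.
  by rewrite L2prodC (L2prod_ae oO (Lwphi i) (LPhi i) Lw (weak_partial_ae oO bO (phiP i))).
have -> : dual_of_L2 Omega (fun x => a x * v2 x) phi = ip (fun x => a x * phi x) v2.
  by apply: eq_L2prod => x _; rewrite mulrAC.
rewrite addNr add0r /dual_partial.
have [F CF thetaF] := Ctheta.
have tE x : Omega x -> theta x = F x.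
  by move=> Ox; apply: thetaF; apply/mem_set/subset_closure.
have LF : L2 leb Omega (fun x => F x * v1 x).
  by apply: (continuous_mul_L2 oO bO) => //; exact: Cinfty_continuous.
rewrite (_ : ip _ _ = ip (weak_partial Omega ord0 phi) (fun x => F x * v1 x)); last first.
  by rewrite L2prodC; apply: eq_L2prod => x Ox; rewrite tE.
rewrite (L2prod_ae oO (Lwphi ord0) (LPhi ord0) LF (weak_partial_ae oO bO (phiP ord0))).
apply/eqP; rewrite oppr_eq0; apply/eqP; rewrite -[RHS](L2prod0r leb Omega (fun=> 0)).
by apply: eq_L2prod => x Ox; rewrite -tE// mulrA [Phi _ _ * _]mulrC Phi_theta// mul0r mulr0.
Qed.

(** Projection on [0, T], to extend functions of time to the whole line by
continuity. *)
Definition clamp (t : R) : R := Num.max 0 (Num.min t T).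

Lemma clamp_itv t : clamp t \in `[0, T].
Proof. by rewrite in_itv/= le_max lexx ge_max ge_min (ltW T0) lexx orbT. Qed.

Lemma clamp_id t : t \in `[0, T] -> clamp t = t.
Proof.
by rewrite in_itv/= => /andP[t0 tT]; rewrite /clamp (min_idPl tT) (max_idPr t0).
Qed.

Lemma clamp_dist s t : `|clamp t - clamp s| <= `|t - s|.
Proof.
have mono x y d : 0 <= d -> x <= y + d -> clamp x <= clamp y + d.
  move=> d0 xy; have c0 : 0 <= clamp y by rewrite le_max lexx.
  rewrite {1}/clamp ge_max addr_ge0//= ge_min; apply/orP.
  have [yT|Ty] := leP y T; [left|right].
    by apply: (le_trans xy); rewrite lerD2r /clamp (min_idPl yT) le_max lexx orbT.
  apply: (@le_trans _ _ (clamp y)); last by rewrite lerDl.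
  by rewrite /clamp (min_idPr (ltW Ty)) le_max lexx orbT.
rewrite ler_distl; apply/andP; split.
  by rewrite lerBlDr mono// -lerBlDl -normrN opprB ler_norm.
by rewrite mono// -lerBlDl ler_norm.
Qed.

(** The time derivative of the pairing of y2 with phi vanishes almost everywhere,
hence weakly, and the pairing is continuous. *)
Theorem weight_conserved y01 y02 u y1 y2 :
  solution T Omega omega theta a y01 y02 u y1 y2 ->
  [/\ L2 leb Omega (y2 T), L2 leb Omega (y2 0),
      {ae leb, forall x, Omega x -> y2 0 x = y02 x} & ip (y2 T) phi = ip (y2 0) phi].
Proof.
move=> [g1 [g2 [[W1 W2] [_ c2] _ eq2 init]]].
have I0 : (0 : R) \in `[0, T] by rewrite in_itv/= lexx ltW.
have IT : T \in `[0, T] by rewrite in_itv/= lexx andbT ltW.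
have Ly t : L2 leb Omega (y2 (clamp t)) by case: (c2 _ (clamp_itv t)).
split; [by case: (c2 _ IT)|by case: (c2 _ I0)| |].
  by apply: filterS init => x h /h[].
pose H t := ip (y2 (clamp t)) phi.
have -> : ip (y2 T) phi = H T by rewrite /H clamp_id.
have -> : ip (y2 0) phi = H 0 by rewrite /H clamp_id.
apply: esym; apply: weakly_constant => //.
  move=> t; apply/cvgrPdist_le => e e0.
  have [_ ct] := c2 _ (clamp_itv t).
  have d0 : 0 < e / (nm phi + 1) by rewrite divr_gt0// ltr_wpDl// L2norm_ge0.
  have /cvgrPdist_le/(_ _ d0) := ct.
  move=> /nbhs_ballP[r r0 rP]; apply/nbhs_ballP; exists r => // s st.
  have := rP (clamp s); rewrite /= sub0r normrN ger0_norm ?L2norm_ge0// => h.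
  have {}h := h (le_lt_trans (clamp_dist _ _) st) (clamp_itv s).
  rewrite /H -(L2prodBl mO (Ly t) (Ly s) Lphi).
  apply: (le_trans (L2prod_CauchySchwarz mO (L2B mO (Ly t) (Ly s)) Lphi)).
  rewrite L2norm_distC; apply: (@le_trans _ _ (e / (nm phi + 1) * nm phi)).
    by rewrite ler_wpM2r ?L2norm_ge0.
  by rewrite mulrAC ler_pdivrMr ?ltr_wpDl ?L2norm_ge0// ler_wpM2l ?(ltW e0)// lerDl.
move=> psi tpsi; have [[E1 _ _] _ _] := W1; have [[E2 _ _] _ tder] := W2.
have rhs0 : \int[@lebesgue_measure R]_(t in `]0, T[) (g2 t phi * psi t) = 0.
  apply: Rintegral_ae0; first exact: measurable_itv.
  have mu1F := ae_filter_ringOfSetsType (@lebesgue_measure R).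
  apply: (@filterS3 _ _ mu1F) eq2 E1 E2 => t h h1 h2 It.
  by rewrite (etrans (h It phi Hphi) (dual_equation_weight (h1 It) (h2 It))) mul0r.
apply: (etrans _ (etrans (tder _ tpsi _ Hphi) (etrans (congr1 -%R rhs0) (oppr0 _)))).
apply: eq_Rintegral => t /set_mem/= It.
rewrite /H clamp_id//; move: It; rewrite !in_itv/= => /andP[t0 tT].
by rewrite !ltW.
Qed.

End Conservation.

Theorem theorem2 (R : realType) (N : nat) (T : R)
    (Omega omega omega1 : set 'rV[R]_N.+1) (theta : 'rV[R]_N.+1 -> R)
    (hT : 0 < T)
    (hOmega : bounded_domain Omega) (hC2 : class_C2 Omega)
    (homega_open : open omega) (homega_neq0 : omega !=set0)
    (homega : compactly_included omega Omega)
    (homega1_open : open omega1) (homega1_neq0 : omega1 !=set0)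
    (homega1_reg : regopen omega1)
    (homega_omega1 : compactly_included omega omega1)
    (homega1_Omega : compactly_included omega1 Omega)
    (htheta : Cinfty_closure Omega theta)
    (htheta1 : forall x, omega x -> theta x = 1)
    (htheta_supp : supp_in Omega theta `<=` closure omega1)
    (htheta_gt0 : forall x, omega1 x -> 0 < theta x) :
  exists a : 'rV[R]_N.+1 -> R, Cinfty_closure Omega a /\
    ~ approximately_controllable T Omega omega theta a /\
    ~ null_controllable T Omega omega theta a.
Proof.
have [oO cO _ bO] := hOmega; have [cO1 O1O] := homega1_Omega.
have mO : measurable Omega := domain_measurable oO.
have [a [phi [Phi [u_ [Ca [Lphi LPhi tu] [cu cp] phi1 phi_eq]]]]] :=
  harmonic_weight ord0 oO bO cO homega1_open homega1_neq0 cO1 O1O.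
have Hphi : H10 Omega phi := limit_H10 oO bO tu Lphi LPhi cu cp.
have phiP := limit_is_weak_partial oO bO tu Lphi LPhi cu cp.
have Phi_theta x : Omega x -> theta x * Phi ord0 x = 0.
  move=> Ox; have [cx|ncx] := pselect (closure omega1 x).
    by rewrite (phi1 x cx).2 mulr0.
  have [->|tx] := eqVneq (theta x) 0; first by rewrite mul0r.
  case: ncx; apply: htheta_supp; apply: subset_closure; split => //.
  exact: subset_closure.
have cons := weight_conserved (omega := omega) hT oO bO htheta Ca Hphi phiP phi_eq Phi_theta.
have phi_gt0 : 0 < L2norm (lebesgue N.+1) Omega phi.
  rewrite lt0r L2norm_ge0 andbT -sqrf_eq0 -L2prod_sqr gt_eqF//.
  have [z Oz] := homega1_neq0.
  have [r r0 rO] := open_contains_ball homega1_open Oz.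
  have ball1 y : ball z r y -> closure omega1 y by move=> /rO; exact: subset_closure.
  apply: (@integral_gt0 R N.+1 Omega (fun x => phi x * phi x) z r 1) => //.
  - exact: L2_mul_integrable.
  - by move=> y _; rewrite -expr2 sqr_ge0.
  - by move=> y /ball1 /O1O.
  - by move=> y /ball1 /phi1[-> _]; rewrite mulr1.
exists a; split; first by exists a.
split=> [ctrl|ctrl].
- have L0 := @L2_0 _ _ _ (lebesgue N.+1) Omega mO.
  have e0 : 0 < L2norm (lebesgue N.+1) Omega phi / 2 by rewrite divr_gt0.
  have [u [y1 [y2 [_ sol small]]]] := ctrl _ _ _ _ L0 L0 L0 Lphi _ e0.
  have [LT L20 init E] := cons _ _ _ _ _ sol.
  have {}E := etrans E (etrans (L2prod_ae oO L20 L0 Lphi init)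
    (etrans (L2prodC _ _ _ _) (L2prod0r _ _ _))).
  have LD := L2B mO LT Lphi.
  have D : L2norm (lebesgue N.+1) Omega (fun x => y2 T x - phi x) <=
      L2norm (lebesgue N.+1) Omega phi / 2.
    apply: le_trans small; rewrite -[leLHS]ger0_norm ?L2norm_ge0// -sqrtr_sqr ler_wsqrtr//.
    by rewrite lerDr sqr_ge0.
  have := L2prod_CauchySchwarz mO LD Lphi.
  rewrite (L2prodBl mO LT Lphi Lphi) E sub0r normrN L2prod_sqr ger0_norm ?sqr_ge0//.
  rewrite expr2 ler_pM2r// => h; have := le_trans h D.
  by rewrite ler_pdivlMr// mulr_natr mulr2n gerDl leNgt phi_gt0.
- have L0 := @L2_0 _ _ _ (lebesgue N.+1) Omega mO.
  have [u [y1 [y2 [_ sol fin]]]] := ctrl _ _ L0 Lphi.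
  have [LT L20 init E] := cons _ _ _ _ _ sol.
  have fin2 : {ae lebesgue N.+1, forall x, Omega x -> y2 T x = 0}.
    by apply: filterS fin => x h /h[].
  have ET := etrans (L2prod_ae oO LT L0 Lphi fin2) (etrans (L2prodC _ _ _ _) (L2prod0r _ _ _)).
  have := etrans (etrans (esym (L2prod_ae oO L20 Lphi Lphi init)) (esym E)) ET.
  rewrite L2prod_sqr => /eqP.
  by rewrite sqrf_eq0 gt_eqF.
Qed.
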